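(* Let $K=D(\delta_1)\cap H^\infty(\mathbb{D})$. The set of multiplicative linear functionals on $K$ consisting of evaluations $f\mapsto f(z)$ at points $z\in\mathbb{D}\cup\{1\}$ is dense in the maximal ideal space of $K$.
   Context: $\mathbb{D}$ is the open unit disc. $D(\delta_1)$ is the space of $f\in H^2(\mathbb{D})$ such that $f=f(1)+(z-1)g$ for some constant $f(1)$ and some $g\in H^2(\mathbb{D})$ (equivalently $\int_{\mathbb{D}}|f'(z)|^2\frac{1-|z|^2}{|1-z|^2}dA(z)<\infty$), with norm $\|f\|^2_{D(\delta_1)}=\|f\|_{H^2}^2+\|g\|_{H^2}^2$; here $f(1)=\lim_{r\to1^-}f(r)$. $K$ is a Banach algebra with norm $\|f\|_K=\|f\|_{D(\delta_1)}+\|f\|_\infty$; its maximal ideal space is the set of nonzero multiplicative linear functionals with the weak-* topology. *)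

(* Defs.v *)
From Stdlib Require Import Reals ClassicalEpsilon.
From Coquelicot Require Import Coquelicot.
Open Scope R_scope.
Open Scope C_scope.

Definition inD (z : C) : Prop := (Cmod z < 1)%R.

(* Elements of K are modelled as functions C -> C that vanish off the disc
   (so that two elements are equal iff they agree on D; algebra operations
   are pointwise). *)
Definition supp_D (f : C -> C) : Prop := forall z, ~ inD z -> f z = 0.

Definition inH2 (f : C -> C) : Prop :=
  exists a : nat -> C,
    ex_series (fun n => (Cmod (a n) ^ 2)%R) /\
    forall z, inD z -> @is_pseries C_AbsRing C_NormedModule a z (f z).

(* H^infinity: bounded on D (holomorphy is provided by the H^2 condition). *)
Definition bounded_D (f : C -> C) : Prop :=
  exists M : R, forall z, inD z -> (Cmod (f z) <= M)%R.

Definition inDdelta1 (f : C -> C) : Prop :=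
  inH2 f /\ exists (c : C) (g : C -> C), inH2 g /\
    forall z, inD z -> f z = c + (z - 1) * g z.

Definition inK (f : C -> C) : Prop := supp_D f /\ inDdelta1 f /\ bounded_D f.

(* f(1) := lim_{r -> 1^-} f(r) (chosen via epsilon; unique when it exists). *)
Definition val1 (f : C -> C) : C :=
  epsilon (inhabits (RtoC 0%R))
    (fun c => filterlim (fun r : R => f (RtoC r)) (at_left 1%R) (locally c)).

Definition ptval (f : C -> C) (z : C) : C :=
  if excluded_middle_informative (z = RtoC 1%R) then val1 f else f z.

(* Nonzero multiplicative C-linear functionals on K (points of the maximal
   ideal space). *)
Definition is_character (phi : (C -> C) -> C) : Prop :=
  (forall f g, inK f -> inK g -> phi (fun z => f z + g z) = phi f + phi g) /\
  (forall (c : C) f, inK f -> phi (fun z => c * f z) = c * phi f) /\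
  (forall f g, inK f -> inK g -> phi (fun z => f z * g z) = phi f * phi g) /\
  (exists f, inK f /\ phi f <> 0).

(* Main.v *)
(* The heart is Carleson's corona theorem. Let phi be a character and I the
   ideal of all u = (z - 1) g in K. If phi vanishes on I it is evaluation
   at 1. Otherwise fix u in I with phi u <> 0; if no point of the disc is close
   to phi, then F_i = f_i - phi f_i satisfy sum |F_i|^2 >= eps^2, a corona
   solution sum F_i H_i = 1 has u H_i in K, and phi u = sum phi(F_i) phi(u H_i) = 0.

   The corona solution is obtained without boundary values or area integrals:
   - For polynomials F_i and f let p_i be the analytic and G_i the conjugate of
     the antianalytic part of (conj F_i) f on the circle. Since
     q_ik = G_i F_k - G_k F_i is controlled on the circle by p, and the
     Laplacian of psi = f sum G_i conj F_i / |F|^2 by the Laplacian of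
     (1 + |F|^2)|f|^2 and (1 + |F|^2)|q_ik|^2 (Wolff's estimates), a
     combination of the latter minus Re psi is subharmonic; averaging it over
     roots of unity, the maximum principle gives |f|^2 <= C sum |p_i|^2.
   - Hence sum T_i T_i^* >= c^2 for the lower triangular Toeplitz matrices of
     the F_i of any size N. The lurking isometry argument turns this
     into lower triangular Toeplitz solutions h of sum F_i h_i = 1 mod z^N
     with a norm bound independent of N, and N tends to infinity along a
     diagonal subsequence. *)

Require Import Defs.
From Stdlib Require Import Reals ClassicalEpsilon Lra Lia FunctionalExtensionality Cantor.
From Coquelicot Require Import Coquelicot.
Open Scope R_scope.
Open Scope C_scope.

(** * Finite sums *)

(** A corona solution H_i is only a bounded multiplier of H^2; it need not have a value at 1 and may
    lie outside K. Inside the ideal of functions (z - 1) g this does no harm, because multiplication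
    by H_i maps that ideal into itself.

    The classical argument integrates Laplacians over the disc and invokes Carleson measures. Here
    one pointwise fact replaces both: |F'| |g| is controlled by the Laplacian of (1 + |F|^2)|g|^2,
    although |F'| alone has no bound near the circle. The Laplacian of psi is bilinear in f and the
    q_ik, and a free weight s splits its terms. The part in f has to be small, since on the circle
    it is absorbed by |f|^2; the part in q_ik may be large, since there it is bounded by the p_i. As
    G_i(0) = 0, psi vanishes at the origin and the test function is nonnegative there, so its sum
    over rotations cannot be negative on the whole circle.

    All constants depend only on n, M and m. Each limit (degree, radius, matrix size N) is therefore
    taken in an inequality between finitely many coefficients. *)

Fixpoint csum (n : nat) (u : nat -> C) : C :=
  match n with O => 0 | S n => csum n u + u n end.

Fixpoint rsum (n : nat) (u : nat -> R) : R :=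
  match n with O => 0%R | S n => (rsum n u + u n)%R end.

Lemma csum_ext (n : nat) (u v : nat -> C) :
  (forall k, (k < n)%nat -> u k = v k) -> csum n u = csum n v.
Proof.
  induction n as [|n IH]; intros H; simpl; auto.
  rewrite IH, H; auto.
Qed.

Lemma csum_plus (n : nat) (u v : nat -> C) :
  csum n (fun k => u k + v k) = csum n u + csum n v.
Proof. induction n as [|n IH]; simpl; [|rewrite IH]; ring. Qed.

Lemma csum_minus (n : nat) (u v : nat -> C) :
  csum n (fun k => u k - v k) = csum n u - csum n v.
Proof. induction n as [|n IH]; simpl; [|rewrite IH]; ring. Qed.

Lemma csum_scal_l (n : nat) (c : C) (u : nat -> C) :
  csum n (fun k => c * u k) = c * csum n u.
Proof. induction n as [|n IH]; simpl; [|rewrite IH]; ring. Qed.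

Lemma csum_scal_r (n : nat) (c : C) (u : nat -> C) :
  csum n (fun k => u k * c) = csum n u * c.
Proof. induction n as [|n IH]; simpl; [|rewrite IH]; ring. Qed.

Lemma csum_conj (n : nat) (u : nat -> C) :
  Cconj (csum n u) = csum n (fun k => Cconj (u k)).
Proof.
  induction n as [|n IH]; simpl.
  - apply injective_projections; simpl; ring.
  - now rewrite Cplus_conj, IH.
Qed.

Lemma csum_0 (n : nat) (u : nat -> C) :
  (forall k, (k < n)%nat -> u k = 0) -> csum n u = 0.
Proof.
  induction n as [|n IH]; intros H; simpl; auto.
  rewrite IH, H by auto. ring.
Qed.

Lemma csum_swap (n m : nat) (u : nat -> nat -> C) :
  csum n (fun j => csum m (fun k => u j k)) =
  csum m (fun k => csum n (fun j => u j k)).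
Proof.
  induction n as [|n IH]; simpl.
  - now rewrite csum_0.
  - now rewrite IH, csum_plus.
Qed.

Lemma csum_first (n : nat) (u : nat -> C) :
  csum (S n) u = u O + csum n (fun k => u (S k)).
Proof.
  induction n as [|n IH]; [simpl; ring|].
  change (csum (S (S n)) u) with (csum (S n) u + u (S n)).
  rewrite IH. simpl. ring.
Qed.

Lemma csum_app (n m : nat) (u : nat -> C) :
  csum (n + m) u = csum n u + csum m (fun k => u (n + k)%nat).
Proof.
  induction m as [|m IH].
  - rewrite Nat.add_0_r. simpl. ring.
  - rewrite Nat.add_succ_r. simpl. rewrite IH. ring.
Qed.

Lemma csum_trunc (n d : nat) (u : nat -> C) :
  (n <= d)%nat -> (forall k, (n <= k < d)%nat -> u k = 0) ->
  csum d u = csum n u.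
Proof.
  intros Hnd H. replace d with (n + (d - n))%nat by lia.
  rewrite csum_app, (csum_0 (d - n)); [ring|].
  intros k Hk. apply H. lia.
Qed.

Lemma csum_delta (n m : nat) (u : nat -> C) :
  (m < n)%nat ->
  csum n (fun k => if Nat.eqb k m then u k else 0) = u m.
Proof.
  intros H. rewrite (csum_trunc (S m)); [|lia|].
  - simpl. rewrite Nat.eqb_refl, csum_0; [ring|].
    intros k Hk. case Nat.eqb_spec; [lia|auto].
  - intros k Hk. case Nat.eqb_spec; [lia|auto].
Qed.

Lemma rsum_ext (n : nat) (u v : nat -> R) :
  (forall k, (k < n)%nat -> u k = v k) -> rsum n u = rsum n v.
Proof.
  induction n as [|n IH]; intros H; simpl; auto.
  rewrite IH, H; auto.
Qed.

Lemma rsum_plus (n : nat) (u v : nat -> R) :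
  rsum n (fun k => u k + v k)%R = (rsum n u + rsum n v)%R.
Proof. induction n as [|n IH]; simpl; [|rewrite IH]; ring. Qed.

Lemma rsum_scal_l (n : nat) (c : R) (u : nat -> R) :
  rsum n (fun k => c * u k)%R = (c * rsum n u)%R.
Proof. induction n as [|n IH]; simpl; [|rewrite IH]; ring. Qed.

Lemma rsum_const (n : nat) (c : R) : rsum n (fun _ => c) = (INR n * c)%R.
Proof.
  induction n as [|n IH]; simpl rsum; [simpl; ring|].
  rewrite IH, S_INR. ring.
Qed.

Lemma rsum_le (n : nat) (u v : nat -> R) :
  (forall k, (k < n)%nat -> (u k <= v k)%R) -> (rsum n u <= rsum n v)%R.
Proof.
  induction n as [|n IH]; intros H; simpl; [lra|].
  apply Rplus_le_compat; auto.
Qed.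

Lemma rsum_ge_0 (n : nat) (u : nat -> R) :
  (forall k, (k < n)%nat -> (0 <= u k)%R) -> (0 <= rsum n u)%R.
Proof.
  intros H. replace 0%R with (rsum n (fun _ => 0%R)).
  - now apply rsum_le.
  - rewrite rsum_const. ring.
Qed.

Lemma rsum_ge_term (n m : nat) (u : nat -> R) :
  (forall k, (k < n)%nat -> (0 <= u k)%R) -> (m < n)%nat ->
  (u m <= rsum n u)%R.
Proof.
  induction n as [|n IH]; intros H Hm; [lia|]. simpl.
  destruct (Nat.eq_dec m n) as [->|Hne].
  - pose proof (rsum_ge_0 n u). assert (0 <= rsum n u)%R by auto. lra.
  - assert (0 <= u n)%R by auto. assert (u m <= rsum n u)%R by (apply IH; auto; lia).
    lra.
Qed.

Lemma rsum_swap (n m : nat) (u : nat -> nat -> R) :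
  rsum n (fun j => rsum m (fun k => u j k)) =
  rsum m (fun k => rsum n (fun j => u j k)).
Proof.
  induction n as [|n IH]; simpl.
  - rewrite rsum_const. ring.
  - now rewrite IH, rsum_plus.
Qed.

Lemma rsum_mono_len (n m : nat) (u : nat -> R) :
  (forall k, (0 <= u k)%R) -> (n <= m)%nat -> (rsum n u <= rsum m u)%R.
Proof.
  intros H Hnm. induction Hnm as [|m Hnm IH]; simpl; [lra|].
  specialize (H m). lra.
Qed.

Lemma RtoC_rsum (n : nat) (u : nat -> R) :
  RtoC (rsum n u) = csum n (fun k => RtoC (u k)).
Proof. induction n as [|n IH]; simpl; auto. now rewrite RtoC_plus, IH. Qed.

Lemma Re_csum (n : nat) (u : nat -> C) :
  Re (csum n u) = rsum n (fun k => Re (u k)).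
Proof. induction n as [|n IH]; simpl; auto. now rewrite <- IH. Qed.

Lemma Cmod_csum_le (n : nat) (u : nat -> C) :
  (Cmod (csum n u) <= rsum n (fun k => Cmod (u k)))%R.
Proof.
  induction n as [|n IH]; simpl; [rewrite Cmod_0; lra|].
  eapply Rle_trans; [apply Cmod_triangle|lra].
Qed.

Lemma Cconj_RtoC (r : R) : Cconj (RtoC r) = RtoC r.
Proof. apply injective_projections; simpl; ring. Qed.

Lemma Re_le_Cmod (c : C) : (Re c <= Cmod c)%R.
Proof. eapply Rle_trans; [apply Rle_abs|apply re_le_Cmod]. Qed.

Lemma Cmod_triangle_minus (x y : C) : (Cmod (x - y) <= Cmod x + Cmod y)%R.
Proof.
  unfold Cminus. rewrite <- (Cmod_opp y). apply Cmod_triangle.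
Qed.

Lemma Cmod_triangle_rev (x y : C) : (Cmod x - Cmod y <= Cmod (x - y))%R.
Proof.
  replace x with ((x - y) + y) at 1 by ring.
  pose proof (Cmod_triangle (x - y) y). lra.
Qed.

Lemma Cmod_sqr_plus_le (x y : C) :
  (Cmod (x + y) ^ 2 <= 2 * Cmod x ^ 2 + 2 * Cmod y ^ 2)%R.
Proof.
  pose proof (Cmod_triangle x y). pose proof (Cmod_ge_0 (x + y)).
  pose proof (Cmod_ge_0 x). pose proof (Cmod_ge_0 y).
  assert (Cmod (x + y) ^ 2 <= (Cmod x + Cmod y) ^ 2)%R by (apply pow_incr; lra).
  pose proof (pow2_ge_0 (Cmod x - Cmod y)). lra.
Qed.

Lemma Re_plus (x y : C) : Re (x + y) = (Re x + Re y)%R.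
Proof. reflexivity. Qed.

Lemma Re_minus (x y : C) : Re (x - y) = (Re x - Re y)%R.
Proof. reflexivity. Qed.

(** * Second-order expansions *)

Definition OO (p : nat) (e : C -> C) : Prop :=
  exists K r : R, (0 <= K)%R /\ (0 < r)%R /\
    forall h, (Cmod h < r)%R -> (Cmod (e h) <= K * Cmod h ^ p)%R.

Lemma OO_ext (p : nat) (e e' : C -> C) :
  (forall h, e h = e' h) -> OO p e -> OO p e'.
Proof.
  intros H (K & r & HK & Hr & Hb). exists K, r. repeat split; auto.
  intros h Hh. rewrite <- H. auto.
Qed.

Lemma OO_plus (p : nat) (e e' : C -> C) :
  OO p e -> OO p e' -> OO p (fun h => e h + e' h).
Proof.
  intros (K & r & HK & Hr & H) (K' & r' & HK' & Hr' & H').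
  exists (K + K')%R, (Rmin r r'). repeat split; [lra|now apply Rmin_pos|].
  intros h Hh.
  assert (H1 := H h (Rlt_le_trans _ _ _ Hh (Rmin_l _ _))).
  assert (H2 := H' h (Rlt_le_trans _ _ _ Hh (Rmin_r _ _))).
  pose proof (Cmod_triangle (e h) (e' h)). lra.
Qed.

Lemma OO_mult (p q : nat) (e e' : C -> C) :
  OO p e -> OO q e' -> OO (p + q) (fun h => e h * e' h).
Proof.
  intros (K & r & HK & Hr & H) (K' & r' & HK' & Hr' & H').
  exists (K * K')%R, (Rmin r r'). repeat split; [nra|now apply Rmin_pos|].
  intros h Hh.
  assert (H1 := H h (Rlt_le_trans _ _ _ Hh (Rmin_l _ _))).
  assert (H2 := H' h (Rlt_le_trans _ _ _ Hh (Rmin_r _ _))).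
  rewrite Cmod_mult, pow_add.
  replace (K * K' * (Cmod h ^ p * Cmod h ^ q))%R
    with ((K * Cmod h ^ p) * (K' * Cmod h ^ q))%R by ring.
  apply Rmult_le_compat; auto using Cmod_ge_0.
Qed.

Lemma OO_weaken (p q : nat) (e : C -> C) : (q <= p)%nat -> OO p e -> OO q e.
Proof.
  intros Hqp (K & r & HK & Hr & H).
  exists K, (Rmin r 1). repeat split; [auto|apply Rmin_pos; lra|].
  intros h Hh.
  assert (H1 := H h (Rlt_le_trans _ _ _ Hh (Rmin_l _ _))).
  assert (H2 := Rlt_le_trans _ _ _ Hh (Rmin_r _ _)).
  eapply Rle_trans; [exact H1|]. apply Rmult_le_compat_l; auto.
  replace p with (q + (p - q))%nat by lia. rewrite pow_add.
  assert (0 <= Cmod h ^ q)%R by (apply pow_le, Cmod_ge_0).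
  assert (Cmod h ^ (p - q) <= 1)%R.
  { rewrite <- (pow1 (p - q)). apply pow_incr.
    pose proof (Cmod_ge_0 h). lra. }
  nra.
Qed.

Lemma OO_const (c : C) : OO 0 (fun _ => c).
Proof.
  exists (Cmod c), 1%R. repeat split; [apply Cmod_ge_0|lra|].
  intros. simpl. lra.
Qed.

Lemma OO_id : OO 1 (fun h => h).
Proof. exists 1%R, 1%R. repeat split; try lra. intros. simpl. lra. Qed.

Lemma OO_conj (p : nat) (e : C -> C) : OO p e -> OO p (fun h => Cconj (e h)).
Proof.
  intros (K & r & HK & Hr & H). exists K, r. repeat split; auto.
  intros h Hh. rewrite Cmod_conj. auto.
Qed.

Lemma OO_scal (p : nat) (c : C) (e : C -> C) : OO p e -> OO p (fun h => c * e h).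
Proof. intros H. apply (OO_mult 0 p); auto using OO_const. Qed.

Lemma OO_0 (p : nat) : OO p (fun _ => 0).
Proof.
  exists 0%R, 1%R. repeat split; try lra. intros. rewrite Cmod_0. lra.
Qed.

(** * Second-order jets and their arithmetic *)

Record jet := Jet { j0 : C; jz : C; jb : C; jzz : C; jzb : C; jbb : C }.

Definition jlin (J : jet) (h : C) : C := jz J * h + jb J * Cconj h.
Definition jquad (J : jet) (h : C) : C :=
  jzz J * (h * h) + jzb J * (h * Cconj h) + jbb J * (Cconj h * Cconj h).
Definition jev (J : jet) (h : C) : C := j0 J + jlin J h + jquad J h.

(* The second-order Taylor expansion at z in the variables h and its
   conjugate; [jzb] is the value at z of the mixed derivative, a quarter of
   the Laplacian. *)
Definition hasjet (f : C -> C) (z : C) (J : jet) : Prop :=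
  OO 3 (fun h => f (z + h) - jev J h).

Lemma OO_jlin (J : jet) : OO 1 (jlin J).
Proof.
  apply OO_plus; apply OO_scal; [|apply OO_conj]; apply OO_id.
Qed.

Lemma OO_jquad (J : jet) : OO 2 (jquad J).
Proof.
  assert (Hc : OO 1 Cconj) by apply (OO_conj 1 _ OO_id).
  repeat apply OO_plus; apply OO_scal; apply (OO_mult 1 1); auto using OO_id.
Qed.

Lemma OO_jev (J : jet) : OO 0 (jev J).
Proof.
  apply OO_plus; [apply OO_plus; [apply OO_const|]|].
  - apply (OO_weaken 1); [lia|apply OO_jlin].
  - apply (OO_weaken 2); [lia|apply OO_jquad].
Qed.

Lemma hasjet_OO_0 (f : C -> C) (z : C) (J : jet) :
  hasjet f z J -> OO 0 (fun h => f (z + h)).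
Proof.
  intros H. apply (OO_ext 0 (fun h => (f (z + h) - jev J h) + jev J h)).
  - intros h. ring.
  - apply OO_plus; [apply (OO_weaken 3); [lia|exact H]|apply OO_jev].
Qed.

Lemma hasjet_OO_1 (f : C -> C) (z : C) (J : jet) :
  hasjet f z J -> OO 1 (fun h => f (z + h) - j0 J).
Proof.
  intros H.
  apply (OO_ext 1 (fun h => (f (z + h) - jev J h) + (jlin J h + jquad J h))).
  - intros h. unfold jev. ring.
  - apply OO_plus; [apply (OO_weaken 3); [lia|exact H]|].
    apply OO_plus; [apply OO_jlin|apply (OO_weaken 2); [lia|apply OO_jquad]].
Qed.

Lemma hasjet_ext (f g : C -> C) (z : C) (J : jet) :
  (forall w, f w = g w) -> hasjet f z J -> hasjet g z J.
Proof. intros H. apply OO_ext. intros h. now rewrite H. Qed.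

Definition jadd (J K : jet) : jet :=
  Jet (j0 J + j0 K) (jz J + jz K) (jb J + jb K)
      (jzz J + jzz K) (jzb J + jzb K) (jbb J + jbb K).

Definition jmul (J K : jet) : jet :=
  Jet (j0 J * j0 K) (j0 J * jz K + jz J * j0 K) (j0 J * jb K + jb J * j0 K)
      (j0 J * jzz K + jz J * jz K + jzz J * j0 K)
      (j0 J * jzb K + jz J * jb K + jb J * jz K + jzb J * j0 K)
      (j0 J * jbb K + jb J * jb K + jbb J * j0 K).

Definition jconj (J : jet) : jet :=
  Jet (Cconj (j0 J)) (Cconj (jb J)) (Cconj (jz J))
      (Cconj (jbb J)) (Cconj (jzb J)) (Cconj (jzz J)).

Definition jconst (c : C) : jet := Jet c 0 0 0 0 0.

Definition jinv (J : jet) : jet :=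
  let c := / j0 J in
  Jet c (- (c * c * jz J)) (- (c * c * jb J))
      (c * c * c * (jz J * jz J) - c * c * jzz J)
      (2 * (c * c * c * (jz J * jb J)) - c * c * jzb J)
      (c * c * c * (jb J * jb J) - c * c * jbb J).

Lemma hasjet_const (c z : C) : hasjet (fun _ => c) z (jconst c).
Proof.
  apply (OO_ext 3 (fun _ => 0)); [|apply OO_0].
  intros h. unfold jev, jlin, jquad. simpl. ring.
Qed.

Lemma hasjet_plus (f g : C -> C) (z : C) (J K : jet) :
  hasjet f z J -> hasjet g z K -> hasjet (fun w => f w + g w) z (jadd J K).
Proof.
  intros Hf Hg. eapply OO_ext; [|exact (OO_plus 3 _ _ Hf Hg)].
  intros h. unfold jev, jlin, jquad. simpl. ring.
Qed.

Lemma hasjet_mult (f g : C -> C) (z : C) (J K : jet) :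
  hasjet f z J -> hasjet g z K -> hasjet (fun w => f w * g w) z (jmul J K).
Proof.
  intros Hf Hg.
  (* The last bracket collects the products of the two jets of degree three and four, which [jmul]
     drops. *)
  apply (OO_ext 3 (fun h =>
    ((f (z + h) - jev J h) * g (z + h) + jev J h * (g (z + h) - jev K h)) +
    (jlin J h * jquad K h + (jquad J h * jlin K h + jquad J h * jquad K h)))).
  - intros h. unfold jev, jlin, jquad. simpl. ring.
  - apply OO_plus; apply OO_plus.
    + apply (OO_mult 3 0); [exact Hf|now apply hasjet_OO_0 in Hg].
    + apply (OO_mult 0 3); [apply OO_jev|exact Hg].
    + apply (OO_mult 1 2); [apply OO_jlin|apply OO_jquad].
    + apply OO_plus.
      * apply (OO_mult 2 1); [apply OO_jquad|apply OO_jlin].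
      * apply (OO_weaken 4); [lia|].
        apply (OO_mult 2 2); apply OO_jquad.
Qed.

Lemma hasjet_conj (f : C -> C) (z : C) (J : jet) :
  hasjet f z J -> hasjet (fun w => Cconj (f w)) z (jconj J).
Proof.
  intros Hf. eapply OO_ext; [|exact (OO_conj 3 _ Hf)].
  intros h. unfold jev, jlin, jquad. simpl.
  rewrite Cminus_conj, !Cplus_conj, !Cmult_conj, !Cconj_conj. ring.
Qed.

(** Reduced to the product rule: [jmul J (jinv J)] is the jet of 1, so f times the polynomial
    [jev (jinv J)] is 1 + O(|h|^3). Dividing by f, which is bounded below near z, costs only a
    constant. *)
Lemma hasjet_inv (f : C -> C) (z : C) (J : jet) :
  j0 J <> 0 -> hasjet f z J -> hasjet (fun w => / f w) z (jinv J).
Proof.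
  intros HJ Hf.
  assert (Hg : hasjet (fun w => jev (jinv J) (w - z)) z (jinv J)).
  { apply (OO_ext 3 (fun _ => 0)); [|apply OO_0].
    intros h. replace (z + h - z) with h by ring. ring. }
  pose proof (hasjet_mult _ _ _ _ _ Hf Hg) as Hp.
  assert (H1 : jmul J (jinv J) = jconst 1).
  { unfold jmul, jinv, jconst. simpl.
    f_equal; field; auto. }
  rewrite H1 in Hp.
  assert (Hlow : exists r, (0 < r)%R /\ forall h, (Cmod h < r)%R ->
            (Cmod (j0 J) / 2 <= Cmod (f (z + h)%C))%R).
  { destruct (hasjet_OO_1 _ _ _ Hf) as (K & r & HK & Hr & H).
    assert (Hc : (0 < Cmod (j0 J))%R) by now apply Cmod_gt_0.
    exists (Rmin r (Cmod (j0 J) / 2 / (K + 1))). split.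
    - apply Rmin_pos; auto. apply Rdiv_lt_0_compat; lra.
    - intros h Hh.
      assert (H2 := H h (Rlt_le_trans _ _ _ Hh (Rmin_l _ _))).
      assert (H3 := Rlt_le_trans _ _ _ Hh (Rmin_r _ _)).
      apply (Rmult_lt_compat_r (K + 1)) in H3; [|lra].
      replace (Cmod (j0 J) / 2 / (K + 1) * (K + 1))%R
        with (Cmod (j0 J) / 2)%R in H3 by (field; lra).
      pose proof (Cmod_ge_0 h).
      replace (f (z + h)) with (j0 J - (j0 J - f (z + h))) by ring.
      pose proof (Cmod_triangle_rev (j0 J) (j0 J - f (z + h))).
      rewrite <- (Cmod_opp (f (z + h) - j0 J)) in H2.
      replace (- (f (z + h) - j0 J)) with (j0 J - f (z + h)) in H2 by ring.
      simpl in H2. nra. }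
  destruct Hlow as (r & Hr & Hlow).
  assert (Hc : (0 < Cmod (j0 J))%R) by now apply Cmod_gt_0.
  destruct Hp as (K & r' & HK & Hr' & Hp).
  exists (K * (2 / Cmod (j0 J)))%R, (Rmin r r').
  repeat split; [|now apply Rmin_pos|].
  - apply Rmult_le_pos; auto. apply Rlt_le, Rdiv_lt_0_compat; lra.
  - intros h Hh.
    assert (H2 := Hlow h (Rlt_le_trans _ _ _ Hh (Rmin_l _ _))).
    assert (H3 := Hp h (Rlt_le_trans _ _ _ Hh (Rmin_r _ _))).
    assert (Hfn : f (z + h) <> 0).
    { apply Cmod_gt_0. lra. }
    replace (z + h - z) with h in H3 by ring.
    replace (/ f (z + h) - jev (jinv J) h) with
      (- ((f (z + h) * jev (jinv J) h - jev (jconst 1) h) * / f (z + h))).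
    2:{ unfold jev at 2, jlin, jquad. simpl. field. auto. }
    rewrite Cmod_opp, Cmod_mult, Cmod_inv by auto.
    replace (K * (2 / Cmod (j0 J)) * Cmod h ^ 3)%R
      with ((K * Cmod h ^ 3) * (2 / Cmod (j0 J)))%R by ring.
    apply Rmult_le_compat; auto using Cmod_ge_0.
    + apply Rlt_le, Rinv_0_lt_compat. lra.
    + replace (2 / Cmod (j0 J))%R with (/ (Cmod (j0 J) / 2))%R by (field; lra).
      apply Rinv_le_contravar; lra.
Qed.

(** Rotation invariance of the Laplacian: the mixed coefficient is multiplied by [w * Cconj w],
    which is 1. *)
Lemma hasjet_rot (f : C -> C) (w z : C) (J : jet) :
  Cmod w = 1%R -> hasjet f (w * z) J ->
  exists J', hasjet (fun x => f (w * x)) z J' /\ jzb J' = jzb J.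
Proof.
  intros Hw (K & r & HK & Hr & H).
  exists (Jet (j0 J) (jz J * w) (jb J * Cconj w) (jzz J * (w * w))
              (jzb J) (jbb J * (Cconj w * Cconj w))).
  split; auto. exists K, r. repeat split; auto. intros h Hh.
  assert (Hm : Cmod (w * h) = Cmod h) by (rewrite Cmod_mult, Hw; ring).
  rewrite <- Hm in Hh. specialize (H _ Hh). rewrite Hm in H.
  assert (Hww : w * Cconj w = 1) by (rewrite <- Cmod2_conj, Hw; f_equal; ring).
  replace (w * (z + h)) with (w * z + w * h) by ring.
  eapply Rle_trans; [|exact H]. right. f_equal. f_equal.
  unfold jev, jlin, jquad. simpl. rewrite !Cmult_conj.
  replace (w * h * (Cconj w * Cconj h)) with ((w * Cconj w) * (h * Cconj h)) by ring.
  rewrite Hww. ring.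
Qed.

Definition lap (f : C -> C) (z d : C) : Prop :=
  exists J, hasjet f z J /\ jzb J = d.

Lemma lap_plus (f g : C -> C) (z d e : C) :
  lap f z d -> lap g z e -> lap (fun w => f w + g w) z (d + e).
Proof.
  intros (J & HJ & <-) (K & HK & <-). exists (jadd J K).
  split; auto. now apply hasjet_plus.
Qed.

Lemma lap_scal (f : C -> C) (c z d : C) :
  lap f z d -> lap (fun w => c * f w) z (c * d).
Proof.
  intros (J & HJ & <-). exists (jmul (jconst c) J). split.
  - apply hasjet_mult; auto using hasjet_const.
  - simpl. ring.
Qed.

Lemma lap_csum (n : nat) (f : nat -> C -> C) (z : C) (d : nat -> C) :
  (forall k, (k < n)%nat -> lap (f k) z (d k)) ->
  lap (fun w => csum n (fun k => f k w)) z (csum n d).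
Proof.
  induction n as [|n IH]; intros H; simpl.
  - exists (jconst 0). split; auto. apply hasjet_const.
  - apply lap_plus; auto.
Qed.

(* [ana g g']: g is entire, in the weak sense of having a second-order
   expansion without conjugate terms at every point, with derivative g'. *)
Definition ana (g g' : C -> C) : Prop :=
  forall z, exists g2, hasjet g z (Jet (g z) (g' z) 0 g2 0 0).

Lemma ana_const (c : C) : ana (fun _ => c) (fun _ => 0).
Proof. intros z. exists 0. apply (hasjet_const c z). Qed.

Lemma ana_id : ana (fun z => z) (fun _ => 1).
Proof.
  intros z. exists 0. apply (OO_ext 3 (fun _ => 0)); [|apply OO_0].
  intros h. unfold jev, jlin, jquad. simpl. ring.
Qed.

Lemma jet_eq (J K : jet) :
  j0 J = j0 K -> jz J = jz K -> jb J = jb K -> jzz J = jzz K ->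
  jzb J = jzb K -> jbb J = jbb K -> J = K.
Proof. destruct J, K; simpl. congruence. Qed.

Lemma ana_plus (f f' g g' : C -> C) :
  ana f f' -> ana g g' -> ana (fun z => f z + g z) (fun z => f' z + g' z).
Proof.
  intros Hf Hg z. destruct (Hf z) as (a & Ha). destruct (Hg z) as (b & Hb).
  exists (a + b). pose proof (hasjet_plus _ _ _ _ _ Ha Hb) as H.
  eapply eq_ind_r with (P := hasjet _ z); [exact H|].
  apply jet_eq; simpl; ring.
Qed.

Lemma ana_mult (f f' g g' : C -> C) :
  ana f f' -> ana g g' ->
  ana (fun z => f z * g z) (fun z => f' z * g z + f z * g' z).
Proof.
  intros Hf Hg z. destruct (Hf z) as (a & Ha). destruct (Hg z) as (b & Hb).
  exists (f z * b + f' z * g' z + a * g z).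
  pose proof (hasjet_mult _ _ _ _ _ Ha Hb) as H.
  eapply eq_ind_r with (P := hasjet _ z); [exact H|].
  apply jet_eq; simpl; ring.
Qed.

Lemma ana_scal (c : C) (f f' : C -> C) :
  ana f f' -> ana (fun z => c * f z) (fun z => c * f' z).
Proof.
  intros Hf z. destruct (ana_mult _ _ _ _ (ana_const c) Hf z) as (a & Ha).
  exists a. now replace (c * f' z) with (0 * f z + c * f' z) by ring.
Qed.

Lemma ana_csum (n : nat) (f f' : nat -> C -> C) :
  (forall k, (k < n)%nat -> ana (f k) (f' k)) ->
  ana (fun z => csum n (fun k => f k z)) (fun z => csum n (fun k => f' k z)).
Proof.
  induction n as [|n IH]; intros H; simpl.
  - apply ana_const.
  - apply ana_plus; auto.
Qed.

Lemma ana_pow (n : nat) : ana (fun z => z ^ n) (fun z => INR n * z ^ (n - 1)).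
Proof.
  induction n as [|n IH].
  - intros z. destruct (ana_const 1 z) as (a & Ha). exists a.
    simpl. now rewrite Cmult_0_l.
  - intros z. destruct (ana_mult _ _ _ _ ana_id IH z) as (a & Ha).
    exists a.
    replace (INR (S n) * z ^ (S n - 1)) with
      (1 * z ^ n + z * (INR n * z ^ (n - 1))); [exact Ha|].
    rewrite S_INR, RtoC_plus. replace (S n - 1)%nat with n by lia.
    destruct n as [|n]; [simpl; ring|].
    replace (S n - 1)%nat with n by lia. rewrite Cpow_S. ring.
Qed.

Lemma lap_abs2 (g g' : C -> C) (z : C) :
  ana g g' -> lap (fun w => g w * Cconj (g w)) z (g' z * Cconj (g' z)).
Proof.
  intros Hg. destruct (Hg z) as (a & Ha).
  eexists. split; [apply hasjet_mult; [exact Ha|apply hasjet_conj, Ha]|].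
  simpl.
  replace (Cconj 0) with (RtoC 0) by (apply injective_projections; simpl; ring).
  ring.
Qed.

(** * Compactness and the maximum principle *)

Definition ccv (u : nat -> C) (l : C) : Prop :=
  forall eps : R, (0 < eps)%R ->
    exists N : nat, forall n, (N <= n)%nat -> (Cmod (u n - l) < eps)%R.

Definition increasing (s : nat -> nat) : Prop := forall n, (s n < s (S n))%nat.

Lemma increasing_ge (s : nat -> nat) (n : nat) : increasing s -> (n <= s n)%nat.
Proof.
  intros H. induction n as [|n IH]; [lia|]. specialize (H n). lia.
Qed.

Lemma increasing_lt (s : nat -> nat) (n m : nat) :
  increasing s -> (n < m)%nat -> (s n < s m)%nat.
Proof.
  intros H Hnm. induction Hnm as [|m Hnm IH]; [apply H|].
  specialize (H m). lia.
Qed.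

Lemma increasing_comp (s t : nat -> nat) :
  increasing s -> increasing t -> increasing (fun n => s (t n)).
Proof. intros Hs Ht n. now apply increasing_lt. Qed.

Lemma bolzano_R (u : nat -> R) (M : R) :
  (forall n, (Rabs (u n) <= M)%R) ->
  exists s l, increasing s /\ Un_cv (fun n => u (s n)) l.
Proof.
  intros Hb.
  destruct (Bolzano_Weierstrass u (fun x => (- M <= x <= M)%R) (compact_P3 _ _))
    as (l & Hl).
  { intros n. specialize (Hb n). apply Rabs_le_between in Hb. lra. }
  assert (Hp : forall N k : nat, exists p, (N <= p)%nat /\
            (Rabs (u p - l) < / (INR k + 1))%R).
  { intros N k. pose proof (pos_INR k).
    assert (Hk : (0 < / (INR k + 1))%R) by (apply Rinv_0_lt_compat; lra).
    apply (Hl (disc l (mkposreal _ Hk)) N).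
    exists (mkposreal _ Hk). intros x Hx. exact Hx. }
  set (pick N k := proj1_sig (constructive_indefinite_description _ (Hp N k))).
  assert (Hpick : forall N k, (N <= pick N k)%nat /\
            (Rabs (u (pick N k) - l) < / (INR k + 1))%R).
  { intros N k. unfold pick.
    now destruct (constructive_indefinite_description _ (Hp N k)). }
  set (s := fix s n := match n with
                       | O => pick O O
                       | S n => pick (S (s n)) (S n) end).
  exists s, l. split.
  - intros n. simpl. pose proof (Hpick (S (s n)) (S n)). lia.
  - intros eps Heps. destruct (archimed_cor1 eps Heps) as (N & HN & HN0).
    exists N. intros n Hn. unfold Rdist.
    assert (H : (Rabs (u (s n) - l) < / (INR n + 1))%R).
    { destruct n; simpl s; apply Hpick. }
    eapply Rlt_trans; [exact H|]. eapply Rle_lt_trans; [|exact HN].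
    apply Rinv_le_contravar; [now apply lt_0_INR|].
    apply le_INR in Hn. lra.
Qed.

Lemma bolzano_C (u : nat -> C) (M : R) :
  (forall n, (Cmod (u n) <= M)%R) ->
  exists s l, increasing s /\ ccv (fun n => u (s n)) l.
Proof.
  intros Hb.
  destruct (bolzano_R (fun n => fst (u n)) M) as (s & x & Hs & Hx).
  { intros n. eapply Rle_trans; [|apply Hb].
    eapply Rle_trans; [apply Rmax_l|apply Rmax_Cmod]. }
  destruct (bolzano_R (fun n => snd (u (s n))) M) as (t & y & Ht & Hy).
  { intros n. eapply Rle_trans; [|apply Hb].
    eapply Rle_trans; [apply Rmax_r|apply Rmax_Cmod]. }
  exists (fun n => s (t n)), (x, y). split; [now apply increasing_comp|].
  intros eps Heps.
  destruct (Hx (eps / 2)%R) as (N1 & H1); [lra|].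
  destruct (Hy (eps / 2)%R) as (N2 & H2); [lra|].
  exists (Nat.max N1 N2). intros n Hn.
  assert (Hn1 : (t n >= N1)%nat).
  { pose proof (increasing_ge t n Ht). lia. }
  specialize (H1 _ Hn1). specialize (H2 n ltac:(lia)).
  unfold Rdist in H1, H2.
  eapply Rle_lt_trans; [apply Cmod_2Rmax|]. simpl.
  replace (fst (u (s (t n))) + - x)%R with (fst (u (s (t n))) - x)%R by ring.
  replace (snd (u (s (t n))) + - y)%R with (snd (u (s (t n))) - y)%R by ring.
  assert (Hm : (Rmax (Rabs (fst (u (s (t n))) - x)) (Rabs (snd (u (s (t n))) - y))
             < eps / 2)%R) by (apply Rmax_lub_lt; lra).
  assert (Hs2 : (0 < sqrt 2 < 2)%R).
  { split; [apply sqrt_lt_R0; lra|]. rewrite <- (sqrt_square 2) at 2 by lra.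
    apply sqrt_lt_1; lra. }
  assert (0 <= Rmax (Rabs (fst (u (s (t n))) - x)) (Rabs (snd (u (s (t n))) - y)))%R.
  { eapply Rle_trans; [apply Rabs_pos|apply Rmax_l]. }
  nra.
Qed.

Lemma diagonal_subsequence (u : nat -> nat -> C) (B : nat -> R) :
  (forall N j, (Cmod (u N j) <= B j)%R) ->
  exists (s : nat -> nat) (l : nat -> C),
    (forall N, (N <= s N)%nat) /\ forall j, ccv (fun N => u (s N) j) (l j).
Proof.
  intros Hb.
  assert (Hex : forall (s : nat -> nat) j, exists t, increasing t /\
            exists l, ccv (fun N => u (s (t N)) j) l).
  { intros s j. destruct (bolzano_C (fun N => u (s N) j) (B j)) as (t & l & Ht & Hl).
    - intros n. apply Hb.
    - exists t. split; auto. now exists l. }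
  set (bw s j := proj1_sig (constructive_indefinite_description _ (Hex s j))).
  assert (Hbw : forall s j, increasing (bw s j) /\
            exists l, ccv (fun N => u (s (bw s j N)) j) l).
  { intros s j. unfold bw.
    now destruct (constructive_indefinite_description _ (Hex s j)). }
  set (S_ := fix S_ j := match j with
                         | O => fun n : nat => n
                         | S j => fun n => S_ j (bw (S_ j) j n) end).
  assert (Hinc : forall j, increasing (S_ j)).
  { induction j as [|j IH].
    - intros n. simpl. lia.
    - apply (increasing_comp (S_ j) (bw (S_ j) j)); auto. apply Hbw. }
  (* Later subsequences refine earlier ones. Hence the diagonal term of index n > j is a term of
     [S_ (S j)] of index at least n. *)
  assert (Hfac : forall j d, exists r, increasing r /\
            forall n, S_ (d + j)%nat n = S_ j (r n)).
  { intros j d. induction d as [|d (r & Hr & IH)].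
    - exists (fun n => n). split; [intros n; lia|reflexivity].
    - exists (fun n => r (bw (S_ (d + j)%nat) (d + j)%nat n)). split.
      + apply increasing_comp; auto. apply Hbw.
      + intros n. simpl. now rewrite IH. }
  assert (Hl : forall j, exists l, ccv (fun N => u (S_ (S j) N) j) l).
  { intros j. apply Hbw. }
  set (l j := proj1_sig (constructive_indefinite_description _ (Hl j))).
  exists (fun N => S_ N N), l. split.
  - intros N. apply increasing_ge, Hinc.
  - intros j eps Heps. unfold l.
    destruct (constructive_indefinite_description _ (Hl j)) as (lj & Hlj). simpl.
    destruct (Hlj eps Heps) as (N0 & HN0).
    exists (Nat.max N0 (S j)). intros n Hn.
    destruct (Hfac (S j) (n - S j)%nat) as (r & Hr & Hf).
    replace (n - S j + S j)%nat with n in Hf by lia.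
    rewrite Hf. apply HN0. pose proof (increasing_ge r n Hr). lia.
Qed.

Definition cont_at (V : C -> R) (z : C) : Prop :=
  forall eps : R, (0 < eps)%R -> exists d : R, (0 < d)%R /\
    forall w, (Cmod (w - z) < d)%R -> (Rabs (V w - V z) < eps)%R.

Lemma disc_cluster (u : nat -> C) :
  (forall n, (Cmod (u n) <= 1)%R) ->
  exists s l, increasing s /\ ccv (fun n => u (s n)) l /\ (Cmod l <= 1)%R.
Proof.
  intros Hb. destruct (bolzano_C u 1 Hb) as (s & l & Hs & Hl).
  exists s, l. repeat split; auto.
  apply le_epsilon. intros eps Heps. destruct (Hl eps Heps) as (N & HN).
  specialize (HN N (le_n N)). specialize (Hb (s N)).
  replace l with (u (s N) - (u (s N) - l)) by ring.
  pose proof (Cmod_triangle_minus (u (s N)) (u (s N) - l)). lra.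
Qed.

Lemma disc_max (V : C -> R) :
  (forall z, (Cmod z <= 1)%R -> cont_at V z) ->
  exists z, (Cmod z <= 1)%R /\ forall w, (Cmod w <= 1)%R -> (V w <= V z)%R.
Proof.
  intros Hc.
  (* Used twice: with thresholds n it shows that V is bounded, with thresholds S0 - 1/(n+1) that the
     supremum is attained. *)
  assert (Hseq : forall t : nat -> R, (forall n, exists w, (Cmod w <= 1)%R /\ (t n < V w)%R) ->
    exists s z, increasing s /\ (Cmod z <= 1)%R /\
      forall eps, (0 < eps)%R -> exists N, forall n, (N <= n)%nat -> (t (s n) < V z + eps)%R).
  { intros t Ht.
    set (w n := proj1_sig (constructive_indefinite_description _ (Ht n))).
    assert (Hw : forall n, (Cmod (w n) <= 1)%R /\ (t n < V (w n))%R).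
    { intros n. unfold w. now destruct (constructive_indefinite_description _ (Ht n)). }
    destruct (disc_cluster w) as (s & z & Hs & Hz & Hz1); [apply Hw|].
    exists s, z. repeat split; auto. intros eps Heps.
    destruct (Hc z Hz1 eps Heps) as (d & Hd & Hd').
    destruct (Hz d Hd) as (N & HN). exists N. intros n Hn.
    specialize (Hd' _ (HN n Hn)). apply Rabs_lt_between in Hd'.
    destruct (Hw (s n)). lra. }
  set (E := fun y => exists w, (Cmod w <= 1)%R /\ y = V w).
  assert (HE : bound E).
  { apply NNPP. intros Hn.
    destruct (Hseq (fun n => INR n)) as (s & z & Hs & Hz & H).
    { intros n. apply NNPP. intros Hn'. apply Hn. exists (INR n).
      intros y (w & Hw & ->). apply Rnot_lt_le. intros Hlt. apply Hn'. eauto. }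
    destruct (H 1%R) as (N & HN); [lra|].
    destruct (INR_unbounded (V z + 1)) as (m & Hm).
    specialize (HN (Nat.max N m) (Nat.le_max_l _ _)).
    assert (INR m <= INR (s (Nat.max N m)))%R.
    { apply le_INR. pose proof (increasing_ge s (Nat.max N m) Hs). lia. }
    lra. }
  destruct (completeness E HE) as (S0 & Hub & Hlub).
  { exists (V 0). exists 0. split; auto. rewrite Cmod_0. lra. }
  destruct (Hseq (fun n => (S0 - / (INR n + 1))%R)) as (s & z & Hs & Hz & H).
  { intros n. apply NNPP. intros Hn.
    assert (0 < / (INR n + 1))%R.
    { apply Rinv_0_lt_compat. pose proof (pos_INR n). lra. }
    assert (S0 <= S0 - / (INR n + 1))%R; [|lra].
    apply Hlub. intros y (w & Hw & ->). apply Rnot_lt_le. intros Hlt. eauto. }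
  exists z. split; auto. intros w Hw.
  apply Rle_trans with S0; [apply Hub; now exists w|].
  apply le_epsilon. intros eps Heps.
  destruct (H (eps / 2)%R) as (N & HN); [lra|].
  destruct (archimed_cor1 (eps / 2)) as (m & Hm & Hm0); [lra|].
  specialize (HN (Nat.max N m) (Nat.le_max_l _ _)). simpl in HN.
  assert (/ (INR (s (Nat.max N m)) + 1) <= / INR m)%R.
  { apply Rinv_le_contravar; [now apply lt_0_INR|].
    assert (m <= s (Nat.max N m))%nat.
    { pose proof (increasing_ge s (Nat.max N m) Hs). lia. }
    apply le_INR in H0. lra. }
  lra.
Qed.

Lemma hasjet_cont (f : C -> C) (z : C) (J : jet) :
  hasjet f z J -> cont_at (fun w => Re (f w)) z.
Proof.
  intros Hj. pose proof (hasjet_OO_1 _ _ _ Hj) as (K & r & HK & Hr & H).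
  assert (Hz : f z = j0 J).
  { specialize (H 0). rewrite Cmod_0 in H. specialize (H Hr).
    rewrite Cplus_0_r in H. simpl in H.
    pose proof (Cmod_ge_0 (f z - j0 J)).
    apply Ceq_minus, Cmod_eq_0. lra. }
  intros eps Heps. exists (Rmin r (eps / (K + 1))). split.
  - apply Rmin_pos; auto. apply Rdiv_lt_0_compat; lra.
  - intros w Hw.
    assert (H1 := H _ (Rlt_le_trans _ _ _ Hw (Rmin_l _ _))).
    assert (H2 := Rlt_le_trans _ _ _ Hw (Rmin_r _ _)).
    replace (z + (w - z)) with w in H1 by ring. rewrite <- Hz in H1.
    apply (Rmult_lt_compat_r (K + 1)) in H2; [|lra].
    replace (eps / (K + 1) * (K + 1))%R with eps in H2 by (field; lra).
    pose proof (Cmod_ge_0 (w - z)).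
    replace (Re (f w) - Re (f z))%R with (Re (f w - f z)) by reflexivity.
    eapply Rle_lt_trans; [apply re_le_Cmod|]. simpl in H1. nra.
Qed.

Lemma cont_at_plus_sqr (V : C -> R) (eps : R) (z : C) :
  cont_at V z -> cont_at (fun w => V w + eps * Cmod w ^ 2)%R z.
Proof.
  intros HV.
  assert (Hs : cont_at (fun w => Re (w * Cconj w)) z).
  { destruct (ana_id z) as (a & Ha).
    eapply hasjet_cont. apply hasjet_mult; [exact Ha|apply hasjet_conj, Ha]. }
  intros e He. destruct (HV (e / 2)%R) as (d & Hd & H); [lra|].
  destruct (Hs (e / 2 / (Rabs eps + 1))%R) as (d' & Hd' & H').
  { pose proof (Rabs_pos eps). apply Rdiv_lt_0_compat; lra. }
  exists (Rmin d d'). split; [now apply Rmin_pos|]. intros w Hw.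
  specialize (H w (Rlt_le_trans _ _ _ Hw (Rmin_l _ _))).
  specialize (H' w (Rlt_le_trans _ _ _ Hw (Rmin_r _ _))).
  rewrite <- !Cmod2_conj, !re_RtoC in H'.
  pose proof (Rabs_pos eps).
  apply (Rmult_lt_compat_r (Rabs eps + 1)) in H'; [|lra].
  replace (e / 2 / (Rabs eps + 1) * (Rabs eps + 1))%R with (e / 2)%R in H'
    by (field; lra).
  replace (V w + eps * Cmod w ^ 2 - (V z + eps * Cmod z ^ 2))%R
    with ((V w - V z) + eps * (Cmod w ^ 2 - Cmod z ^ 2))%R by ring.
  eapply Rle_lt_trans; [apply Rabs_triang|]. rewrite Rabs_mult.
  pose proof (Rabs_pos (Cmod w ^ 2 - Cmod z ^ 2)). nra.
Qed.

(* At an interior maximum z the mean of the four values at z + h, z - h,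
   z + ih, z - ih exceeds the value at z by h^2 (jzb + eps) + O(h^3). *)
Lemma max_principle (u : C -> C) (B : R) :
  (forall z, (Cmod z <= 1)%R -> exists d, lap u z d /\ ((Cmod z < 1)%R -> (0 <= Re d)%R)) ->
  (forall z, Cmod z = 1%R -> (Re (u z) <= B)%R) ->
  (Re (u 0%R) <= B)%R.
Proof.
  intros Hu HB. apply le_epsilon. intros eps Heps.
  destruct (disc_max (fun w => Re (u w) + eps * Cmod w ^ 2)%R) as (z & Hz & Hmax).
  { intros z Hz. destruct (Hu z Hz) as (d & (J & HJ & _) & _).
    apply cont_at_plus_sqr. now apply (hasjet_cont u z J). }
  pose proof (Hmax 0 ltac:(rewrite Cmod_0; lra)) as H0. rewrite Cmod_0 in H0.
  destruct (Rle_lt_or_eq_dec _ _ Hz) as [Hlt|Heq].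
  2:{ rewrite Heq in H0. specialize (HB z Heq). lra. }
  exfalso. clear H0. destruct (Hu z Hz) as (d & (J & HJ & Hd) & Hpos).
  specialize (Hpos Hlt).
  assert (Hz0 : j0 J = u z).
  { pose proof (hasjet_OO_1 _ _ _ HJ) as (K & r & HK & Hr & H).
    specialize (H 0). rewrite Cmod_0 in H. specialize (H Hr).
    rewrite Cplus_0_r in H. simpl in H.
    pose proof (Cmod_ge_0 (u z - j0 J)).
    symmetry. apply Ceq_minus, Cmod_eq_0. lra. }
  destruct HJ as (K & r & HK & Hr & HJ).
  set (t := Rmin (r / 2) (Rmin ((1 - Cmod z)) (eps / 2 / (K + 1)))).
  assert (Ht0 : (0 < t)%R).
  { unfold t. repeat apply Rmin_pos; try lra. apply Rdiv_lt_0_compat; lra. }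
  assert (Htr : (t <= r / 2)%R) by apply Rmin_l.
  assert (Htz : (t <= 1 - Cmod z)%R).
  { eapply Rle_trans; [apply Rmin_r|apply Rmin_l]. }
  assert (HtK : (t * (K + 1) <= eps / 2)%R).
  { apply Rle_trans with ((eps / 2 / (K + 1)) * (K + 1))%R; [|right; field; lra].
    apply Rmult_le_compat_r; [lra|].
    eapply Rle_trans; [apply Rmin_r|apply Rmin_r]. }
  assert (Hpt : forall h, Cmod h = t ->
    (Re (jev J h) - K * t ^ 3 <= Re (u (z + h)%C))%R /\
    (Re (u (z + h)%C) + eps * Cmod (z + h) ^ 2 <= Re (u z) + eps * Cmod z ^ 2)%R).
  { intros h Hh. split.
    - specialize (HJ h ltac:(lra)). rewrite Hh in HJ.
      pose proof (re_le_Cmod (u (z + h) - jev J h)) as H1.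
      replace (Re (u (z + h) - jev J h)) with (Re (u (z + h)%C) - Re (jev J h))%R in H1
        by reflexivity.
      pose proof (Rle_trans _ _ _ H1 HJ) as H2. apply Rabs_le_between in H2. lra.
    - apply Hmax. pose proof (Cmod_triangle z h). lra. }
  assert (Hm : forall c : C, Cmod c = 1%R -> Cmod (t * c) = t).
  { intros c Hc. rewrite Cmod_mult, Hc, Cmod_R, Rabs_pos_eq; lra. }
  pose proof (Hpt (t * 1) (Hm _ Cmod_1)) as (A1 & B1).
  pose proof (Hpt (t * - (1)) (Hm _ Cmod_m1)) as (A2 & B2).
  pose proof (Hpt (t * Ci) (Hm _ Cmod_Ci)) as (A3 & B3).
  pose proof (Hpt (t * - Ci) (Hm _ ltac:(rewrite Cmod_opp; apply Cmod_Ci))) as (A4 & B4).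
  (* Over the four directions the linear terms cancel, and so do the terms in h^2 and in its
     conjugate; only [jzb] survives. *)
  assert (Hjsum : (Re (jev J (t * 1)) + Re (jev J (t * - (1))) +
                   Re (jev J (t * Ci)) + Re (jev J (t * - Ci)) =
                   4 * Re (u z) + 4 * t ^ 2 * Re d)%R).
  { rewrite <- Hz0, <- Hd. unfold jev, jlin, jquad, Re. simpl. ring. }
  assert (Hsq : (Cmod (z + t * 1) ^ 2 + Cmod (z + t * - (1)) ^ 2 +
                 Cmod (z + t * Ci) ^ 2 + Cmod (z + t * - Ci) ^ 2 =
                 4 * Cmod z ^ 2 + 4 * t ^ 2)%R).
  { rewrite !Cmod2_alt. unfold Re, Im. simpl. ring. }
  assert (K * t ^ 3 <= eps / 2 * t ^ 2)%R.
  { replace (K * t ^ 3)%R with ((K * t) * t ^ 2)%R by ring.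
    apply Rmult_le_compat_r; [apply pow2_ge_0|]. lra. }
  assert (0 <= t ^ 2 * Re d)%R by (apply Rmult_le_pos; auto; apply pow2_ge_0).
  assert (0 < eps * t ^ 2)%R by (apply Rmult_lt_0_compat; auto; apply pow_lt; auto).
  nra.
Qed.

(** * The subharmonic test function *)

Lemma ana_minus (f f' g g' : C -> C) :
  ana f f' -> ana g g' -> ana (fun z => f z - g z) (fun z => f' z - g' z).
Proof.
  intros Hf Hg z.
  destruct (ana_plus _ _ _ _ Hf (ana_scal (- (1)) _ _ Hg) z) as (a & Ha).
  exists a.
  replace (f z - g z) with (f z + - (1) * g z) by ring.
  replace (f' z - g' z) with (f' z + - (1) * g' z) by ring.
  eapply hasjet_ext; [|exact Ha]. intros w. simpl. ring.
Qed.

Definition ip (n : nat) (x y : nat -> C) : C :=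
  csum n (fun i => x i * Cconj (y i)).

Definition wedge (x y : nat -> C) (i k : nat) : C := x i * y k - x k * y i.

Lemma csum_prod (n m : nat) (a b : nat -> C) :
  csum n (fun i => csum m (fun k => a i * b k)) = csum n a * csum m b.
Proof.
  rewrite <- csum_scal_r. apply csum_ext. intros i _. apply csum_scal_l.
Qed.

(** Cauchy-Binet (Lagrange) identity; the factor 2 appears because every unordered pair of indices
    is counted twice. It rewrites the Laplacian of [psi] so that G enters only through its wedge
    with F and the derivative of that wedge. *)
Lemma binet_cauchy (n : nat) (x y u v : nat -> C) :
  csum n (fun i => csum n (fun k => wedge x y i k * Cconj (wedge u v i k))) =
  2 * (ip n x u * ip n y v - ip n x v * ip n y u).
Proof.
  transitivity
    (csum n (fun i => csum n (fun k =>
       ((x i * Cconj (u i)) * (y k * Cconj (v k)) -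
        (x i * Cconj (v i)) * (y k * Cconj (u k))) +
       ((y i * Cconj (v i)) * (x k * Cconj (u k)) -
        (y i * Cconj (u i)) * (x k * Cconj (v k)))))).
  { apply csum_ext; intros i _. apply csum_ext; intros k _.
    unfold wedge. rewrite Cminus_conj, !Cmult_conj. ring. }
  unfold ip.
  rewrite (csum_ext n _ (fun i =>
    (csum n (fun k => (x i * Cconj (u i)) * (y k * Cconj (v k))) -
     csum n (fun k => (x i * Cconj (v i)) * (y k * Cconj (u k)))) +
    (csum n (fun k => (y i * Cconj (v i)) * (x k * Cconj (u k))) -
     csum n (fun k => (y i * Cconj (u i)) * (x k * Cconj (v k)))))).
  2:{ intros i _. now rewrite csum_plus, !csum_minus. }
  rewrite csum_plus, !csum_minus, !csum_prod. ring.
Qed.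

Lemma ip_self (n : nat) (x : nat -> C) :
  ip n x x = RtoC (rsum n (fun i => Cmod (x i) ^ 2)%R).
Proof.
  unfold ip. rewrite RtoC_rsum. apply csum_ext. intros i _. now rewrite Cmod2_conj.
Qed.

Lemma ip_jet (n : nat) (x x' y y' : nat -> C -> C) (z : C) :
  (forall i, (i < n)%nat -> ana (x i) (x' i)) ->
  (forall i, (i < n)%nat -> ana (y i) (y' i)) ->
  exists J, hasjet (fun w => ip n (fun i => x i w) (fun i => y i w)) z J /\
    j0 J = ip n (fun i => x i z) (fun i => y i z) /\
    jz J = ip n (fun i => x' i z) (fun i => y i z) /\
    jb J = ip n (fun i => x i z) (fun i => y' i z) /\
    jzb J = ip n (fun i => x' i z) (fun i => y' i z).
Proof.
  unfold ip. induction n as [|n IH]; intros Hx Hy.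
  - exists (jconst 0). split; [apply (hasjet_const 0 z)|]. simpl. auto.
  - destruct IH as (J & HJ & E0 & E1 & E2 & E3); auto.
    destruct (Hx n (Nat.lt_succ_diag_r n) z) as (a & Ha).
    destruct (Hy n (Nat.lt_succ_diag_r n) z) as (b & Hb).
    eexists. split.
    + simpl. apply hasjet_plus; [exact HJ|].
      apply hasjet_mult; [exact Ha|apply hasjet_conj, Hb].
    + simpl. rewrite E0, E1, E2, E3.
      replace (Cconj 0) with (RtoC 0) by (apply injective_projections; simpl; ring).
      repeat split; ring.
Qed.

Definition psi (n : nat) (F G : nat -> C -> C) (z : C) : C :=
  ip n (fun i => G i z) (fun i => F i z) * / ip n (fun i => F i z) (fun i => F i z).

(** The quotient rule produces numerators of the form <x,u><y,v> - <x,v><y,u>, which are sums of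
    wedges by [binet_cauchy]. The bracket in the first sum is the derivative of the wedge of G and
    F. *)
Lemma lap_psi (n : nat) (F F' G G' : nat -> C -> C) (z : C) :
  (forall i, (i < n)%nat -> ana (F i) (F' i)) ->
  (forall i, (i < n)%nat -> ana (G i) (G' i)) ->
  let D := ip n (fun i => F i z) (fun i => F i z) in
  let W := wedge (fun i => F' i z) (fun i => F i z) in
  D <> 0 ->
  lap (psi n F G) z
    (/ 2 * / (D * D) * csum n (fun i => csum n (fun k =>
        (wedge (fun i => G' i z) (fun i => F i z) i k +
         wedge (fun i => G i z) (fun i => F' i z) i k) * Cconj (W i k))) -
     / (D * D * D) * (ip n (fun i => F' i z) (fun i => F i z) *
       csum n (fun i => csum n (fun k =>
         wedge (fun i => G i z) (fun i => F i z) i k * Cconj (W i k))))).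
Proof.
  intros HF HG D W HD.
  destruct (ip_jet n G G' F F' z HG HF) as (J & HJ & E0 & E1 & E2 & E3).
  destruct (ip_jet n F F' F F' z HF HF) as (K & HK & K0 & K1 & K2 & K3).
  exists (jmul J (jinv K)). split.
  - apply (hasjet_mult _ _ _ _ _ HJ). apply hasjet_inv; auto.
    rewrite K0. exact HD.
  - unfold W. rewrite binet_cauchy.
    rewrite (csum_ext n (fun i => csum n (fun k => (_ + _) * _)) (fun i =>
      csum n (fun k => wedge (fun i => G' i z) (fun i => F i z) i k *
        Cconj (wedge (fun i => F' i z) (fun i => F i z) i k)) +
      csum n (fun k => wedge (fun i => G i z) (fun i => F' i z) i k *
        Cconj (wedge (fun i => F' i z) (fun i => F i z) i k)))).
    2:{ intros i _. rewrite <- csum_plus. apply csum_ext. intros k _. ring. }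
    rewrite csum_plus, !binet_cauchy. simpl.
    rewrite E0, E1, E2, E3, K0, K1, K2, K3. fold D.
    field. exact HD.
Qed.

Lemma Cmod_csum2_le (n m : nat) (u : nat -> nat -> C) (v : nat -> nat -> R) :
  (forall i k, (i < n)%nat -> (k < m)%nat -> (Cmod (u i k) <= v i k)%R) ->
  (Cmod (csum n (fun i => csum m (u i))) <= rsum n (fun i => rsum m (v i)))%R.
Proof.
  intros H. eapply Rle_trans; [apply Cmod_csum_le|]. apply rsum_le. intros i Hi.
  eapply Rle_trans; [apply Cmod_csum_le|]. apply rsum_le. auto.
Qed.

Lemma amgm (s x y X Y : R) :
  (0 < s)%R -> (x ^ 2 <= X)%R -> (y ^ 2 <= Y)%R -> (x * y <= / 2 * (s * X + / s * Y))%R.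
Proof.
  intros Hs HX HY.
  assert (Hi : (0 < / s)%R) by now apply Rinv_0_lt_compat.
  assert (H : (0 <= / s * (s * x - y) ^ 2)%R).
  { apply Rmult_le_pos; [lra|apply pow2_ge_0]. }
  replace (/ s * (s * x - y) ^ 2)%R with (s * x ^ 2 + / s * y ^ 2 - 2 * (x * y))%R in H
    by (field; lra).
  assert (s * x ^ 2 <= s * X)%R by (apply Rmult_le_compat_l; lra).
  assert (/ s * y ^ 2 <= / s * Y)%R by (apply Rmult_le_compat_l; lra).
  lra.
Qed.

(** The two summands come from the terms with D^-2 and D^-3 in [lap_psi]; the last factor is the
    constant L of [energy_bounds]. *)
Definition psi_const (n : nat) (M m : R) : R :=
  ((M / m ^ 2 + INR n * M ^ 2 / m ^ 3) * (2 + 2 * INR n * M ^ 2))%R.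

Lemma psi_const_ge_0 (n : nat) (M m : R) :
  (0 <= M)%R -> (0 < m)%R -> (0 <= psi_const n M m)%R.
Proof.
  intros HM Hm. unfold psi_const.
  pose proof (pos_INR n). pose proof (pow2_ge_0 M).
  apply Rmult_le_pos; [|nra]. apply Rplus_le_le_0_compat.
  - apply Rdiv_le_0_compat; [lra|now apply pow_lt].
  - apply Rdiv_le_0_compat; [nra|now apply pow_lt].
Qed.

(** Here al stands for |F'|. Once W is bounded by 2 M al, every product pairs one of |f'|, al |f|
    with one of |q'|, al |q|, and the square of each of these four is at most L times an energy. The
    weight s of [amgm] stays free; it is fixed by the behaviour on the circle. *)
Lemma psi_lap_bound (n : nat) (M m al s D Ef : R) (f f' Dz : C)
    (q q' W : nat -> nat -> C) (Eq : nat -> nat -> R) :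
  (0 <= M)%R -> (0 < m)%R -> (0 <= al)%R -> (0 < s)%R -> (m <= D)%R ->
  (Cmod Dz <= INR n * (M * al))%R ->
  (forall i k, (i < n)%nat -> (k < n)%nat -> (Cmod (W i k) <= 2 * M * al)%R) ->
  let L := (2 + 2 * INR n * M ^ 2)%R in
  (Cmod f' ^ 2 <= L * Ef)%R -> ((al * Cmod f) ^ 2 <= L * Ef)%R ->
  (forall i k, (i < n)%nat -> (k < n)%nat ->
     (Cmod (q' i k) ^ 2 <= L * Eq i k)%R /\ ((al * Cmod (q i k)) ^ 2 <= L * Eq i k)%R) ->
  (Cmod (/ 2 * / (D * D) * csum n (fun i => csum n (fun k =>
        (f' * q i k + f * q' i k) * Cconj (W i k))) -
     / (D * D * D) * (Dz *
       csum n (fun i => csum n (fun k => (f * q i k) * Cconj (W i k)))))%C <=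
   psi_const n M m * rsum n (fun i => rsum n (fun k => s * Ef + / s * Eq i k)))%R.
Proof.
  intros HM Hm Hal Hs HD HDz HW L Hf' Hf Hq.
  assert (HD0 : (0 < D)%R) by lra.
  assert (HDC : RtoC D <> 0) by (intros H; apply RtoC_inj in H; lra).
  pose proof (pos_INR n) as Hn.
  assert (HM2 : (0 <= M ^ 2)%R) by apply pow2_ge_0.
  assert (HD2 : (0 < D * D)%R) by now apply Rmult_lt_0_compat.
  assert (HD3 : (0 < D * D * D)%R) by now apply Rmult_lt_0_compat.
  set (T := fun i k => (s * Ef + / s * Eq i k)%R).
  assert (HS1 : (Cmod (csum n (fun i => csum n (fun k =>
        (f' * q i k + f * q' i k) * Cconj (W i k))))%C <=
        2 * M * L * rsum n (fun i => rsum n (T i)))%R).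
  { eapply Rle_trans.
    - apply (Cmod_csum2_le n n _ (fun i k => 2 * M * L * T i k)%R).
      intros i k Hi Hk. destruct (Hq i k Hi Hk) as (Hq1 & Hq2).
      rewrite Cmod_mult, Cmod_conj.
      eapply Rle_trans.
      { apply Rmult_le_compat; [apply Cmod_ge_0|apply Cmod_ge_0|apply Cmod_triangle|
          apply (HW i k Hi Hk)]. }
      rewrite !Cmod_mult.
      pose proof (amgm s _ _ _ _ Hs Hf' Hq2) as A1.
      pose proof (amgm s _ _ _ _ Hs Hf Hq1) as A2.
      replace ((Cmod f' * Cmod (q i k) + Cmod f * Cmod (q' i k)) * (2 * M * al))%R
        with (2 * M * (Cmod f' * (al * Cmod (q i k)) + al * Cmod f * Cmod (q' i k)))%R
        by ring.
      replace (2 * M * L * T i k)%R with (2 * M * (L * T i k))%R by ring.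
      apply Rmult_le_compat_l; [lra|]. unfold T. lra.
    - right. rewrite <- rsum_scal_l. apply rsum_ext. intros i _.
      now rewrite rsum_scal_l. }
  assert (HS2 : (Cmod (Dz *
       csum n (fun i => csum n (fun k => (f * q i k) * Cconj (W i k))))%C <=
       INR n * M ^ 2 * L * rsum n (fun i => rsum n (T i)))%R).
  { rewrite <- csum_scal_l, (csum_ext n _ (fun i => csum n (fun k =>
      Dz * ((f * q i k) * Cconj (W i k))))).
    2:{ intros i _. now rewrite csum_scal_l. }
    eapply Rle_trans.
    - apply (Cmod_csum2_le n n _ (fun i k => INR n * M ^ 2 * L * T i k)%R).
      intros i k Hi Hk. destruct (Hq i k Hi Hk) as (Hq1 & Hq2).
      rewrite !Cmod_mult, Cmod_conj.
      pose proof (Cmod_ge_0 f). pose proof (Cmod_ge_0 (q i k)).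
      apply Rle_trans with
        ((INR n * (M * al)) * (Cmod f * Cmod (q i k) * (2 * M * al)))%R.
      { apply Rmult_le_compat; auto using Cmod_ge_0.
        - apply Rmult_le_pos; [nra|apply Cmod_ge_0].
        - apply Rmult_le_compat_l; auto. nra. }
      pose proof (amgm s _ _ _ _ Hs Hf Hq2) as A1.
      replace (INR n * (M * al) * (Cmod f * Cmod (q i k) * (2 * M * al)))%R with
        (INR n * M ^ 2 * (2 * (al * Cmod f * (al * Cmod (q i k)))))%R by ring.
      replace (INR n * M ^ 2 * L * T i k)%R with (INR n * M ^ 2 * (L * T i k))%R by ring.
      apply Rmult_le_compat_l; [nra|]. unfold T. lra.
    - right. rewrite <- rsum_scal_l. apply rsum_ext. intros i _.
      now rewrite rsum_scal_l. }
  fold T. change (fun i => rsum n (fun k => (s * Ef + / s * Eq i k)%R))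
    with (fun i => rsum n (T i)).
  set (Y := rsum n (fun i => rsum n (T i))) in *.
  eapply Rle_trans; [apply Cmod_triangle_minus|].
  replace (/ 2 * / (D * D)) with (RtoC (/ 2 * / (D * D))%R).
  2:{ rewrite RtoC_mult, !RtoC_inv, RtoC_mult; auto; lra. }
  replace (/ (D * D * D)) with (RtoC (/ (D * D * D))%R).
  2:{ rewrite RtoC_inv, !RtoC_mult; auto; lra. }
  rewrite Cmod_mult in HS2. rewrite !Cmod_mult, !Cmod_R, !Rabs_pos_eq.
  2:{ now apply Rlt_le, Rinv_0_lt_compat. }
  2:{ apply Rmult_le_pos; [lra|]. now apply Rlt_le, Rinv_0_lt_compat. }
  assert (Hm2 : (m ^ 2 <= D * D)%R) 
    by (replace (D * D)%R with (D ^ 2)%R by ring; apply pow_incr; lra).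
  assert (Hm3 : (m ^ 3 <= D * D * D)%R).
  { replace (D * D * D)%R with (D ^ 3)%R by ring. apply pow_incr. lra. }
  assert (0 < m ^ 2)%R by now apply pow_lt.
  assert (0 < m ^ 3)%R by now apply pow_lt.
  assert (I2 : (/ (D * D) <= / m ^ 2)%R) by now apply Rinv_le_contravar.
  assert (I3 : (/ (D * D * D) <= / m ^ 3)%R) by now apply Rinv_le_contravar.
  assert (0 < / (D * D))%R by (apply Rinv_0_lt_compat; lra).
  assert (0 < / (D * D * D))%R by (apply Rinv_0_lt_compat; lra).
  replace (psi_const n M m * Y)%R with
    (/ 2 * / m ^ 2 * (2 * M * L * Y) + / m ^ 3 * (INR n * M ^ 2 * L * Y))%R
    by (unfold psi_const, L; field; lra).
  apply Rplus_le_compat; apply Rmult_le_compat; auto; try lra.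
  - apply Cmod_ge_0.
  - apply Rmult_le_pos; apply Cmod_ge_0.
Qed.

(** This is |g|^2 (1 + |F|^2), written as a sum of squared moduli of analytic functions. Its
    Laplacian is then a sum of squared moduli of derivatives, the [energy]. *)
Definition zed (n : nat) (F : nat -> C -> C) (g : C -> C) (z : C) : C :=
  g z * Cconj (g z) + csum n (fun l => (F l z * g z) * Cconj (F l z * g z)).

Definition energy (n : nat) (F F' : nat -> C) (g g' : C) : R :=
  (Cmod g' ^ 2 + rsum n (fun l => Cmod (F' l * g + F l * g')%C ^ 2))%R.

Lemma lap_zed (n : nat) (F F' : nat -> C -> C) (g g' : C -> C) (z : C) :
  (forall i, (i < n)%nat -> ana (F i) (F' i)) -> ana g g' ->
  lap (zed n F g) z
    (RtoC (energy n (fun l => F l z) (fun l => F' l z) (g z) (g' z))).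
Proof.
  intros HF Hg. unfold energy. rewrite RtoC_plus, RtoC_rsum, Cmod2_conj.
  apply lap_plus; [now apply lap_abs2|].
  rewrite (csum_ext n _ (fun l => (F' l z * g z + F l z * g' z) *
             Cconj (F' l z * g z + F l z * g' z)))
    by (intros; now rewrite Cmod2_conj).
  apply (lap_csum n (fun l w => (F l w * g w) * Cconj (F l w * g w))).
  intros l Hl.
  apply (lap_abs2 (fun w => F l w * g w) (fun w => F' l w * g w + F l w * g' w)).
  apply ana_mult; auto.
Qed.

Lemma zed_val (n : nat) (F : nat -> C -> C) (g : C -> C) (z : C) :
  zed n F g z =
  RtoC (Cmod (g z) ^ 2 * (1 + rsum n (fun l => Cmod (F l z) ^ 2)))%R.
Proof.
  unfold zed. rewrite RtoC_mult, RtoC_plus, RtoC_rsum, Cmod2_conj.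
  rewrite Cmult_plus_distr_l, <- csum_scal_l. f_equal; [ring|].
  apply csum_ext. intros l _. rewrite Cmod2_conj, Cmult_conj. ring.
Qed.

(** Since F' g = (F g)' - F g', the energy controls |F'| |g| without any bound on F'. This takes the
    place of the Carleson measure estimate in Wolff's proof. *)
Lemma energy_bounds (n : nat) (F F' : nat -> C) (g g' : C) (M al : R) :
  (forall l, (l < n)%nat -> (Cmod (F l) <= M)%R) ->
  (al ^ 2 = rsum n (fun l => Cmod (F' l) ^ 2))%R ->
  let L := (2 + 2 * INR n * M ^ 2)%R in
  (0 <= energy n F F' g g')%R /\
  (Cmod g' ^ 2 <= L * energy n F F' g g')%R /\
  ((al * Cmod g) ^ 2 <= L * energy n F F' g g')%R.
Proof.
  intros HF Hal L.
  set (S := rsum n (fun l => Cmod (F' l * g + F l * g')%C ^ 2)%R).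
  assert (HS : (0 <= S)%R) by (apply rsum_ge_0; intros; apply pow2_ge_0).
  assert (Hg : (0 <= Cmod g' ^ 2)%R) by apply pow2_ge_0.
  assert (HnM : (0 <= INR n * M ^ 2)%R).
  { apply Rmult_le_pos; [apply pos_INR|apply pow2_ge_0]. }
  assert (HE : energy n F F' g g' = (Cmod g' ^ 2 + S)%R) by reflexivity.
  rewrite HE. split; [lra|]. split; [unfold L; nra|].
  assert (H : ((al * Cmod g) ^ 2 <= 2 * S + 2 * (INR n * M ^ 2 * Cmod g' ^ 2))%R).
  { replace ((al * Cmod g) ^ 2)%R with (al ^ 2 * Cmod g ^ 2)%R by ring.
    rewrite Hal, Rmult_comm, <- rsum_scal_l.
    replace (2 * (INR n * M ^ 2 * Cmod g' ^ 2))%R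
      with (rsum n (fun _ => 2 * (M ^ 2 * Cmod g' ^ 2)))%R
      by (rewrite rsum_const; ring).
    unfold S. rewrite <- rsum_scal_l, <- rsum_plus. apply rsum_le. intros l Hl.
    pose proof (Cmod_sqr_plus_le (F' l * g + F l * g') (- (F l * g'))) as H.
    replace (F' l * g + F l * g' + - (F l * g')) with (F' l * g) in H by ring.
    rewrite Cmod_opp, !Cmod_mult in H.
    assert (((Cmod (F l) * Cmod g') ^ 2 <= M ^ 2 * Cmod g' ^ 2)%R).
    { rewrite Rpow_mult_distr. apply Rmult_le_compat_r; auto.
      apply pow_incr. split; [apply Cmod_ge_0|auto]. }
    replace (Cmod g ^ 2 * Cmod (F' l) ^ 2)%R
      with ((Cmod (F' l) * Cmod g) ^ 2)%R by ring.
    lra. }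
  unfold L. nra.
Qed.

Definition qdiff (F G : nat -> C -> C) (i k : nat) (z : C) : C :=
  G i z * F k z - G k z * F i z.

Definition qdiff' (F F' G G' : nat -> C -> C) (i k : nat) (z : C) : C :=
  (G' i z * F k z + G i z * F' k z) - (G' k z * F i z + G k z * F' i z).

(** The factor [kap] has to make the first sum dominate the Laplacian of [psi]; then s is taken so
    small that on the circle the part in f costs at most a quarter of |f|^2. *)
Definition testfun (n : nat) (kap s : R) (F G : nat -> C -> C) (f : C -> C) (z : C) : C :=
  RtoC kap * csum n (fun i => csum n (fun k =>
    RtoC s * zed n F f z + RtoC (/ s) * zed n F (qdiff F G i k) z)) +
  - (1) * psi n F (fun i w => f w * G i w) z.

Lemma testfun_lap (n : nat) (M m s : R) (F F' G G' : nat -> C -> C) (f f' : C -> C) (z : C) :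
  (0 <= M)%R -> (0 < m)%R -> (0 < s)%R ->
  (forall i, (i < n)%nat -> ana (F i) (F' i)) ->
  (forall i, (i < n)%nat -> ana (G i) (G' i)) -> ana f f' ->
  (forall i, (i < n)%nat -> (Cmod (F i z) <= M)%R) ->
  (m <= rsum n (fun i => Cmod (F i z) ^ 2))%R ->
  exists d, lap (testfun n (psi_const n M m) s F G f) z d /\ (0 <= Re d)%R.
Proof.
  intros HM Hm Hs HF HG Hf HFM HD.
  set (D := rsum n (fun i => Cmod (F i z) ^ 2)%R) in *.
  assert (HDip : ip n (fun i => F i z) (fun i => F i z) = RtoC D) by apply ip_self.
  assert (HDC : RtoC D <> 0) by (intros H; apply RtoC_inj in H; lra).
  set (S := rsum n (fun l => Cmod (F' l z) ^ 2)%R).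
  assert (HS : (0 <= S)%R) by (apply rsum_ge_0; intros; apply pow2_ge_0).
  set (al := sqrt S).
  assert (Hal : (0 <= al)%R) by apply sqrt_pos.
  assert (Hal2 : (al ^ 2 = S)%R) by (unfold al; now rewrite pow2_sqrt).
  assert (HF'al : forall i, (i < n)%nat -> (Cmod (F' i z) <= al)%R).
  { intros i Hi.
    apply Rsqr_incr_0_var; auto. rewrite !Rsqr_pow2, Hal2.
    apply (rsum_ge_term n i (fun l => Cmod (F' l z) ^ 2)%R); auto.
    intros; apply pow2_ge_0. }
  assert (Hq : forall i k, (i < n)%nat -> (k < n)%nat ->
            ana (qdiff F G i k) (qdiff' F F' G G' i k)).
  { intros i k Hi Hk. apply ana_minus; apply ana_mult; auto. }
  pose proof (lap_psi n F F' (fun i w => f w * G i w)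
    (fun i w => f' w * G i w + f w * G' i w) z HF) as HL.
  cbv zeta in HL. rewrite HDip in HL.
  assert (HL' := HL (fun i Hi => ana_mult _ _ _ _ Hf (HG i Hi)) HDC). clear HL.
  match type of HL' with lap _ _ ?d => set (dpsi := d) in HL' end.
  set (Ef := energy n (fun l => F l z) (fun l => F' l z) (f z) (f' z)).
  set (Eq i k := energy n (fun l => F l z) (fun l => F' l z)
                   (qdiff F G i k z) (qdiff' F F' G G' i k z)).
  set (T := rsum n (fun i => rsum n (fun k => s * Ef + / s * Eq i k)%R)).
  assert (Hb : (Cmod dpsi <= psi_const n M m * T)%R).
  { destruct (energy_bounds n (fun l => F l z) (fun l => F' l z) (f z) (f' z) M al)
      as (_ & B1 & B2); auto.
    refine (Rle_trans _ _ _ (Req_le _ _ _)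
      (psi_lap_bound n M m al s D Ef (f z) (f' z)
        (ip n (fun i => F' i z) (fun i => F i z))
        (fun i k => qdiff F G i k z) (fun i k => qdiff' F F' G G' i k z)
        (wedge (fun i => F' i z) (fun i => F i z)) Eq HM Hm Hal Hs HD _ _ B1 B2 _)).
    (* The wedge of f G and F is f times [qdiff], and its derivative is f' q + f q'. *)
    - unfold dpsi. f_equal. f_equal; [f_equal|f_equal; f_equal];
        apply csum_ext; intros i _; apply csum_ext; intros k _;
        unfold wedge, qdiff, qdiff'; ring.
    - eapply Rle_trans; [apply Cmod_csum_le|].
      rewrite <- rsum_const. apply rsum_le. intros i Hi.
      rewrite Cmod_mult, Cmod_conj, Rmult_comm.
      apply Rmult_le_compat; auto using Cmod_ge_0.
    - intros i k Hi Hk. unfold wedge.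
      eapply Rle_trans; [apply Cmod_triangle_minus|]. rewrite !Cmod_mult.
      assert (Cmod (F' i z) * Cmod (F k z) <= al * M)%R
        by (apply Rmult_le_compat; auto using Cmod_ge_0).
      assert (Cmod (F' k z) * Cmod (F i z) <= al * M)%R
        by (apply Rmult_le_compat; auto using Cmod_ge_0).
      lra.
    - intros i k Hi Hk. now apply energy_bounds. }
  exists (RtoC (psi_const n M m) * csum n (fun i => csum n (fun k =>
            RtoC s * RtoC Ef + RtoC (/ s) * RtoC (Eq i k))) + - (1) * dpsi).
  split.
  - unfold testfun. apply lap_plus; [|now apply lap_scal].
    apply lap_scal.
    apply (lap_csum n (fun i w => csum n (fun k => RtoC s * zed n F f w +
             RtoC (/ s) * zed n F (qdiff F G i k) w))).
    intros i Hi.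
    apply (lap_csum n (fun k w => RtoC s * zed n F f w +
             RtoC (/ s) * zed n F (qdiff F G i k) w)).
    intros k Hk.
    apply lap_plus; apply lap_scal.
    + now apply lap_zed.
    + apply lap_zed; auto.
  - replace (csum n (fun i => csum n (fun k =>
            RtoC s * RtoC Ef + RtoC (/ s) * RtoC (Eq i k)))) with (RtoC T).
    2:{ unfold T. rewrite RtoC_rsum. apply csum_ext. intros i _.
        rewrite RtoC_rsum. apply csum_ext. intros k _.
        now rewrite RtoC_plus, !RtoC_mult. }
    rewrite Re_plus, <- RtoC_mult, re_RtoC.
    replace (- (1) * dpsi) with (- dpsi) by ring.
    replace (Re (- dpsi)) with (- Re dpsi)%R by reflexivity.
    pose proof (Re_le_Cmod dpsi). lra.
Qed.

Lemma testfun_val (n : nat) (kap s : R) (F G : nat -> C -> C) (f : C -> C) (z : C) :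
  Re (testfun n kap s F G f z) =
  (kap * rsum n (fun i => rsum n (fun k =>
     (s * Cmod (f z) ^ 2 + / s * Cmod (qdiff F G i k z) ^ 2) *
     (1 + rsum n (fun l => Cmod (F l z) ^ 2)))) -
   Re (psi n F (fun i w => (f w * G i w)%C) z))%R.
Proof.
  unfold testfun.
  replace (csum n _) with (RtoC (rsum n (fun i => rsum n (fun k =>
     (s * Cmod (f z) ^ 2 + / s * Cmod (qdiff F G i k z) ^ 2) *
     (1 + rsum n (fun l => Cmod (F l z) ^ 2))))%R)).
  - rewrite <- RtoC_mult, Re_plus, re_RtoC.
    replace (- (1) * psi n F (fun i w => f w * G i w) z)
      with (- psi n F (fun i w => f w * G i w) z) by ring.
    reflexivity.
  - rewrite RtoC_rsum. apply csum_ext. intros i _.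
    rewrite RtoC_rsum. apply csum_ext. intros k _.
    rewrite !zed_val, <- !RtoC_mult, <- RtoC_plus. f_equal. ring.
Qed.

(** On the circle the terms with the conjugate of f cancel in [qdiff] and leave only p, while [psi]
    is |f|^2 up to a cross term of f and p. Of the resulting -|f|^2, one quarter is spent on the
    terms with weight s and one quarter on the cross term, which leaves one half. *)
Lemma testfun_boundary (n : nat) (kap M m s : R) (F G : nat -> C -> C)
    (f : C -> C) (p : nat -> C) (z : C) :
  (0 <= M)%R -> (0 < m)%R -> (0 < s)%R -> (0 <= kap)%R ->
  (kap * (1 + INR n * M ^ 2) * INR n ^ 2 * s <= / 4)%R ->
  (forall i, (i < n)%nat -> (Cmod (F i z) <= M)%R) ->
  (m <= rsum n (fun i => Cmod (F i z) ^ 2))%R ->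
  (forall i, (i < n)%nat -> G i z = F i z * Cconj (f z) - Cconj (p i)) ->
  (Re (testfun n kap s F G f z) <=
   (kap * (1 + INR n * M ^ 2) * (4 * INR n * M ^ 2 * / s) + (INR n + 1) * (M / m) ^ 2) *
     rsum n (fun i => Cmod (p i) ^ 2) - / 2 * Cmod (f z) ^ 2)%R.
Proof.
  intros HM Hm Hs Hk Hks HFM HD HG.
  set (D := rsum n (fun i => Cmod (F i z) ^ 2)%R) in *.
  set (P := rsum n (fun i => Cmod (p i) ^ 2)%R).
  pose proof (pos_INR n) as Hn.
  assert (Hsi : (0 < / s)%R) by now apply Rinv_0_lt_compat.
  assert (HM2 : (0 <= M ^ 2)%R) by apply pow2_ge_0.
  assert (HP : (0 <= P)%R) by (apply rsum_ge_0; intros; apply pow2_ge_0).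
  assert (Hf : (0 <= Cmod (f z) ^ 2)%R) by apply pow2_ge_0.
  assert (HDM : (D <= INR n * M ^ 2)%R).
  { rewrite <- rsum_const. apply rsum_le. intros i Hi.
    apply pow_incr. split; [apply Cmod_ge_0|auto]. }
  rewrite testfun_val. fold D.
  assert (H1 : (rsum n (fun i => rsum n (fun k =>
     (s * Cmod (f z) ^ 2 + / s * Cmod (qdiff F G i k z) ^ 2) * (1 + D))) <=
     (1 + INR n * M ^ 2) *
       (INR n ^ 2 * s * Cmod (f z) ^ 2 + 4 * INR n * M ^ 2 * / s * P))%R).
  { apply Rle_trans with (rsum n (fun i => rsum n (fun k =>
      (1 + INR n * M ^ 2) * (s * Cmod (f z) ^ 2) +
      (1 + INR n * M ^ 2) * (2 * M ^ 2 * / s) * (Cmod (p i) ^ 2 + Cmod (p k) ^ 2)))%R).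
    - apply rsum_le; intros i Hi. apply rsum_le; intros k Hk'.
      assert (Hq : (Cmod (qdiff F G i k z) ^ 2 <=
                    2 * M ^ 2 * (Cmod (p i) ^ 2 + Cmod (p k) ^ 2))%R).
      { unfold qdiff. rewrite !HG by auto.
        replace ((F i z * Cconj (f z) - Cconj (p i)) * F k z -
                 (F k z * Cconj (f z) - Cconj (p k)) * F i z)
          with (Cconj (p k) * F i z + - (Cconj (p i) * F k z)) by ring.
        eapply Rle_trans; [apply Cmod_sqr_plus_le|].
        rewrite Cmod_opp, !Cmod_mult, !Cmod_conj, !Rpow_mult_distr.
        assert (Cmod (F i z) ^ 2 <= M ^ 2)%R by (apply pow_incr; split; auto using Cmod_ge_0).
        assert (Cmod (F k z) ^ 2 <= M ^ 2)%R by (apply pow_incr; split; auto using Cmod_ge_0).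
        pose proof (pow2_ge_0 (Cmod (p i))). pose proof (pow2_ge_0 (Cmod (p k))). nra. }
      assert (0 <= s * Cmod (f z) ^ 2)%R by (apply Rmult_le_pos; lra).
      assert (0 <= / s * Cmod (qdiff F G i k z) ^ 2)%R
        by (apply Rmult_le_pos; [lra|apply pow2_ge_0]).
      assert (/ s * Cmod (qdiff F G i k z) ^ 2 <=
              / s * (2 * M ^ 2 * (Cmod (p i) ^ 2 + Cmod (p k) ^ 2)))%R
        by (apply Rmult_le_compat_l; lra).
      eapply Rle_trans.
      { apply Rmult_le_compat_l with (r2 := (1 + INR n * M ^ 2)%R); lra. }
      eapply Rle_trans.
      { apply Rmult_le_compat_r with
          (r2 := (s * Cmod (f z) ^ 2 +
                  / s * (2 * M ^ 2 * (Cmod (p i) ^ 2 + Cmod (p k) ^ 2)))%R); [nra|lra]. }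
      right. ring.
    - right.
      rewrite (rsum_ext n _ (fun i =>
        INR n * ((1 + INR n * M ^ 2) * (s * Cmod (f z) ^ 2)) +
        (1 + INR n * M ^ 2) * (2 * M ^ 2 * / s) * (INR n * Cmod (p i) ^ 2 + P))%R).
      + rewrite rsum_plus, rsum_const, rsum_scal_l, rsum_plus, rsum_scal_l, rsum_const.
        fold P. ring.
      + intros i _. rewrite rsum_plus, rsum_const, rsum_scal_l, rsum_plus, rsum_const.
        fold P. ring. }
  assert (HDC : RtoC D <> 0) by (intros H; apply RtoC_inj in H; lra).
  assert (H2 : (- Re (psi n F (fun i w => (f w * G i w)%C) z) <=
     - Cmod (f z) ^ 2 + / 4 * Cmod (f z) ^ 2 + (INR n + 1) * (M / m) ^ 2 * P)%R).
  { unfold psi. rewrite ip_self. fold D. unfold ip.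
    rewrite (csum_ext n _ (fun i => (f z * Cconj (f z)) * (F i z * Cconj (F i z)) -
               f z * (Cconj (p i) * Cconj (F i z)))).
    2:{ intros i Hi. rewrite HG by auto. ring. }
    rewrite csum_minus, !csum_scal_l.
    change (csum n (fun i => F i z * Cconj (F i z)))
      with (ip n (fun i => F i z) (fun i => F i z)).
    rewrite ip_self. fold D.
    replace ((f z * Cconj (f z) * D - f z * csum n (fun i => Cconj (p i) * Cconj (F i z))) * / D)
      with (RtoC (Cmod (f z) ^ 2)%R -
            f z * csum n (fun i => Cconj (p i) * Cconj (F i z)) * / D)
      by (rewrite Cmod2_conj; field; exact HDC).
    rewrite Re_minus, re_RtoC.
    set (X := f z * csum n (fun i => Cconj (p i) * Cconj (F i z)) * / D).
    assert (HX : (Cmod X <= / 4 * Cmod (f z) ^ 2 + (INR n + 1) * (M / m) ^ 2 * P)%R).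
    { unfold X. rewrite !Cmod_mult, Cmod_inv, Cmod_R, Rabs_pos_eq by (auto; lra).
      assert (HDi : (0 < / D <= / m)%R).
      { split; [apply Rinv_0_lt_compat; lra|apply Rinv_le_contravar; lra]. }
      assert (Hc : (Cmod (csum n (fun i => (Cconj (p i) * Cconj (F i z))%C)) <=
                    rsum n (fun i => M * Cmod (p i)))%R).
      { eapply Rle_trans; [apply Cmod_csum_le|]. apply rsum_le. intros i Hi.
        rewrite Cmod_mult, !Cmod_conj, Rmult_comm.
        apply Rmult_le_compat_r; auto using Cmod_ge_0. }
      apply Rle_trans with (rsum n (fun i => Cmod (f z) * (M / m * Cmod (p i)))%R).
      - rewrite rsum_scal_l, rsum_scal_l. rewrite rsum_scal_l in Hc.
        unfold Rdiv. rewrite Rmult_assoc. apply Rmult_le_compat_l; [apply Cmod_ge_0|].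
        replace (M * / m * rsum n (fun i => Cmod (p i)))%R
          with ((M * rsum n (fun i => Cmod (p i))) * / m)%R by ring.
        apply Rmult_le_compat; auto using Cmod_ge_0; lra.
      (* This weight makes the n copies of |f|^2 add up to at most one quarter of it; n + 1 in place
         of n covers n = 0. *)
      - assert (Hs' : (0 < / (2 * (INR n + 1)))%R) by (apply Rinv_0_lt_compat; lra).
        apply Rle_trans with (rsum n (fun i =>
          / 2 * (/ (2 * (INR n + 1)) * Cmod (f z) ^ 2 +
                 / / (2 * (INR n + 1)) * (M / m * Cmod (p i)) ^ 2))%R).
        + apply rsum_le. intros i Hi. apply amgm; auto; lra.
        + rewrite rsum_scal_l, rsum_plus, rsum_const, Rinv_inv.
          rewrite (rsum_ext n (fun i => 2 * (INR n + 1) * _)%R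
            (fun i => 2 * (INR n + 1) * (M / m) ^ 2 * Cmod (p i) ^ 2)%R)
            by (intros; ring).
          rewrite rsum_scal_l. fold P.
          assert (INR n * / (2 * (INR n + 1)) <= / 2)%R.
          { rewrite Rinv_mult. apply Rmult_le_reg_r with (INR n + 1)%R; [lra|].
            field_simplify; lra. }
          nra. }
    pose proof (Re_le_Cmod X). lra. }
  assert (H3 : (kap * rsum n (fun i => rsum n (fun k =>
     (s * Cmod (f z) ^ 2 + / s * Cmod (qdiff F G i k z) ^ 2) * (1 + D))) <=
     / 4 * Cmod (f z) ^ 2 + kap * (1 + INR n * M ^ 2) * (4 * INR n * M ^ 2 * / s) * P)%R).
  { eapply Rle_trans; [apply Rmult_le_compat_l; [exact Hk|exact H1]|].
    replace (kap * ((1 + INR n * M ^ 2) *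
       (INR n ^ 2 * s * Cmod (f z) ^ 2 + 4 * INR n * M ^ 2 * / s * P)))%R with
      (kap * (1 + INR n * M ^ 2) * INR n ^ 2 * s * Cmod (f z) ^ 2 +
       kap * (1 + INR n * M ^ 2) * (4 * INR n * M ^ 2 * / s) * P)%R by ring.
    apply Rplus_le_compat_r, Rmult_le_compat_r; auto. }
  lra.
Qed.

(** At the origin [psi] vanishes because G_i does, and the rest of [testfun] is nonnegative. By the
    maximum principle for the sum over rotations, any upper bound B on the circle is nonnegative as
    well. K is fixed before N, f and F are, which permits all later limits. *)
Lemma corona_average (n : nat) (M m : R) :
  (0 <= M)%R -> (0 < m)%R ->
  exists K, (0 <= K)%R /\
    forall (N : nat) (om : nat -> C) (F F' G G' : nat -> C -> C) (f f' : C -> C)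
           (p : nat -> C -> C) (B : R),
    (forall k, Cmod (om k) = 1%R) ->
    (forall i, (i < n)%nat -> ana (F i) (F' i)) ->
    (forall i, (i < n)%nat -> ana (G i) (G' i)) -> ana f f' ->
    (forall i z, (i < n)%nat -> (Cmod z <= 1)%R -> (Cmod (F i z) <= M)%R) ->
    (forall z, (Cmod z <= 1)%R -> (m <= rsum n (fun i => Cmod (F i z) ^ 2))%R) ->
    (forall i, (i < n)%nat -> G i 0 = 0) ->
    (forall i z, (i < n)%nat -> Cmod z = 1%R ->
       G i z = F i z * Cconj (f z) - Cconj (p i z)) ->
    (forall z, Cmod z = 1%R ->
       (rsum N (fun k => K * rsum n (fun i => Cmod (p i (om k * z)%C) ^ 2) -
                         / 2 * Cmod (f (om k * z)%C) ^ 2) <= B)%R) ->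
    (0 <= B)%R.
Proof.
  intros HM Hm.
  set (kap := psi_const n M m).
  assert (Hk : (0 <= kap)%R) by now apply psi_const_ge_0.
  set (A := (kap * (1 + INR n * M ^ 2) * INR n ^ 2)%R).
  assert (HnM : (0 <= INR n * M ^ 2)%R).
  { apply Rmult_le_pos; [apply pos_INR|apply pow2_ge_0]. }
  assert (HA : (0 <= A)%R).
  { apply Rmult_le_pos; [apply Rmult_le_pos; lra|apply pow2_ge_0]. }
  set (s := (/ 4 * / (A + 1))%R).
  assert (Hs : (0 < s)%R).
  { apply Rmult_lt_0_compat; [lra|apply Rinv_0_lt_compat; lra]. }
  assert (HAs : (A * s <= / 4)%R).
  { unfold s. apply Rmult_le_reg_r with (A + 1)%R; [lra|]. field_simplify; lra. }
  exists (kap * (1 + INR n * M ^ 2) * (4 * INR n * M ^ 2 * / s) +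
          (INR n + 1) * (M / m) ^ 2)%R.
  assert (0 < / s)%R by now apply Rinv_0_lt_compat.
  split.
  { pose proof (pos_INR n). pose proof (pow2_ge_0 (M / m)).
    apply Rplus_le_le_0_compat; [|nra].
    apply Rmult_le_pos; [nra|]. apply Rmult_le_pos; [nra|lra]. }
  intros N om F F' G G' f f' p B Hom HF HG Hf HFM HFm HG0 HGb HB.
  set (u := testfun n kap s F G f).
  assert (Hrot : forall k z, Cmod (om k * z) = Cmod z).
  { intros k z. rewrite Cmod_mult, Hom. ring. }
  apply Rle_trans with (Re (csum N (fun k => u (om k * 0)))).
  - rewrite Re_csum. apply rsum_ge_0. intros k _. rewrite Cmult_0_r.
    unfold u. rewrite testfun_val.
    replace (psi n F (fun i w => f w * G i w) 0) with (RtoC 0).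
    + rewrite re_RtoC, Rminus_0_r. apply Rmult_le_pos; auto.
      apply rsum_ge_0; intros i _. apply rsum_ge_0; intros j _.
      apply Rmult_le_pos.
      * apply Rplus_le_le_0_compat; apply Rmult_le_pos; try lra; apply pow2_ge_0.
      * assert (0 <= rsum n (fun l => Cmod (F l 0) ^ 2))%R; [|lra].
        apply rsum_ge_0. intros; apply pow2_ge_0.
    + unfold psi, ip. rewrite csum_0; [ring|]. intros i Hi. rewrite HG0 by auto. ring.
  - apply (max_principle (fun z => csum N (fun k => u (om k * z))) B).
    + intros z Hz.
      assert (Hd : forall k, exists d, lap (fun w => u (om k * w)) z d /\ (0 <= Re d)%R).
      { intros k.
        assert (Hkz : (Cmod (om k * z) <= 1)%R) by now rewrite Hrot.
        destruct (testfun_lap n M m s F F' G G' f f' (om k * z) HM Hm Hs HF HG Hf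
          (fun i Hi => HFM i _ Hi Hkz) (HFm _ Hkz)) as (d & (J & HJ & Hd) & Hp).
        destruct (hasjet_rot _ (om k) z J (Hom k) HJ) as (J' & HJ' & HJJ).
        exists d. split; auto. exists J'. split; [exact HJ'|congruence]. }
      set (d k := proj1_sig (constructive_indefinite_description _ (Hd k))).
      assert (Hdk : forall k, lap (fun w => u (om k * w)) z (d k) /\ (0 <= Re (d k))%R).
      { intros k. unfold d. now destruct (constructive_indefinite_description _ (Hd k)). }
      exists (csum N d). split.
      * apply (lap_csum N (fun k w => u (om k * w))). intros k _. apply Hdk.
      * intros _. rewrite Re_csum. apply rsum_ge_0. intros k _. apply Hdk.
    + intros z Hz. rewrite Re_csum. eapply Rle_trans; [|apply (HB z Hz)].
      apply rsum_le. intros k _.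
      apply (testfun_boundary n kap M m s F G f (fun i => p i (om k * z)) (om k * z)); auto.
      * intros i Hi. apply HFM; auto. rewrite Hrot. lra.
      * apply HFm. rewrite Hrot. lra.
      * intros i Hi. apply HGb; auto. now rewrite Hrot.
Qed.

(** * Lower bounds for adjoint Toeplitz operators *)

Definition cis (t : R) : C := (cos t, sin t).

Lemma cis_pow (t : R) (n : nat) : cis t ^ n = cis (INR n * t).
Proof.
  induction n as [|n IH].
  - simpl. unfold cis. rewrite Rmult_0_l, cos_0, sin_0. reflexivity.
  - rewrite Cpow_S, IH, S_INR.
    replace ((INR n + 1) * t)%R with (t + INR n * t)%R by ring.
    unfold cis. rewrite cos_plus, sin_plus.
    apply injective_projections; simpl; ring.
Qed.

Lemma Cmod_cis (t : R) : Cmod (cis t) = 1%R.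
Proof.
  unfold cis, Cmod. simpl. rewrite !Rmult_1_r.
  replace (cos t * cos t + sin t * sin t)%R with 1%R; [apply sqrt_1|].
  pose proof (sin2_cos2 t) as H. unfold Rsqr in H. lra.
Qed.

Lemma root_of_unity (N : nat) :
  (0 < N)%nat ->
  exists w : C, Cmod w = 1%R /\ w ^ N = 1 /\
    forall m, (0 < m < N)%nat -> w ^ m <> 1.
Proof.
  intros HN. assert (HN' : (0 < INR N)%R) by now apply lt_0_INR.
  exists (cis (2 * PI / INR N)). split; [apply Cmod_cis|]. split.
  - rewrite cis_pow. replace (INR N * (2 * PI / INR N))%R with (2 * PI)%R by (field; lra).
    unfold cis. now rewrite cos_2PI, sin_2PI.
  - intros m Hm. rewrite cis_pow. intros H. apply (f_equal fst) in H. simpl in H.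
    replace (INR m * (2 * PI / INR N))%R with (2 * (PI * (INR m / INR N)))%R in H
      by (field; lra).
    rewrite cos_2a_sin in H.
    assert (Hq : (0 < INR m / INR N < 1)%R).
    { split.
      - apply Rdiv_lt_0_compat; auto. apply lt_0_INR. lia.
      - apply Rmult_lt_reg_r with (INR N); auto.
        unfold Rdiv. rewrite Rmult_assoc, Rinv_l, Rmult_1_r, Rmult_1_l by lra.
        apply lt_INR. lia. }
    pose proof PI_RGT_0.
    assert (Hs : (0 < sin (PI * (INR m / INR N)))%R).
    { apply sin_gt_0; [nra|]. rewrite <- (Rmult_1_r PI) at 2.
      apply Rmult_lt_compat_l; lra. }
    nra.
Qed.

Lemma csum_geom (N : nat) (x : C) :
  (x - 1) * csum N (fun k => x ^ k) = x ^ N - 1.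
Proof.
  induction N as [|N IH]; [simpl; ring|].
  simpl csum. rewrite Cmult_plus_distr_l, IH, Cpow_S. ring.
Qed.

Lemma pow_conj_cancel (z : C) (i j : nat) :
  Cmod z = 1%R -> (j <= i)%nat -> z ^ i * Cconj z ^ j = z ^ (i - j).
Proof.
  intros Hz Hij.
  assert (Hzz : z * Cconj z = 1) by (rewrite <- Cmod2_conj, Hz; f_equal; ring).
  replace i with (i - j + j)%nat at 1 by lia.
  rewrite Cpow_add_r, <- Cmult_assoc, <- Cpow_mult_l, Hzz, Cpow_1_l. ring.
Qed.

Lemma pow_conj_cancel' (z : C) (i j : nat) :
  Cmod z = 1%R -> (i <= j)%nat -> z ^ i * Cconj z ^ j = Cconj z ^ (j - i).
Proof.
  intros Hz Hij.
  assert (H := pow_conj_cancel (Cconj z) j i).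
  rewrite Cconj_conj, Cmod_conj in H. rewrite Cmult_comm. now apply H.
Qed.

Definition peval (d : nat) (c : nat -> C) (z : C) : C := csum d (fun k => c k * z ^ k).

(** Discrete Parseval identity, by orthogonality of the characters of the N-th roots of unity. The
    value is the same for every z on the circle, so the rotated sums of [corona_average] become
    constant there. *)
Lemma parseval (N : nat) (w z : C) (c : nat -> C) :
  Cmod w = 1%R -> Cmod z = 1%R -> w ^ N = 1 ->
  (forall m, (0 < m < N)%nat -> w ^ m <> 1) ->
  rsum N (fun k => Cmod (peval N c (w ^ k * z)) ^ 2)%R =
  (INR N * rsum N (fun j => Cmod (c j) ^ 2))%R.
Proof.
  intros Hw Hz HwN Hprim.
  assert (Horth : forall i j, (i < N)%nat -> (j < N)%nat ->
    csum N (fun k => (w ^ k * z) ^ i * Cconj ((w ^ k * z) ^ j)) =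
    if Nat.eqb j i then RtoC (INR N) else 0).
  { intros i j Hi Hj.
    rewrite (csum_ext N _ (fun k => (z ^ i * Cconj z ^ j) * (w ^ i * Cconj w ^ j) ^ k)).
    2:{ intros k _. rewrite Cpow_conj, Cmult_conj, Cpow_conj, !Cpow_mult_l, <- !Cpow_mult_r.
        rewrite (Nat.mul_comm i k), (Nat.mul_comm j k). ring. }
    rewrite csum_scal_l. case Nat.eqb_spec; intros Hij.
    - subst j. rewrite !pow_conj_cancel, Nat.sub_diag by auto. simpl.
      rewrite (csum_ext N _ (fun _ => RtoC 1)) by (intros; apply Cpow_1_l).
      rewrite <- RtoC_rsum, rsum_const, Rmult_1_r. ring.
    - set (x := w ^ i * Cconj w ^ j).
      assert (Hx1 : x ^ N = 1).
      { unfold x. rewrite Cpow_mult_l, <- !Cpow_mult_r, (Nat.mul_comm i), (Nat.mul_comm j),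
          !Cpow_mult_r, <- (Cpow_conj w N), HwN, Cconj_RtoC, !Cpow_1_l. ring. }
      assert (Hx : x - 1 <> 0).
      { apply Cminus_eq_contra. unfold x.
        destruct (Nat.le_gt_cases j i) as [Hle|Hlt].
        - rewrite pow_conj_cancel by auto. apply Hprim. lia.
        - rewrite pow_conj_cancel' by (auto; lia). rewrite <- Cpow_conj.
          intros H. apply (Hprim (j - i)%nat); [lia|].
          now rewrite <- (Cconj_conj (w ^ _)), H, Cconj_RtoC. }
      pose proof (csum_geom N x) as H. rewrite Hx1 in H.
      assert (HS : csum N (fun k => x ^ k) = 0).
      { replace (csum N (fun k => x ^ k)) with
          (/ (x - 1) * ((x - 1) * csum N (fun k => x ^ k))) by (field; auto).
        rewrite H. ring. }
      change (csum N (Cpow x)) with (csum N (fun k => x ^ k)). rewrite HS. ring. }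
  apply RtoC_inj. rewrite RtoC_mult, !RtoC_rsum.
  rewrite (csum_ext N _ (fun k => csum N (fun i => csum N (fun j =>
    (c i * Cconj (c j)) * ((w ^ k * z) ^ i * Cconj ((w ^ k * z) ^ j)))))).
  2:{ intros k _. rewrite Cmod2_conj. unfold peval.
      rewrite csum_conj, <- csum_prod. apply csum_ext; intros i _.
      apply csum_ext; intros j _. rewrite Cmult_conj. ring. }
  rewrite csum_swap, <- csum_scal_l. apply csum_ext; intros i Hi.
  rewrite csum_swap.
  rewrite (csum_ext N _ (fun j => if Nat.eqb j i then c i * Cconj (c j) * RtoC (INR N) else 0)).
  2:{ intros j Hj. rewrite csum_scal_l, Horth by auto. case Nat.eqb; ring. }
  rewrite (csum_delta N i (fun j => c i * Cconj (c j) * RtoC (INR N))) by auto.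
  rewrite Cmod2_conj. ring.
Qed.

Lemma ana_peval (d : nat) (c : nat -> C) :
  ana (peval d c) (fun z => csum d (fun k => c k * (INR k * z ^ (k - 1)))).
Proof.
  apply (ana_csum d (fun k z => c k * z ^ k)). intros k _.
  apply ana_scal, ana_pow.
Qed.

(* Coefficients of the analytic part of (conj F) f on the circle, i.e. of
   the adjoint Toeplitz operator applied to f. *)
Definition tadj (N : nat) (a b : nat -> C) (l : nat) : C :=
  csum N (fun k => Cconj (a k) * b (l + k)%nat).

(* The strictly analytic part of F (conj f) on the circle. *)
Definition hankel (d N : nat) (a b : nat -> C) (z : C) : C :=
  csum d (fun k => csum N (fun m =>
    if Nat.ltb m k then a k * Cconj (b m) * z ^ (k - m) else 0)).

Lemma ana_hankel (d N : nat) (a b : nat -> C) : exists g, ana (hankel d N a b) g.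
Proof.
  exists (fun z => csum d (fun k => csum N (fun m =>
    if Nat.ltb m k then a k * Cconj (b m) * (INR (k - m) * z ^ (k - m - 1)) else 0))).
  apply (ana_csum d (fun k z => csum N (fun m =>
    if Nat.ltb m k then a k * Cconj (b m) * z ^ (k - m) else 0))). intros k _.
  apply (ana_csum N (fun m z =>
    if Nat.ltb m k then a k * Cconj (b m) * z ^ (k - m) else 0)). intros m _.
  case Nat.ltb; [apply ana_scal, ana_pow|apply ana_const].
Qed.

Lemma hankel_0 (d N : nat) (a b : nat -> C) : hankel d N a b 0 = 0.
Proof.
  unfold hankel. apply csum_0; intros k _. apply csum_0; intros m _.
  case Nat.ltb_spec; intros H; auto.
  replace (k - m)%nat with (S (k - m - 1)) by lia. rewrite Cpow_S. ring.
Qed.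

(** On the circle z^k times the conjugate of z^m depends only on k - m. The terms with m < k form
    [hankel]; those with k <= m are the conjugate of the polynomial with coefficients [tadj]. *)
Lemma hankel_boundary (d N : nat) (a b : nat -> C) (z : C) :
  (N <= d)%nat -> (forall k, (N <= k)%nat -> b k = 0) -> Cmod z = 1%R ->
  hankel d N a b z =
  peval d a z * Cconj (peval N b z) - Cconj (peval N (tadj N a b) z).
Proof.
  intros HNd Hb Hz. unfold peval at 1 2.
  rewrite csum_conj, <- csum_prod.
  assert (HT : Cconj (peval N (tadj N a b) z) =
    csum d (fun k => csum N (fun m =>
      if Nat.ltb m k then 0 else a k * Cconj (b m) * Cconj z ^ (m - k)))).
  { rewrite (csum_trunc N d); auto.
    2:{ intros k Hk. apply csum_0. intros m Hm. case Nat.ltb_spec; [auto|lia]. }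
    unfold peval, tadj. rewrite csum_conj.
    rewrite (csum_ext N _ (fun l => csum N (fun k =>
      a k * Cconj (b (l + k)%nat) * Cconj z ^ l))).
    2:{ intros l _. rewrite Cmult_conj, csum_conj, Cpow_conj, <- csum_scal_r.
        apply csum_ext. intros k _. now rewrite Cmult_conj, Cconj_conj. }
    rewrite csum_swap. apply csum_ext. intros k Hk.
    rewrite (csum_trunc (N - k) N); [|lia|].
    2:{ intros l Hl. rewrite Hb by lia. rewrite Cconj_RtoC. ring. }
    replace (csum N (fun m => if Nat.ltb m k then 0 else
        a k * Cconj (b m) * Cconj z ^ (m - k))) with
      (csum (k + (N - k)) (fun m => if Nat.ltb m k then 0 else
        a k * Cconj (b m) * Cconj z ^ (m - k))) by (f_equal; lia).
    rewrite csum_app, (csum_0 k), Cplus_0_l.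
    2:{ intros m Hm. case Nat.ltb_spec; [auto|lia]. }
    apply csum_ext. intros l Hl. case Nat.ltb_spec; [lia|]. intros _.
    replace (k + l - k)%nat with l by lia. now rewrite Nat.add_comm. }
  rewrite HT. unfold hankel. rewrite <- csum_minus.
  apply csum_ext; intros k _. rewrite <- csum_minus.
  apply csum_ext; intros m _. rewrite Cmult_conj, Cpow_conj.
  replace (a k * z ^ k * (Cconj (b m) * Cconj z ^ m))
    with (a k * Cconj (b m) * (z ^ k * Cconj z ^ m)) by ring.
  case Nat.ltb_spec; intros H.
  - rewrite pow_conj_cancel by (auto; lia). ring.
  - rewrite pow_conj_cancel' by (auto; lia). ring.
Qed.

(** With the N-th roots of unity as rotations, Parseval turns the boundary sum into the constant N
    (K Y - X / 2), where X and Y are the two sides of the claim; [corona_average] says that it is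
    nonnegative. *)
Lemma toeplitz_lower_poly (n : nat) (M m : R) :
  (0 <= M)%R -> (0 < m)%R ->
  exists K, (0 <= K)%R /\
    forall (N d : nat) (a : nat -> nat -> C) (b : nat -> C),
    (N <= d)%nat -> (forall k, (N <= k)%nat -> b k = 0) ->
    (forall i z, (i < n)%nat -> (Cmod z <= 1)%R -> (Cmod (peval d (a i) z) <= M)%R) ->
    (forall z, (Cmod z <= 1)%R -> (m <= rsum n (fun i => Cmod (peval d (a i) z) ^ 2))%R) ->
    (rsum N (fun k => Cmod (b k) ^ 2) <=
     K * rsum n (fun i => rsum N (fun l => Cmod (tadj N (a i) b l) ^ 2)))%R.
Proof.
  intros HM Hm. destruct (corona_average n M m HM Hm) as (K & HK & Hcor).
  exists (2 * K)%R. split; [lra|]. intros N d a b HNd Hb HFM HFm.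
  destruct N as [|N'].
  { simpl. rewrite rsum_const. lra. }
  set (N := S N') in *. assert (HN : (0 < N)%nat) by (unfold N; lia).
  destruct (root_of_unity N HN) as (w & Hw & HwN & Hprim).
  set (X := rsum N (fun k => Cmod (b k) ^ 2)%R).
  set (Y := rsum n (fun i => rsum N (fun l => Cmod (tadj N (a i) b l) ^ 2))%R).
  assert (HB : (0 <= INR N * (K * Y - / 2 * X))%R).
  { set (gp i := proj1_sig (constructive_indefinite_description _ (ana_hankel d N (a i) b))).
    apply (Hcor N (fun k => w ^ k) (fun i => peval d (a i))
      (fun i z => csum d (fun k => a i k * (INR k * z ^ (k - 1))))
      (fun i => hankel d N (a i) b) gp (peval N b)
      (fun z => csum N (fun k => b k * (INR k * z ^ (k - 1))))
      (fun i => peval N (tadj N (a i) b))); auto.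
    - intros k. now rewrite Cmod_pow, Hw, pow1.
    - intros i _. apply ana_peval.
    - intros i _. unfold gp. now destruct (constructive_indefinite_description _ _).
    - apply ana_peval.
    - intros i _. apply hankel_0.
    - intros i z _ Hz. now apply hankel_boundary.
    - intros z Hz. right.
      rewrite (rsum_ext N _ (fun k =>
        K * rsum n (fun i => Cmod (peval N (tadj N (a i) b) (w ^ k * z)) ^ 2) +
        (- / 2) * Cmod (peval N b (w ^ k * z)) ^ 2)%R) by (intros; ring).
      rewrite rsum_plus, !rsum_scal_l, parseval, rsum_swap by auto.
      rewrite (rsum_ext n _ (fun i => INR N * rsum N (fun l => Cmod (tadj N (a i) b l) ^ 2))%R).
      + rewrite rsum_scal_l. fold X Y. ring.
      + intros i _. now apply parseval. }
  assert (HN' : (0 < INR N)%R) by now apply lt_0_INR.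
  assert (0 <= K * Y - / 2 * X)%R by (apply Rmult_le_reg_l with (INR N); lra).
  lra.
Qed.

(** * Limits of complex sequences *)

Lemma ccv_ext (u v : nat -> C) (l : C) : (forall n, u n = v n) -> ccv u l -> ccv v l.
Proof.
  intros H Hu eps Heps. destruct (Hu eps Heps) as (N & HN).
  exists N. intros n Hn. rewrite <- H. auto.
Qed.

Lemma ccv_const (c : C) : ccv (fun _ => c) c.
Proof.
  intros eps Heps. exists O. intros n _.
  replace (c - c) with (RtoC 0) by ring. now rewrite Cmod_0.
Qed.

Lemma ccv_plus (u v : nat -> C) (l m : C) :
  ccv u l -> ccv v m -> ccv (fun n => u n + v n) (l + m).
Proof.
  intros Hu Hv eps Heps.
  destruct (Hu (eps / 2)%R) as (N1 & H1); [lra|].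
  destruct (Hv (eps / 2)%R) as (N2 & H2); [lra|].
  exists (Nat.max N1 N2). intros n Hn.
  specialize (H1 n ltac:(lia)). specialize (H2 n ltac:(lia)).
  replace (u n + v n - (l + m)) with ((u n - l) + (v n - m)) by ring.
  pose proof (Cmod_triangle (u n - l) (v n - m)). lra.
Qed.

Lemma ccv_mult (u v : nat -> C) (l m : C) :
  ccv u l -> ccv v m -> ccv (fun n => u n * v n) (l * m).
Proof.
  intros Hu Hv eps Heps.
  pose proof (Cmod_ge_0 l) as Hl. pose proof (Cmod_ge_0 m) as Hm.
  destruct (Hu 1%R) as (N0 & H0); [lra|].
  destruct (Hu (eps / 2 / (Cmod m + 1))%R) as (N1 & H1); [apply Rdiv_lt_0_compat; lra|].
  destruct (Hv (eps / 2 / (Cmod l + 1))%R) as (N2 & H2); [apply Rdiv_lt_0_compat; lra|].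
  exists (Nat.max N0 (Nat.max N1 N2)). intros n Hn.
  specialize (H0 n ltac:(lia)). specialize (H1 n ltac:(lia)). specialize (H2 n ltac:(lia)).
  replace (u n * v n - l * m) with (u n * (v n - m) + m * (u n - l)) by ring.
  eapply Rle_lt_trans; [apply Cmod_triangle|]. rewrite !Cmod_mult.
  assert (Hun : (Cmod (u n) <= Cmod l + 1)%R).
  { pose proof (Cmod_triangle_rev (u n) l). lra. }
  apply (Rmult_lt_compat_r (Cmod m + 1)) in H1; [|lra].
  apply (Rmult_lt_compat_r (Cmod l + 1)) in H2; [|lra].
  replace (eps / 2 / (Cmod m + 1) * (Cmod m + 1))%R with (eps / 2)%R in H1 by (field; lra).
  replace (eps / 2 / (Cmod l + 1) * (Cmod l + 1))%R with (eps / 2)%R in H2 by (field; lra).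
  pose proof (Cmod_ge_0 (u n - l)). pose proof (Cmod_ge_0 (v n - m)).
  assert (Cmod (u n) * Cmod (v n - m) <= (Cmod l + 1) * Cmod (v n - m))%R
    by (apply Rmult_le_compat_r; auto).
  nra.
Qed.

Lemma ccv_conj (u : nat -> C) (l : C) : ccv u l -> ccv (fun n => Cconj (u n)) (Cconj l).
Proof.
  intros Hu eps Heps. destruct (Hu eps Heps) as (N & HN).
  exists N. intros n Hn. rewrite <- Cminus_conj, Cmod_conj. auto.
Qed.

Lemma ccv_csum (m : nat) (u : nat -> nat -> C) (l : nat -> C) :
  (forall k, (k < m)%nat -> ccv (fun n => u n k) (l k)) ->
  ccv (fun n => csum m (u n)) (csum m l).
Proof.
  induction m as [|m IH]; intros H; simpl; [apply ccv_const|].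
  apply ccv_plus; auto.
Qed.

Lemma ccv_pow (u : nat -> C) (l : C) (k : nat) :
  ccv u l -> ccv (fun n => u n ^ k) (l ^ k).
Proof.
  intros Hu. induction k as [|k IH]; [apply (ccv_const 1)|].
  now apply (ccv_mult u (fun n => u n ^ k)).
Qed.

Lemma ccv_unique (u : nat -> C) (l m : C) : ccv u l -> ccv u m -> l = m.
Proof.
  intros Hl Hm. apply Ceq_minus, Cmod_eq_0.
  apply Rle_antisym; [|apply Cmod_ge_0]. apply le_epsilon. intros eps Heps.
  destruct (Hl (eps / 2)%R) as (N1 & H1); [lra|].
  destruct (Hm (eps / 2)%R) as (N2 & H2); [lra|].
  specialize (H1 (Nat.max N1 N2) ltac:(lia)). specialize (H2 (Nat.max N1 N2) ltac:(lia)).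
  replace (l - m) with ((u (Nat.max N1 N2) - m) - (u (Nat.max N1 N2) - l)) by ring.
  pose proof (Cmod_triangle_minus (u (Nat.max N1 N2) - m) (u (Nat.max N1 N2) - l)). lra.
Qed.

Lemma ccv_Re_le (u : nat -> C) (l : C) (x : R) (N0 : nat) :
  (forall n, (N0 <= n)%nat -> (Re (u n) <= x)%R) -> ccv u l -> (Re l <= x)%R.
Proof.
  intros H Hu. apply le_epsilon. intros eps Heps.
  destruct (Hu eps Heps) as (N & HN).
  specialize (HN (Nat.max N N0) ltac:(lia)). specialize (H (Nat.max N N0) ltac:(lia)).
  pose proof (re_le_Cmod (u (Nat.max N N0) - l)) as H1.
  rewrite Re_minus in H1. apply Rabs_le_between in H1. lra.
Qed.

Lemma ccv_Re_ge (u : nat -> C) (l : C) (x : R) (N0 : nat) :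
  (forall n, (N0 <= n)%nat -> (x <= Re (u n))%R) -> ccv u l -> (x <= Re l)%R.
Proof.
  intros H Hu. apply le_epsilon. intros eps Heps.
  destruct (Hu eps Heps) as (N & HN).
  specialize (HN (Nat.max N N0) ltac:(lia)). specialize (H (Nat.max N N0) ltac:(lia)).
  pose proof (re_le_Cmod (u (Nat.max N N0) - l)) as H1.
  rewrite Re_minus in H1. apply Rabs_le_between in H1. lra.
Qed.

Lemma ccv_Cmod_le (u : nat -> C) (l : C) (x : R) (N0 : nat) :
  (forall n, (N0 <= n)%nat -> (Cmod (u n) <= x)%R) -> ccv u l -> (Cmod l <= x)%R.
Proof.
  intros H Hu. apply le_epsilon. intros eps Heps.
  destruct (Hu eps Heps) as (N & HN).
  specialize (HN (Nat.max N N0) ltac:(lia)). specialize (H (Nat.max N N0) ltac:(lia)).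
  replace l with (u (Nat.max N N0) - (u (Nat.max N N0) - l)) by ring.
  pose proof (Cmod_triangle_minus (u (Nat.max N N0)) (u (Nat.max N N0) - l)). lra.
Qed.

(** Real quantities pass to the limit as [RtoC], so one notion of convergence suffices; a simple sum
    is used as a double sum of outer length 1. *)
Lemma ccv_sqr_sum (n m : nat) (u : nat -> nat -> nat -> C) (l : nat -> nat -> C) :
  (forall i k, (i < n)%nat -> (k < m)%nat -> ccv (fun t => u t i k) (l i k)) ->
  ccv (fun t => RtoC (rsum n (fun i => rsum m (fun k => Cmod (u t i k) ^ 2)))%R)
      (RtoC (rsum n (fun i => rsum m (fun k => Cmod (l i k) ^ 2)))%R).
Proof.
  intros H.
  assert (E : forall v : nat -> nat -> C,
    RtoC (rsum n (fun i => rsum m (fun k => Cmod (v i k) ^ 2)))%R =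
    csum n (fun i => csum m (fun k => v i k * Cconj (v i k)))).
  { intros v. rewrite RtoC_rsum. apply csum_ext; intros i _.
    rewrite RtoC_rsum. apply csum_ext; intros k _. now rewrite Cmod2_conj. }
  rewrite E.
  apply (ccv_ext (fun t => csum n (fun i => csum m (fun k => u t i k * Cconj (u t i k))))).
  { intros t. now rewrite E. }
  apply (ccv_csum n (fun t i => csum m (fun k => u t i k * Cconj (u t i k)))).
  intros i Hi. apply (ccv_csum m (fun t k => u t i k * Cconj (u t i k))).
  intros k Hk. apply ccv_mult; [|apply ccv_conj]; auto.
Qed.

(** * Power series, their tails and dilations *)

Lemma rsum_geom_le (x : R) (N : nat) :
  (0 <= x < 1)%R -> (rsum N (fun k => x ^ k) <= / (1 - x))%R.
Proof.
  intros Hx.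
  assert (H : ((1 - x) * rsum N (fun k => x ^ k) = 1 - x ^ N)%R).
  { induction N as [|N IH]; simpl; [ring|]. rewrite Rmult_plus_distr_l, IH. ring. }
  assert (0 <= x ^ N)%R by (apply pow_le; lra).
  apply Rmult_le_reg_l with (1 - x)%R; [lra|]. rewrite H, Rinv_r; lra.
Qed.

Lemma peval_tail (a : nat -> C) (A x : R) (z : C) (d e : nat) :
  (forall k, (Cmod (a k) <= A)%R) -> (0 <= x < 1)%R -> (Cmod z <= x)%R -> (d <= e)%nat ->
  (Cmod (peval e a z - peval d a z) <= A * x ^ d * / (1 - x))%R.
Proof.
  intros HA Hx Hz Hde. unfold peval. replace e with (d + (e - d))%nat by lia.
  rewrite csum_app. set (S := csum (e - d) _).
  replace (csum d (fun k => a k * z ^ k) + S - csum d (fun k => a k * z ^ k)) with S by ring.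
  unfold S. eapply Rle_trans; [apply Cmod_csum_le|].
  assert (HA0 : (0 <= A)%R) by (eapply Rle_trans; [apply Cmod_ge_0|apply (HA O)]).
  apply Rle_trans with (rsum (e - d) (fun k => A * x ^ d * x ^ k)%R).
  - apply rsum_le. intros k _. rewrite Cmod_mult, Cmod_pow, Rmult_assoc, <- pow_add.
    apply Rmult_le_compat; auto using Cmod_ge_0, pow_le.
    apply pow_incr. split; auto using Cmod_ge_0.
  - rewrite rsum_scal_l. apply Rmult_le_compat_l; [|now apply rsum_geom_le].
    apply Rmult_le_pos; auto. apply pow_le; lra.
Qed.

Definition pser (a : nat -> C) (z l : C) : Prop := ccv (fun d => peval d a z) l.

Lemma pser_tail (a : nat -> C) (A x : R) (z l : C) (d : nat) :
  (forall k, (Cmod (a k) <= A)%R) -> (0 <= x < 1)%R -> (Cmod z <= x)%R -> pser a z l ->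
  (Cmod (l - peval d a z) <= A * x ^ d * / (1 - x))%R.
Proof.
  intros HA Hx Hz Hl.
  apply (ccv_Cmod_le (fun e => peval e a z - peval d a z) _ _ d).
  - intros e He. now apply peval_tail.
  - apply (ccv_plus (fun e => peval e a z) (fun _ => - peval d a z)); auto.
    apply ccv_const.
Qed.

Definition dilate (r : R) (a : nat -> C) (k : nat) : C := a k * RtoC r ^ k.

Lemma peval_dilate (r : R) (a : nat -> C) (d : nat) (z : C) :
  peval d (dilate r a) z = peval d a (RtoC r * z).
Proof.
  unfold peval, dilate. apply csum_ext. intros k _. rewrite Cpow_mult_l. ring.
Qed.

(** The geometric tail bound depends only on A and r, so one degree d serves all F_i at once. *)
Lemma dilate_approx (A r eps : R) (N : nat) :
  (0 <= r < 1)%R -> (0 < eps)%R ->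
  exists d, (N <= d)%nat /\ forall (a : nat -> C) (F : C -> C) (z : C),
    (forall k, (Cmod (a k) <= A)%R) ->
    (forall z, (Cmod z < 1)%R -> pser a z (F z)) -> (Cmod z <= 1)%R ->
    (Cmod (RtoC r * z) < 1)%R /\
    (Cmod (F (RtoC r * z)%C - peval d (dilate r a) z) <= eps)%R.
Proof.
  intros Hr Heps. pose proof (Rabs_pos A) as HA0.
  destruct (pow_lt_1_zero r ltac:(rewrite Rabs_pos_eq; lra)
    (eps * (1 - r) / (Rabs A + 1))%R) as (d & Hd).
  { apply Rdiv_lt_0_compat; [|lra]. apply Rmult_lt_0_compat; lra. }
  exists (Nat.max N d). split; [lia|].
  specialize (Hd (Nat.max N d) ltac:(lia)).
  rewrite Rabs_pos_eq in Hd by (apply pow_le; lra).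
  apply (Rmult_lt_compat_r (Rabs A + 1)) in Hd; [|lra].
  replace (eps * (1 - r) / (Rabs A + 1) * (Rabs A + 1))%R with (eps * (1 - r))%R in Hd
    by (field; lra).
  intros a F z HA HF Hz.
  assert (Hrz : (Cmod (RtoC r * z) <= r)%R).
  { rewrite Cmod_mult, Cmod_R, Rabs_pos_eq by lra.
    pose proof (Cmod_ge_0 z). nra. }
  split; [lra|]. rewrite peval_dilate.
  apply Rle_trans with (Rabs A * r ^ Nat.max N d * / (1 - r))%R.
  - apply pser_tail; auto; [|apply HF; lra].
    intros k. eapply Rle_trans; [apply HA|apply Rle_abs].
  - assert (0 <= r ^ Nat.max N d)%R by (apply pow_le; lra).
    apply Rmult_le_reg_r with (1 - r)%R; [lra|].
    rewrite Rmult_assoc, Rinv_l, Rmult_1_r by lra. nra.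
Qed.

Definition radius (t : nat) : R := (1 - / (INR t + 1))%R.

Lemma radius_range (t : nat) : (0 <= radius t < 1)%R.
Proof.
  unfold radius. pose proof (pos_INR t).
  assert (0 < / (INR t + 1))%R by (apply Rinv_0_lt_compat; lra).
  assert (/ (INR t + 1) <= 1)%R by (rewrite <- Rinv_1; apply Rinv_le_contravar; lra).
  lra.
Qed.

Lemma ccv_dilate (a : nat -> C) (k : nat) : ccv (fun t => dilate (radius t) a k) (a k).
Proof.
  assert (Hrt1 : ccv (fun t => RtoC (radius t)) 1).
  { intros eps Heps. destruct (archimed_cor1 eps Heps) as (t0 & Ht & Ht0).
    exists t0. intros t Htt. rewrite <- RtoC_minus, Cmod_R. unfold radius.
    replace (1 - / (INR t + 1) - 1)%R with (- / (INR t + 1))%R by ring.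
    pose proof (pos_INR t). rewrite Rabs_Ropp, Rabs_pos_eq.
    2:{ apply Rlt_le, Rinv_0_lt_compat. lra. }
    eapply Rle_lt_trans; [|exact Ht]. apply Rinv_le_contravar; [now apply lt_0_INR|].
    apply le_INR in Htt. lra. }
  replace (a k) with (a k * 1 ^ k) by (rewrite Cpow_1_l; ring).
  apply (ccv_mult (fun _ => a k)); [apply ccv_const|now apply ccv_pow].
Qed.

(** Dilation by r < 1 and a cutoff at degree d reduce to polynomials. The constants M + 1 and m / 4
    absorb the error and do not depend on r, so r may tend to 1 in an inequality between finitely
    many coefficients. *)
Lemma toeplitz_lower (n : nat) (M m : R) :
  (0 <= M)%R -> (0 < m)%R ->
  exists K, (0 <= K)%R /\
    forall (N : nat) (A : R) (a : nat -> nat -> C) (F : nat -> C -> C) (b : nat -> C),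
    (forall i k, (i < n)%nat -> (Cmod (a i k) <= A)%R) ->
    (forall i z, (i < n)%nat -> (Cmod z < 1)%R -> pser (a i) z (F i z)) ->
    (forall i z, (i < n)%nat -> (Cmod z < 1)%R -> (Cmod (F i z) <= M)%R) ->
    (forall z, (Cmod z < 1)%R -> (m <= rsum n (fun i => Cmod (F i z) ^ 2))%R) ->
    (forall k, (N <= k)%nat -> b k = 0) ->
    (rsum N (fun k => Cmod (b k) ^ 2) <=
     K * rsum n (fun i => rsum N (fun l => Cmod (tadj N (a i) b l) ^ 2)))%R.
Proof.
  intros HM Hm.
  destruct (toeplitz_lower_poly n (M + 1) (m / 4)) as (K & HK & Hpoly); [lra|lra|].
  exists K. split; auto. intros N A a F b HA HF HFM HFm Hb.
  assert (Hr : forall r : R, (0 <= r < 1)%R ->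
    (rsum N (fun k => Cmod (b k) ^ 2) <=
     K * rsum n (fun i => rsum N (fun l => Cmod (tadj N (dilate r (a i)) b l) ^ 2)))%R).
  { intros r Hr. pose proof (pos_INR n) as Hn.
    (* The choice gives n eps^2 <= m / 4, and m <= 2 n eps^2 + 2 sum |P_i|^2 then leaves m / 4 for
       the polynomials P_i. *)
    set (eps := Rmin 1 (m / 4 / (INR n + 1))).
    assert (Heps : (0 < eps)%R).
    { apply Rmin_pos; [lra|]. apply Rdiv_lt_0_compat; lra. }
    assert (Heps1 : (eps <= 1)%R) by apply Rmin_l.
    assert (Heps2 : (INR n * eps ^ 2 <= m / 4)%R).
    { assert (H : (eps <= m / 4 / (INR n + 1))%R) by apply Rmin_r.
      apply (Rmult_le_compat_r (INR n + 1)) in H; [|lra].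
      replace (m / 4 / (INR n + 1) * (INR n + 1))%R with (m / 4)%R in H by (field; lra).
      assert (eps ^ 2 <= eps)%R by nra.
      assert (INR n * eps ^ 2 <= INR n * eps)%R by (apply Rmult_le_compat_l; auto).
      lra. }
    destruct (dilate_approx A r eps N Hr Heps) as (d & HNd & Hd).
    assert (Happ : forall i z, (i < n)%nat -> (Cmod z <= 1)%R ->
      (Cmod (RtoC r * z) < 1)%R /\
      (Cmod (F i (RtoC r * z)%C - peval d (dilate r (a i)) z) <= eps)%R)
      by (intros i z Hi; apply Hd; auto).
    apply (Hpoly N d (fun i => dilate r (a i))); auto.
    - intros i z Hi Hz. destruct (Happ i z Hi Hz) as (H1 & H2).
      specialize (HFM i _ Hi H1).
      set (P := peval d (dilate r (a i)) z) in *. set (v := F i (r * z)) in *.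
      replace P with (v - (v - P)) by ring.
      pose proof (Cmod_triangle_minus v (v - P)). lra.
    - intros z Hz.
      assert (Hrz : (Cmod (RtoC r * z) < 1)%R).
      { rewrite Cmod_mult, Cmod_R, Rabs_pos_eq by lra.
        pose proof (Cmod_ge_0 z). nra. }
      specialize (HFm _ Hrz).
      assert (H : (rsum n (fun i => Cmod (F i (RtoC r * z)%C) ^ 2) <=
        rsum n (fun i => 2 * eps ^ 2 + 2 * Cmod (peval d (dilate r (a i)) z) ^ 2))%R).
      { apply rsum_le. intros i Hi. destruct (Happ i z Hi Hz) as (_ & H2).
        set (P := peval d (dilate r (a i)) z) in *. set (v := F i (RtoC r * z)) in *.
        replace v with ((v - P) + P) by ring.
        pose proof (Cmod_sqr_plus_le (v - P) P).
        assert (Cmod (v - P) ^ 2 <= eps ^ 2)%R by (apply pow_incr; split; auto using Cmod_ge_0).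
        lra. }
      rewrite rsum_plus, rsum_const, rsum_scal_l in H. lra. }
  set (Y v := rsum n (fun i => rsum N (fun l => Cmod (v i l) ^ 2))%R).
  change (rsum N (fun k => Cmod (b k) ^ 2)%R <= K * Y (fun i l => tadj N (a i) b l))%R.
  rewrite <- (re_RtoC (K * _)).
  apply (ccv_Re_ge (fun t => RtoC (K * Y (fun i l => tadj N (dilate (radius t) (a i)) b l))%R)
           _ _ O).
  - intros t _. rewrite re_RtoC. apply Hr, radius_range.
  - rewrite RtoC_mult.
    apply (ccv_ext (fun t => RtoC K *
      RtoC (Y (fun i l => tadj N (dilate (radius t) (a i)) b l))%R)).
    { intros t. now rewrite RtoC_mult. }
    apply ccv_mult; [apply ccv_const|].
    apply (ccv_sqr_sum n N (fun t i l => tadj N (dilate (radius t) (a i)) b l)).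
    intros i l _ _. unfold tadj.
    apply (ccv_csum N (fun t k => Cconj (dilate (radius t) (a i) k) * b (l + k)%nat)).
    intros k _. apply ccv_mult; [apply ccv_conj, ccv_dilate|apply ccv_const].
Qed.

(** * The Toeplitz corona theorem for truncated matrices *)

Definition mv (N : nat) (X : nat -> nat -> C) (v : nat -> C) (j : nat) : C :=
  csum N (fun k => X j k * v k).

Definition form (N : nat) (X : nat -> nat -> C) (x y : nat -> C) : C :=
  csum N (fun j => Cconj (x j) * mv N X y j).

Definition supported (N : nat) (v : nat -> C) : Prop :=
  forall k, (N <= k)%nat -> v k = 0.

Definition unit0 (j : nat) : C := match j with O => 1 | S _ => 0 end.

(** Elimination of the last index. The pivot is the value of the form at a basis vector, hence
    nonzero. The Schur complement inherits the hypothesis: its form at x is the form of X at x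
    extended by the y that annihilates the last row. *)
Lemma nondegenerate_solve (N : nat) (X : nat -> nat -> C) :
  (forall (x : nat -> C) j, (j < N)%nat -> x j <> 0 -> form N X x x <> 0) ->
  forall b, exists v, supported N v /\ forall j, (j < N)%nat -> mv N X v j = b j.
Proof.
  revert X. induction N as [|N IH]; intros X HX b.
  - exists (fun _ => 0). split; [now intros k|]. intros j Hj. lia.
  - set (p := X N N).
    assert (Hp : p <> 0).
    { intros Hp. apply (HX (fun k => if Nat.eqb k N then 1 else 0) N); [lia| |].
      - rewrite Nat.eqb_refl. exact C1_nz.
      - unfold form. apply csum_0. intros j Hj.
        case Nat.eqb_spec; intros HjN; [|rewrite Cconj_RtoC; ring].
        subst j. unfold mv.
        rewrite (csum_ext (S N) _ (fun k => if Nat.eqb k N then X N k else 0)).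
        + rewrite csum_delta by lia. fold p. rewrite Hp. ring.
        + intros k _. case Nat.eqb; ring. }
    set (X' j k := X j k - X j N * X N k / p).
    set (ext (x : nat -> C) y k := if Nat.eqb k N then y else x k).
    assert (Hext : forall x y j, mv (S N) X (ext x y) j = mv N X x j + X j N * y).
    { intros x y j. unfold mv, ext. simpl. rewrite Nat.eqb_refl. f_equal.
      apply csum_ext. intros k Hk. case Nat.eqb_spec; [lia|auto]. }
    assert (Hmv' : forall x j, mv N X' x j = mv N X x j - X j N / p * mv N X x N).
    { intros x j. unfold mv, X'. rewrite <- csum_scal_l, <- csum_minus.
      apply csum_ext. intros k _. field. exact Hp. }
    destruct (IH X') with (b := fun j => b j - X j N / p * b N) as (v & Hv & Hsol).
    { intros x j Hj Hxj.
      set (y := - / p * mv N X x N).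
      replace (form N X' x x) with (form (S N) X (ext x y) (ext x y)).
      - apply (HX _ j); [lia|]. unfold ext. case Nat.eqb_spec; [lia|auto].
      - unfold form. simpl. rewrite Hext. fold p.
        replace (mv N X x N + p * y) with (RtoC 0) by (unfold y; field; auto).
        rewrite Cmult_0_r, Cplus_0_r. apply csum_ext. intros k Hk.
        rewrite Hext, Hmv'. unfold ext. case Nat.eqb_spec; [lia|]. intros _.
        unfold y. field. exact Hp. }
    exists (ext v ((b N - mv N X v N) / p)). split.
    + intros k Hk. unfold ext. case Nat.eqb_spec; [lia|]. intros _. apply Hv. lia.
    + intros j Hj. rewrite Hext. destruct (Nat.eq_dec j N) as [->|Hne].
      * fold p. field. exact Hp.
      * specialize (Hsol j ltac:(lia)). rewrite Hmv' in Hsol.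
        replace (mv N X v j) with (b j - X j N / p * b N + X j N / p * mv N X v N)
          by (rewrite <- Hsol; ring).
        field. exact Hp.
Qed.

Definition gram (n : nat) (a : nat -> nat -> C) (j k : nat) : C :=
  csum n (fun i => a i j * Cconj (a i k)).

(** In operator terms gram + S Y S^*, where S is the forward shift and S^* acts as [sh]. *)
Definition shift_add (n : nat) (a : nat -> nat -> C) (Y : nat -> nat -> C) (j k : nat) : C :=
  gram n a j k + match j, k with S j, S k => Y j k | _, _ => 0 end.

(* The matrix of sum_i T_i T_i^*, T_i the lower triangular Toeplitz matrix
   with first column a i. *)
Fixpoint toep (n : nat) (a : nat -> nat -> C) (j k : nat) : C :=
  gram n a j k + match j, k with S j, S k => toep n a j k | _, _ => 0 end.

(** The operator sum T_i T_i^* - c^2, positive for small c by the lower bound; it measures the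
    energy stored in a state. *)
Definition pmat (n : nat) (a : nat -> nat -> C) (c : R) (j k : nat) : C :=
  toep n a j k - if Nat.eqb j k then RtoC (c ^ 2)%R else 0.

Definition qmat (n : nat) (a : nat -> nat -> C) (c : R) : nat -> nat -> C :=
  shift_add n a (pmat n a c).

Definition sh (x : nat -> C) (k : nat) : C := x (S k).

(** The entry of index 0 of [tadj N a x]. *)
Definition obs (N : nat) (a : nat -> C) (x : nat -> C) : C :=
  csum N (fun k => Cconj (a k) * x k).

Lemma supported_sh (N : nat) (x : nat -> C) : supported N x -> supported N (sh x).
Proof. intros H k Hk. apply H. lia. Qed.

Lemma toep_shift (n : nat) (a : nat -> nat -> C) (j k : nat) :
  toep n a j k = shift_add n a (toep n a) j k.
Proof. destruct j, k; reflexivity. Qed.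

(** The identity behind the lurking isometry. [toep] is a fixed point of [shift_add], whereas
    shifting c^2 times the identity loses the entry (0,0). Hence gram + S P S^* = P + c^2 e_0 e_0^*,
    and the form of Q splits in two ways. *)
Lemma qmat_pmat (n : nat) (a : nat -> nat -> C) (c : R) (j k : nat) :
  qmat n a c j k = pmat n a c j k + RtoC (c ^ 2)%R * (unit0 j * unit0 k).
Proof.
  unfold qmat, pmat. rewrite toep_shift. unfold shift_add.
  destruct j, k; simpl; ring.
Qed.

Lemma mv_ext (N : nat) (X Y : nat -> nat -> C) (x : nat -> C) (j : nat) :
  (forall k, X j k = Y j k) -> mv N X x j = mv N Y x j.
Proof. intros H. apply csum_ext. intros k _. now rewrite H. Qed.

Lemma form_ext (N : nat) (X Y : nat -> nat -> C) (x y : nat -> C) :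
  (forall j k, X j k = Y j k) -> form N X x y = form N Y x y.
Proof.
  intros H. apply csum_ext. intros j _. f_equal. apply mv_ext. intros k. apply H.
Qed.

Lemma mv_gram (n N : nat) (a : nat -> nat -> C) (x : nat -> C) (j : nat) :
  mv N (gram n a) x j = csum n (fun i => a i j * obs N (a i) x).
Proof.
  unfold mv, gram, obs.
  rewrite (csum_ext N _ (fun k => csum n (fun i => a i j * (Cconj (a i k) * x k)))).
  - rewrite csum_swap. apply csum_ext. intros i _. apply csum_scal_l.
  - intros k _. rewrite <- csum_scal_r. apply csum_ext. intros i _. ring.
Qed.

Lemma mv_shift_add (n N : nat) (a : nat -> nat -> C) (Y : nat -> nat -> C)
    (x : nat -> C) (j : nat) :
  supported N x ->
  mv N (shift_add n a Y) x j =
  csum n (fun i => a i j * obs N (a i) x) +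
  match j with O => 0 | S j => mv N Y (sh x) j end.
Proof.
  intros Hx. rewrite <- mv_gram. unfold mv at 1, shift_add.
  rewrite (csum_ext N _ (fun k => gram n a j k * x k +
    match j, k with S j, S k => Y j k | _, _ => 0 end * x k)) by (intros; ring).
  rewrite csum_plus. unfold mv at 1. f_equal.
  destruct j as [|j]; [apply csum_0; intros; ring|].
  destruct N as [|N]; [reflexivity|].
  rewrite csum_first. unfold mv, sh. simpl.
  rewrite (Hx (S N)) by lia. ring.
Qed.

Lemma form_shift_add (n N : nat) (a : nat -> nat -> C) (Y : nat -> nat -> C)
    (x y : nat -> C) :
  supported N x -> supported N y ->
  form N (shift_add n a Y) x y =
  csum n (fun i => Cconj (obs N (a i) x) * obs N (a i) y) + form N Y (sh x) (sh y).
Proof.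
  intros Hx Hy. unfold form.
  rewrite (csum_ext N _ (fun j =>
    csum n (fun i => Cconj (x j) * a i j * obs N (a i) y) +
    Cconj (x j) * match j with O => 0 | S j => mv N Y (sh y) j end)).
  2:{ intros j _. rewrite mv_shift_add by auto.
      rewrite Cmult_plus_distr_l, <- csum_scal_l. f_equal.
      apply csum_ext. intros i _. ring. }
  rewrite csum_plus. f_equal.
  - rewrite csum_swap. apply csum_ext. intros i _. rewrite csum_scal_r. f_equal.
    unfold obs. rewrite csum_conj. apply csum_ext. intros j _.
    rewrite Cmult_conj, Cconj_conj. ring.
  - destruct N as [|N]; [reflexivity|]. rewrite csum_first. simpl csum.
    replace (sh x N) with (RtoC 0) by (symmetry; apply Hx; lia).
    rewrite Cconj_RtoC, Cmult_0_r, Cmult_0_l, Cplus_0_l, Cplus_0_r. reflexivity.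
Qed.

(** Each use of [toep_shift] splits off one entry of every T_i^* x; after N shifts the vector is
    zero. *)
Lemma form_toep (n N : nat) (a : nat -> nat -> C) (x : nat -> C) :
  supported N x ->
  form N (toep n a) x x =
  RtoC (rsum n (fun i => rsum N (fun l => Cmod (tadj N (a i) x l) ^ 2)))%R.
Proof.
  intros Hx.
  assert (H : forall t, form N (toep n a) x x =
    csum t (fun l => csum n (fun i =>
      Cconj (tadj N (a i) x l) * tadj N (a i) x l)) +
    form N (toep n a) (fun k => x (t + k)%nat) (fun k => x (t + k)%nat)).
  { induction t as [|t IH].
    - simpl. rewrite Cplus_0_l. reflexivity.
    - rewrite IH. simpl csum. rewrite <- Cplus_assoc. f_equal.
      rewrite (form_ext N (toep n a) _ _ _ (toep_shift n a)).
      rewrite form_shift_add by (intros k Hk; apply Hx; lia).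
      f_equal. unfold sh. f_equal; apply functional_extensionality; intros k; f_equal; lia. }
  rewrite (H N).
  replace (form N (toep n a) (fun k => x (N + k)%nat) (fun k => x (N + k)%nat))
    with (RtoC 0).
  2:{ symmetry. apply csum_0. intros j _. rewrite (Hx (N + j)%nat) by lia.
      rewrite Cconj_RtoC. ring. }
  rewrite Cplus_0_r, csum_swap, RtoC_rsum. apply csum_ext. intros i _.
  rewrite RtoC_rsum. apply csum_ext. intros l _. rewrite Cmod2_conj. ring.
Qed.

Lemma mv_diag (N : nat) (d : C) (x : nat -> C) (j : nat) :
  (j < N)%nat -> mv N (fun j k => if Nat.eqb j k then d else 0) x j = d * x j.
Proof.
  intros Hj. unfold mv.
  rewrite (csum_ext N _ (fun k => if Nat.eqb k j then d * x k else 0)).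
  - now rewrite csum_delta.
  - intros k _. rewrite Nat.eqb_sym. case Nat.eqb; ring.
Qed.

Lemma form_pmat (n N : nat) (a : nat -> nat -> C) (c : R) (x : nat -> C) :
  supported N x ->
  form N (pmat n a c) x x =
  RtoC (rsum n (fun i => rsum N (fun l => Cmod (tadj N (a i) x l) ^ 2)) -
        c ^ 2 * rsum N (fun k => Cmod (x k) ^ 2))%R.
Proof.
  intros Hx. rewrite RtoC_minus, <- form_toep, RtoC_mult, RtoC_rsum by auto.
  unfold form. rewrite <- csum_scal_l, <- csum_minus.
  apply csum_ext. intros j Hj.
  rewrite Cmod2_conj, <- (mv_ext N (fun j k => toep n a j k -
    (if Nat.eqb j k then RtoC (c ^ 2)%R else 0)) (pmat n a c)) by reflexivity.
  replace (mv N (fun j k => toep n a j k - (if Nat.eqb j k then RtoC (c ^ 2)%R else 0)) x j)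
    with (mv N (toep n a) x j - RtoC (c ^ 2)%R * x j).
  - ring.
  - rewrite <- (mv_diag N) by auto. unfold mv. rewrite <- csum_minus.
    apply csum_ext. intros k _. ring.
Qed.

Lemma form_conj (N : nat) (X : nat -> nat -> C) (x y : nat -> C) :
  (forall j k, X k j = Cconj (X j k)) -> form N X y x = Cconj (form N X x y).
Proof.
  intros HX. unfold form, mv. rewrite csum_conj.
  rewrite (csum_ext N (fun j => Cconj (y j) * _)
    (fun j => csum N (fun k => Cconj (y j) * (X j k * x k))))
    by (intros; now rewrite csum_scal_l).
  rewrite csum_swap. apply csum_ext. intros k _.
  rewrite Cmult_conj, Cconj_conj, csum_conj, <- csum_scal_l.
  apply csum_ext. intros j _. rewrite (HX k j), Cmult_conj. ring.
Qed.

Lemma pmat_herm (n : nat) (a : nat -> nat -> C) (c : R) (j k : nat) :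
  pmat n a c k j = Cconj (pmat n a c j k).
Proof.
  assert (Hg : forall j k, gram n a k j = Cconj (gram n a j k)).
  { intros j' k'. unfold gram. rewrite csum_conj. apply csum_ext. intros i _.
    rewrite Cmult_conj, Cconj_conj. ring. }
  assert (Ht : forall j k, toep n a k j = Cconj (toep n a j k)).
  { intros j'. induction j' as [|j' IH]; intros [|k']; simpl;
      rewrite Cplus_conj, <- Hg, <- ?IH, ?Cconj_RtoC; reflexivity. }
  unfold pmat. rewrite Cminus_conj, Ht, Nat.eqb_sym. f_equal.
  case Nat.eqb; now rewrite Cconj_RtoC.
Qed.

Lemma mv_minus (N : nat) (X : nat -> nat -> C) (x y : nat -> C) (j : nat) :
  mv N X (fun k => x k - y k) j = mv N X x j - mv N X y j.
Proof.
  unfold mv. rewrite <- csum_minus. apply csum_ext. intros k _. ring.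
Qed.

Lemma mv_csum (N t : nat) (X : nat -> nat -> C) (u : nat -> C) (v : nat -> nat -> C) (j : nat) :
  mv N X (fun l => csum t (fun k => u k * v k l)) j =
  csum t (fun k => u k * mv N X (v k) j).
Proof.
  unfold mv.
  rewrite (csum_ext N _ (fun l => csum t (fun k => u k * (X j l * v k l)))).
  - rewrite csum_swap. apply csum_ext. intros k _. apply csum_scal_l.
  - intros l _. rewrite <- csum_scal_l. apply csum_ext. intros k _. ring.
Qed.

Lemma form_qmat (n N : nat) (a : nat -> nat -> C) (c : R) (x : nat -> C) :
  (0 < N)%nat ->
  form N (qmat n a c) x x = form N (pmat n a c) x x + RtoC (c ^ 2 * Cmod (x O) ^ 2)%R.
Proof.
  intros HN. unfold form.
  rewrite (csum_ext N _ (fun j => Cconj (x j) * mv N (pmat n a c) x j +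
    (if Nat.eqb j O then RtoC (c ^ 2)%R * (Cconj (x j) * x O) else 0))).
  - rewrite csum_plus. f_equal.
    rewrite (csum_delta N O (fun j => RtoC (c ^ 2)%R * (Cconj (x j) * x O))) by auto.
    rewrite (RtoC_mult (c ^ 2)), Cmod2_conj. ring.
  - intros j Hj.
    replace (mv N (qmat n a c) x j) with
      (mv N (pmat n a c) x j + RtoC (c ^ 2)%R * unit0 j * x O).
    + destruct j; simpl; ring.
    + unfold mv. rewrite <- (csum_delta N O x) by auto.
      rewrite <- csum_scal_l, <- csum_plus. apply csum_ext. intros k _.
      rewrite qmat_pmat. destruct k; simpl; ring.
Qed.

(* One step of the state-space realization of the solution dissipates the
   energy [form P]: input u, old state t, new state sh w, output the
   observations of w. *)
Lemma energy_step (n N : nat) (a : nat -> nat -> C) (c : R) (w t : nat -> C) (u : C) :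
  (0 < N)%nat -> supported N w -> supported N t ->
  (forall x, supported N x -> (0 <= Re (form N (pmat n a c) x x))%R) ->
  (forall j, (j < N)%nat ->
     mv N (qmat n a c) w j = u * (RtoC c * unit0 j) + mv N (pmat n a c) t j) ->
  (rsum n (fun i => Cmod (obs N (a i) w) ^ 2) + Re (form N (pmat n a c) (sh w) (sh w)) <=
   Cmod u ^ 2 + Re (form N (pmat n a c) t t))%R.
Proof.
  intros HN Hw Ht Hpos Hsol. set (P := pmat n a c) in *.
  (* Let Q be the form of [qmat] at w. In E2, the product of u and w 0 and the mixed term P(w,t) are
     both split by arithmetic-geometric means; by E3 this gives Q <= (|u|^2 + P(t,t) + Q) / 2, so Q
     <= |u|^2 + P(t,t). E1 identifies Q with the left side of the claim. *)
  assert (E1 : form N (qmat n a c) w w =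
    RtoC (rsum n (fun i => Cmod (obs N (a i) w) ^ 2))%R + form N P (sh w) (sh w)).
  { unfold qmat. rewrite form_shift_add by auto. f_equal.
    rewrite RtoC_rsum. apply csum_ext. intros i _. rewrite Cmod2_conj. ring. }
  assert (E2 : form N (qmat n a c) w w = Cconj (w O) * (u * RtoC c) + form N P w t).
  { unfold form. rewrite (csum_ext N _ (fun j =>
      (if Nat.eqb j O then Cconj (w j) * (u * RtoC c) else 0) + Cconj (w j) * mv N P t j)).
    - rewrite csum_plus. f_equal.
      now rewrite (csum_delta N O (fun j => Cconj (w j) * (u * RtoC c))).
    - intros j Hj. rewrite Hsol by auto. destruct j; simpl; ring. }
  pose proof (form_qmat n N a c w HN) as E3. fold P in E3.
  assert (Hwt : supported N (fun k => w k - t k)).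
  { intros k Hk. rewrite Hw, Ht by auto. ring. }
  pose proof (Hpos _ Hwt) as H0.
  replace (form N P (fun k => w k - t k) (fun k => w k - t k)) with
    (form N P w w - form N P w t - (form N P t w - form N P t t)) in H0.
  2:{ unfold form. rewrite <- !csum_minus. apply csum_ext. intros j _.
      rewrite mv_minus, Cminus_conj. ring. }
  rewrite (form_conj N P w t) in H0 by (intros; apply pmat_herm).
  rewrite !Re_minus, re_conj in H0.
  apply (f_equal Re) in E1, E2, E3.
  rewrite Re_plus, re_RtoC in E1. rewrite Re_plus in E2. rewrite Re_plus, re_RtoC in E3.
  assert (HX : (Re (Cconj (w O) * (u * RtoC c)) <=
                / 2 * (Cmod u ^ 2 + c ^ 2 * Cmod (w O) ^ 2))%R).
  { eapply Rle_trans; [apply Re_le_Cmod|].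
    rewrite !Cmod_mult, Cmod_conj, Cmod_R.
    pose proof (pow2_ge_0 (Cmod u - Rabs c * Cmod (w O))).
    rewrite <- (pow2_abs c). lra. }
  lra.
Qed.

(** h is the impulse response, divided by c, of the linear system with equation Q w = u c e_0 + P t,
    next state [sh w] and output the observations of w. Solving with Q replaces the unitary
    extension of the lurking isometry. *)
Lemma toeplitz_corona (n N : nat) (a : nat -> nat -> C) (K : R) :
  (0 < N)%nat -> (0 <= K)%R ->
  (forall b, supported N b ->
     (rsum N (fun k => Cmod (b k) ^ 2) <=
      K * rsum n (fun i => rsum N (fun l => Cmod (tadj N (a i) b l) ^ 2)))%R) ->
  exists h : nat -> nat -> C,
    (forall j, (j < N)%nat ->
       csum (S j) (fun k => csum n (fun i => a i (j - k)%nat * h i k)) = unit0 j) /\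
    (forall (u : nat -> C) t,
       (rsum t (fun s => rsum n (fun i =>
          Cmod (csum (S s) (fun k => h i k * u (s - k)%nat)%C) ^ 2)) <=
        2 * (K + 1) * rsum t (fun s => Cmod (u s) ^ 2))%R).
Proof.
  intros HN HK Hb.
  (* Only half of the available lower bound 1/(K+1) is used: the rest makes P, hence Q, coercive and
     Q solvable. The gain bound is 1/c^2 = 2 (K + 1). *)
  set (c := sqrt (/ (2 * (K + 1)))).
  assert (HK2 : (0 < / (2 * (K + 1)))%R) by (apply Rinv_0_lt_compat; lra).
  assert (Hc : (0 < c)%R) by now apply sqrt_lt_R0.
  assert (Hc2 : (c ^ 2 = / (2 * (K + 1)))%R) by (unfold c; apply pow2_sqrt; lra).
  assert (HcC : RtoC c <> 0) by (intros H; apply RtoC_inj in H; lra).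
  set (P := pmat n a c). set (Q := qmat n a c).
  assert (Hcoer : forall x, supported N x ->
    (c ^ 2 * rsum N (fun k => Cmod (x k) ^ 2) <= Re (form N P x x))%R).
  { intros x Hx. unfold P. rewrite form_pmat, re_RtoC by auto.
    specialize (Hb x Hx).
    set (X := rsum N (fun k => Cmod (x k) ^ 2)%R) in *.
    set (Y := rsum n (fun i => rsum N (fun l => Cmod (tadj N (a i) x l) ^ 2))%R) in *.
    assert (HY : (0 <= Y)%R).
    { apply rsum_ge_0; intros. apply rsum_ge_0; intros. apply pow2_ge_0. }
    rewrite Hc2.
    assert (X <= (K + 1) * Y)%R by lra.
    apply Rmult_le_reg_l with (K + 1)%R; [lra|].
    field_simplify; lra. }
  assert (Hpos : forall x, supported N x -> (0 <= Re (form N P x x))%R).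
  { intros x Hx. eapply Rle_trans; [|apply (Hcoer x Hx)].
    apply Rmult_le_pos; [apply pow2_ge_0|]. apply rsum_ge_0. intros; apply pow2_ge_0. }
  assert (Hsolve : forall b, exists v, supported N v /\
            forall j, (j < N)%nat -> mv N Q v j = b j).
  { apply nondegenerate_solve. intros x j Hj Hxj H.
    set (x' k := if Nat.ltb k N then x k else 0).
    assert (Hx' : supported N x').
    { intros k Hk. unfold x'. case Nat.ltb_spec; [lia|auto]. }
    assert (HQ : form N Q x' x' = 0).
    { rewrite <- H. unfold form, mv. apply csum_ext. intros i Hi. unfold x' at 1.
      destruct (Nat.ltb_spec i N); [|lia]. f_equal. apply csum_ext. intros k Hk.
      unfold x'. destruct (Nat.ltb_spec k N); [auto|lia]. }
    unfold Q in HQ. rewrite form_qmat in HQ by auto. fold P in HQ.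
    apply (f_equal Re) in HQ. rewrite Re_plus, !re_RtoC in HQ.
    specialize (Hcoer _ Hx').
    assert (0 <= c ^ 2 * Cmod (x' O) ^ 2)%R by (apply Rmult_le_pos; apply pow2_ge_0).
    assert (Hj2 : (Cmod (x' j) ^ 2 <= rsum N (fun k => Cmod (x' k) ^ 2))%R).
    { apply (rsum_ge_term N j (fun k => Cmod (x' k) ^ 2)%R); auto.
      intros; apply pow2_ge_0. }
    assert (0 < Cmod (x' j) ^ 2)%R.
    { apply pow_lt, Cmod_gt_0. unfold x'. destruct (Nat.ltb_spec j N); [auto|lia]. }
    rewrite Hc2 in *. nra. }
  set (sol b := proj1_sig (constructive_indefinite_description _ (Hsolve b))).
  assert (Hsol : forall b, supported N (sol b) /\
            forall j, (j < N)%nat -> mv N Q (sol b) j = b j).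
  { intros b. unfold sol. now destruct (constructive_indefinite_description _ (Hsolve b)). }
  (* The impulse response: the input c e_0 acts at time 0 and no input afterwards. *)
  set (v := fix v k := match k with
                       | O => sol (fun j => RtoC c * unit0 j)
                       | S k => sol (mv N P (sh (v k))) end).
  assert (Hv : forall k, supported N (v k)) by (intros [|k]; apply Hsol).
  assert (Hv0 : forall j, (j < N)%nat -> mv N Q (v O) j = RtoC c * unit0 j)
    by apply Hsol.
  assert (HvS : forall k j, (j < N)%nat -> mv N Q (v (S k)) j = mv N P (sh (v k)) j)
    by (intros k; apply Hsol).
  exists (fun i k => / RtoC c * obs N (a i) (v k)). split.
  - intros j Hj.
    assert (Hg : forall k l, csum n (fun i => a i l * obs N (a i) (v k)) =
      mv N Q (v k) l - match l with O => 0 | S l => mv N P (sh (v k)) l end).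
    { intros k l. unfold Q, qmat. rewrite mv_shift_add by auto. fold P. ring. }
    rewrite (csum_ext (S j) _ (fun k => / RtoC c *
      (mv N Q (v k) (j - k) -
       match (j - k)%nat with O => 0 | S l => mv N P (sh (v k)) l end))).
    2:{ intros k _. rewrite <- Hg, <- csum_scal_l. apply csum_ext. intros i _. ring. }
    rewrite csum_scal_l. simpl csum. rewrite Nat.sub_diag.
    (* Since Q v_(k+1) = P (sh v_k), the subtracted part of one summand is the leading part of the
       next; only the term of v_0, which is c e_0, remains. *)
    assert (Htel : forall t, (t <= j)%nat ->
      csum t (fun k => mv N Q (v k) (j - k) -
        match (j - k)%nat with O => 0 | S l => mv N P (sh (v k)) l end) =
      mv N Q (v O) j - mv N Q (v t) (j - t)).
    { induction t as [|t IH]; intros Ht; simpl csum.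
      - rewrite Nat.sub_0_r. ring.
      - rewrite IH by lia. replace (j - t)%nat with (S (j - S t)) at 3 by lia.
        rewrite <- HvS by lia. ring. }
    rewrite Htel by auto. rewrite Nat.sub_diag, Hv0 by auto. field. exact HcC.
  - intros u t.
    (* The response at time s to the input u, a superposition of delayed impulse responses. *)
    set (w s l := csum (S s) (fun k => u (s - k)%nat * v k l)).
    assert (Hw : forall s, supported N (w s)).
    { intros s l Hl. apply csum_0. intros k _. rewrite Hv by auto. ring. }
    assert (Hobs : forall s i, obs N (a i) (w s) =
      csum (S s) (fun k => obs N (a i) (v k) * u (s - k)%nat)).
    { intros s i. unfold obs, w.
      rewrite (csum_ext N _ (fun l => csum (S s) (fun k =>
        Cconj (a i l) * v k l * u (s - k)%nat))).
      - rewrite csum_swap. apply csum_ext. intros k _. now rewrite csum_scal_r.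
      - intros l _. rewrite <- csum_scal_l. apply csum_ext. intros k _. ring. }
    (* [energy_step] summed over time: the stored energy is 0 at the start and the last one is
       nonnegative. *)
    assert (Hmain : forall t, (rsum t (fun s => rsum n (fun i =>
        Cmod (obs N (a i) (w s)) ^ 2)) +
        match t with O => 0 | S s => Re (form N P (sh (w s)) (sh (w s))) end <=
        rsum t (fun s => Cmod (u s) ^ 2))%R).
    { intros t1. induction t1 as [|t0 IH]; [simpl; lra|]. cbn [rsum].
      set (st := match t0 with O => fun _ => RtoC 0 | S s => sh (w s) end).
      assert (Hst : supported N st).
      { destruct t0; [now intros k|apply supported_sh, Hw]. }
      pose proof (energy_step n N a c (w t0) st (u t0) HN (Hw t0) Hst Hpos) as Hstep.
      fold P in Hstep.
      replace (Re (form N P st st)) with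
        (match t0 with O => 0%R | S s => Re (form N P (sh (w s)) (sh (w s))) end) in Hstep.
      2:{ destruct t0; [|reflexivity]. symmetry. unfold form.
          rewrite csum_0; [apply re_RtoC|]. intros j _. unfold st. rewrite Cconj_RtoC. ring. }
      cut (forall j, (j < N)%nat ->
        mv N Q (w t0) j = u t0 * (RtoC c * unit0 j) + mv N P st j).
      { intros H. specialize (Hstep H).
        set (e := match t0 with O => 0%R | S s => Re (form N P (sh (w s)) (sh (w s))) end) in *.
        lra. }
      intros j Hj. unfold w.
      rewrite (mv_csum N (S t0) Q (fun k => u (t0 - k)%nat)), csum_first.
      rewrite Nat.sub_0_r, Hv0 by auto. f_equal.
      destruct t0 as [|t0].
      + simpl. symmetry. apply csum_0. intros k _. unfold st. ring.
      + unfold st, w, sh.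
        rewrite (mv_csum N (S t0) P (fun k => u (t0 - k)%nat) (fun k l => v k (S l))).
        apply csum_ext. intros k _. rewrite HvS by auto. reflexivity. }
    specialize (Hmain t).
    assert (Hlast : (0 <= match t with O => 0 | S s =>
              Re (form N P (sh (w s)) (sh (w s))) end)%R).
    { destruct t; [lra|]. apply Hpos, supported_sh, Hw. }
    pose proof (Rle_trans _ _ _ (Rplus_le_compat_l _ _ _ Hlast) Hmain) as Hfin.
    rewrite Rplus_0_r in Hfin.
    rewrite (rsum_ext t _ (fun s => 2 * (K + 1) *
      rsum n (fun i => Cmod (obs N (a i) (w s)) ^ 2))%R).
    + rewrite rsum_scal_l. apply Rmult_le_compat_l; [lra|exact Hfin].
    + intros s _. rewrite <- rsum_scal_l. apply rsum_ext. intros i _.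
      rewrite Hobs.
      rewrite (csum_ext (S s) _ (fun k => / RtoC c * (obs N (a i) (v k) * u (s - k)%nat)))
        by (intros; ring).
      rewrite csum_scal_l, Cmod_mult, Cmod_inv, Cmod_R, Rabs_pos_eq, Rpow_mult_distr
        by (auto; lra).
      rewrite pow_inv, Hc2, Rinv_inv. reflexivity.
Qed.

(** * Solutions with multiplier bounds *)

Definition conv (a b : nat -> C) (s : nat) : C :=
  csum (S s) (fun k => a k * b (s - k)%nat).

Lemma conv_unit0 (h : nat -> C) (s : nat) : conv h unit0 s = h s.
Proof.
  unfold conv. simpl csum. rewrite Nat.sub_diag, csum_0; [simpl; ring|].
  intros k Hk. replace (s - k)%nat with (S (s - k - 1)) by lia. simpl. ring.
Qed.

Lemma corona_coefficients (n : nat) (M m A : R) (a : nat -> nat -> C) (F : nat -> C -> C) :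
  (0 <= M)%R -> (0 < m)%R ->
  (forall i k, (i < n)%nat -> (Cmod (a i k) <= A)%R) ->
  (forall i z, (i < n)%nat -> (Cmod z < 1)%R -> pser (a i) z (F i z)) ->
  (forall i z, (i < n)%nat -> (Cmod z < 1)%R -> (Cmod (F i z) <= M)%R) ->
  (forall z, (Cmod z < 1)%R -> (m <= rsum n (fun i => Cmod (F i z) ^ 2))%R) ->
  exists (h : nat -> nat -> C) (K : R), (0 <= K)%R /\
    (forall j, csum (S j) (fun k => csum n (fun i => a i (j - k)%nat * h i k)) = unit0 j) /\
    (forall i (u : nat -> C) t, (i < n)%nat ->
       (rsum t (fun s => Cmod (conv (h i) u s) ^ 2) <=
        K * rsum t (fun s => Cmod (u s) ^ 2))%R).
Proof.
  intros HM Hm HA HF HFM HFm.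
  destruct (toeplitz_lower n M m HM Hm) as (K0 & HK0 & Hlow).
  assert (HN : forall N, exists h : nat -> nat -> C,
    (forall j, (j < S N)%nat ->
       csum (S j) (fun k => csum n (fun i => a i (j - k)%nat * h i k)) = unit0 j) /\
    (forall (u : nat -> C) t,
       (rsum t (fun s => rsum n (fun i => Cmod (conv (h i) u s) ^ 2)) <=
        2 * (K0 + 1) * rsum t (fun s => Cmod (u s) ^ 2))%R)).
  { intros N. apply (toeplitz_corona n (S N) a K0); auto; [lia|].
    intros b Hb. now apply (Hlow (S N) A a F b). }
  set (K := (2 * (K0 + 1))%R) in *. assert (HK : (0 <= K)%R) by (unfold K; lra).
  set (hN N := proj1_sig (constructive_indefinite_description _ (HN N))).
  assert (HhN : forall N,
    (forall j, (j < S N)%nat ->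
       csum (S j) (fun k => csum n (fun i => a i (j - k)%nat * hN N i k)) = unit0 j) /\
    (forall (u : nat -> C) t,
       (rsum t (fun s => rsum n (fun i => Cmod (conv (hN N i) u s) ^ 2)) <=
        K * rsum t (fun s => Cmod (u s) ^ 2))%R)).
  { intros N. unfold hN. now destruct (constructive_indefinite_description _ (HN N)). }
  (* The multiplier bound tested on the unit impulse bounds every coefficient, uniformly in N. *)
  assert (Hbd : forall N i k, (i < n)%nat -> (Cmod (hN N i k) <= K + 1)%R).
  { intros N i k Hi. destruct (HhN N) as (_ & H). specialize (H unit0 (S k)).
    assert (H1 : (rsum (S k) (fun s => Cmod (unit0 s) ^ 2) = 1)%R).
    { clear. induction k as [|k IH]; [simpl; rewrite Cmod_1; ring|].
      change (rsum (S (S k)) (fun s => Cmod (unit0 s) ^ 2))%R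
        with (rsum (S k) (fun s => Cmod (unit0 s) ^ 2) + Cmod 0 ^ 2)%R.
      rewrite IH, Cmod_0. ring. }
    rewrite H1 in H.
    assert (H2 : (Cmod (hN N i k) ^ 2 <= K)%R).
    { rewrite Rmult_1_r in H. eapply Rle_trans; [|exact H].
      eapply Rle_trans;
        [|apply (rsum_ge_term (S k) k
            (fun s => rsum n (fun i => Cmod (conv (hN N i) unit0 s) ^ 2))%R); [|lia]].
      - rewrite <- (conv_unit0 (hN N i) k).
        apply (rsum_ge_term n i (fun i => Cmod (conv (hN N i) unit0 k) ^ 2)%R); auto.
        intros; apply pow2_ge_0.
      - intros; apply rsum_ge_0; intros; apply pow2_ge_0. }
    pose proof (Cmod_ge_0 (hN N i k)). nra. }
  (* The Cantor pairing lists the coefficients of all i in one sequence; the default 0 for i >= n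
     keeps it bounded. *)
  destruct (diagonal_subsequence
    (fun N j => let (i, k) := of_nat j in if Nat.ltb i n then hN N i k else 0)
    (fun _ => (K + 1)%R)) as (s & l & Hs & Hl).
  { intros N j. destruct (of_nat j) as (i, k). case Nat.ltb_spec; intros Hi; auto.
    rewrite Cmod_0. lra. }
  set (h i k := l (to_nat (i, k))).
  assert (Hh : forall i k, (i < n)%nat -> ccv (fun N => hN (s N) i k) (h i k)).
  { intros i k Hi. specialize (Hl (to_nat (i, k))). rewrite cancel_of_to in Hl.
    destruct (Nat.ltb_spec i n); [exact Hl|lia]. }
  exists h, K. split; auto. split.
  - intros j.
    apply (ccv_unique (fun N => csum (S j) (fun k => csum n (fun i =>
      a i (j - k)%nat * hN (s N) i k)))).
    + apply (ccv_csum (S j) (fun N k => csum n (fun i => a i (j - k)%nat * hN (s N) i k))).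
      intros k _. apply (ccv_csum n (fun N i => a i (j - k)%nat * hN (s N) i k)).
      intros i Hi. apply (ccv_mult (fun _ => a i (j - k)%nat)); auto. apply ccv_const.
    + intros eps Heps. exists j. intros N HN'.
      rewrite (proj1 (HhN (s N))) by (specialize (Hs N); lia).
      replace (unit0 j - unit0 j) with (RtoC 0) by ring. now rewrite Cmod_0.
  - intros i u t Hi.
    rewrite <- (re_RtoC (rsum t _)).
    apply (ccv_Re_le (fun N => RtoC (rsum 1 (fun _ =>
             rsum t (fun s' => Cmod (conv (hN (s N) i) u s') ^ 2)))%R) _ _ O).
    + intros N _. rewrite re_RtoC. cbn [rsum]. rewrite Rplus_0_l.
      eapply Rle_trans; [|apply (proj2 (HhN (s N)))]. apply rsum_le. intros s' _.
      apply (rsum_ge_term n i (fun i => Cmod (conv (hN (s N) i) u s') ^ 2)%R); auto.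
      intros; apply pow2_ge_0.
    + replace (rsum t (fun s' => Cmod (conv (h i) u s') ^ 2))%R with
        (rsum 1 (fun _ => rsum t (fun s' => Cmod (conv (h i) u s') ^ 2)))%R
        by apply Rplus_0_l.
      apply (ccv_sqr_sum 1 t (fun N _ s' => conv (hN (s N) i) u s')).
      intros _ s' _ _. unfold conv.
      apply (ccv_csum (S s') (fun N k => hN (s N) i k * u (s' - k)%nat)).
      intros k _. apply ccv_mult; auto. apply ccv_const.
Qed.

(** * Cauchy products, and boundedness of multipliers *)

Lemma csum_triangle (d : nat) (f : nat -> nat -> C) :
  csum d (fun s => csum (S s) (fun k => f k (s - k)%nat)) =
  csum d (fun k => csum (d - k) (fun l => f k l)).
Proof.
  induction d as [|d IH]; [reflexivity|].
  change (csum d (fun s => csum (S s) (fun k => f k (s - k)%nat)) +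
          csum (S d) (fun k => f k (d - k)%nat) =
          csum d (fun k => csum (S d - k) (fun l => f k l)) +
          csum (S d - d) (fun l => f d l)).
  rewrite IH. replace (S d - d)%nat with 1%nat by lia. simpl. rewrite Nat.sub_diag.
  rewrite (csum_ext d (fun k => csum (S d - k) _)
    (fun k => csum (d - k) (fun l => f k l) + f k (d - k)%nat)).
  - rewrite csum_plus. ring.
  - intros k Hk. replace (S d - k)%nat with (S (d - k)) by lia. reflexivity.
Qed.

(** Write x = y^2: d y^d is at most the geometric sum, hence at most 1/(1 - y), and the remaining
    factor y^d tends to 0. *)
Lemma INR_pow_small (x eps : R) :
  (0 <= x < 1)%R -> (0 < eps)%R ->
  exists N, forall d, (N <= d)%nat -> (INR d * x ^ d < eps)%R.
Proof.
  intros Hx Heps. set (y := sqrt x).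
  assert (Hy : (0 <= y < 1)%R).
  { split; [apply sqrt_pos|]. rewrite <- sqrt_1. apply sqrt_lt_1; lra. }
  assert (Hyy : (y * y = x)%R) by (apply sqrt_sqrt; lra).
  destruct (pow_lt_1_zero y ltac:(rewrite Rabs_pos_eq; lra) (eps * (1 - y))%R) as (N & HN).
  { apply Rmult_lt_0_compat; lra. }
  exists N. intros d Hd. specialize (HN d Hd).
  assert (Hyd : (0 <= y ^ d)%R) by (apply pow_le; lra).
  rewrite Rabs_pos_eq in HN by auto.
  assert (H : (INR d * y ^ d <= / (1 - y))%R).
  { eapply Rle_trans; [|apply (rsum_geom_le y d Hy)].
    rewrite <- rsum_const. apply rsum_le. intros k Hk.
    replace d with (k + (d - k))%nat by lia. rewrite pow_add.
    assert (0 <= y ^ k)%R by (apply pow_le; lra).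
    assert (y ^ (d - k) <= 1)%R by (rewrite <- (pow1 (d - k)); apply pow_incr; lra).
    nra. }
  rewrite <- Hyy, Rpow_mult_distr.
  apply Rle_lt_trans with (/ (1 - y) * y ^ d)%R.
  - rewrite <- Rmult_assoc. apply Rmult_le_compat_r; auto.
  - apply Rmult_lt_reg_l with (1 - y)%R; [lra|].
    rewrite <- Rmult_assoc, Rinv_r by lra. lra.
Qed.

(** The partial sum of the Cauchy product misses a tail of order x^(d-k) in the row of x^k. Each of
    the d rows thus contributes an error of order x^d, and d x^d tends to 0. *)
Lemma pser_conv (a b : nat -> C) (A B : R) (z l m : C) :
  (forall k, (Cmod (a k) <= A)%R) -> (forall k, (Cmod (b k) <= B)%R) ->
  (Cmod z < 1)%R -> pser a z l -> pser b z m -> pser (conv a b) z (l * m).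
Proof.
  intros HA HB Hz Ha Hb. set (x := Cmod z).
  assert (Hx : (0 <= x < 1)%R) by (split; [apply Cmod_ge_0|auto]).
  assert (HA0 : (0 <= A)%R) by (eapply Rle_trans; [apply Cmod_ge_0|apply (HA O)]).
  assert (HB0 : (0 <= B)%R) by (eapply Rle_trans; [apply Cmod_ge_0|apply (HB O)]).
  assert (Hi : (0 < / (1 - x))%R) by (apply Rinv_0_lt_compat; lra).
  assert (Hdiff : forall d, (Cmod (peval d a z * peval d b z - peval d (conv a b) z) <=
            INR d * x ^ d * (A * B * / (1 - x)))%R).
  { intros d.
    assert (E : peval d (conv a b) z = csum d (fun k => (a k * z ^ k) * peval (d - k) b z)).
    { unfold peval.
      rewrite (csum_ext d _ (fun s => csum (S s) (fun k =>
        (a k * z ^ k) * (b (s - k)%nat * z ^ (s - k))))).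
      - rewrite (csum_triangle d (fun k l => (a k * z ^ k) * (b l * z ^ l))).
        apply csum_ext. intros k _. apply csum_scal_l.
      - intros s _. unfold conv. rewrite <- csum_scal_r. apply csum_ext. intros k Hk.
        replace (z ^ s) with (z ^ k * z ^ (s - k)) by (rewrite <- Cpow_add_r; f_equal; lia).
        ring. }
    rewrite E. unfold peval at 1. rewrite <- csum_scal_r, <- csum_minus.
    eapply Rle_trans; [apply Cmod_csum_le|].
    rewrite Rmult_assoc, <- rsum_const. apply rsum_le. intros k Hk.
    replace (a k * z ^ k * peval d b z - a k * z ^ k * peval (d - k) b z)
      with (a k * z ^ k * (peval d b z - peval (d - k) b z)) by ring.
    rewrite !Cmod_mult, Cmod_pow. fold x.
    pose proof (peval_tail b B x z (d - k) d HB Hx (Rle_refl _) ltac:(lia)) as Ht.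
    replace d with (k + (d - k))%nat at 3 by lia. rewrite pow_add.
    replace (x ^ k * x ^ (d - k) * (A * B * / (1 - x)))%R
      with ((A * x ^ k) * (B * x ^ (d - k) * / (1 - x)))%R by ring.
    assert (0 <= x ^ k)%R by (apply pow_le; lra).
    apply Rmult_le_compat; auto using Cmod_ge_0.
    - apply Rmult_le_pos; auto using Cmod_ge_0.
    - apply Rmult_le_compat_r; auto. }
  assert (H0 : ccv (fun d => peval d a z * peval d b z - peval d (conv a b) z) 0).
  { intros eps Heps.
    set (c := (A * B * / (1 - x))%R) in *.
    assert (Hc : (0 <= c)%R) by (repeat apply Rmult_le_pos; lra).
    destruct (INR_pow_small x (eps / (c + 1)) Hx) as (N & HN).
    { apply Rdiv_lt_0_compat; lra. }
    exists N. intros d Hd. specialize (HN d Hd). specialize (Hdiff d).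
    replace (peval d a z * peval d b z - peval d (conv a b) z - 0)
      with (peval d a z * peval d b z - peval d (conv a b) z) by ring.
    apply (Rmult_lt_compat_r (c + 1)) in HN; [|lra].
    replace (eps / (c + 1) * (c + 1))%R with eps in HN by (field; lra).
    assert (0 <= INR d * x ^ d)%R by (apply Rmult_le_pos; [apply pos_INR|apply pow_le; lra]).
    nra. }
  pose proof (ccv_plus _ _ _ _ (ccv_mult _ _ _ _ Ha Hb)
    (ccv_mult _ _ _ _ (ccv_const (- (1))) H0)) as H.
  unfold pser. replace (l * m) with (l * m + - (1) * 0) by ring.
  eapply ccv_ext; [|exact H]. intros d. simpl. ring.
Qed.

(** The limit is a cluster point of the bounded partial sums; the tail estimate brings the whole
    sequence to it. *)
Lemma pser_ex (a : nat -> C) (A : R) (z : C) :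
  (forall k, (Cmod (a k) <= A)%R) -> (Cmod z < 1)%R -> exists l, pser a z l.
Proof.
  intros HA Hz. set (x := Cmod z).
  assert (Hx : (0 <= x < 1)%R) by (split; [apply Cmod_ge_0|auto]).
  assert (HA0 : (0 <= A)%R) by (eapply Rle_trans; [apply Cmod_ge_0|apply (HA O)]).
  destruct (bolzano_C (fun d => peval d a z) (A * x ^ 0 * / (1 - x))) as (s & l & Hs & Hl).
  { intros d. pose proof (peval_tail a A x z 0 d HA Hx (Rle_refl _) ltac:(lia)) as H.
    replace (peval d a z - peval 0 a z) with (peval d a z) in H
      by (unfold peval; simpl; ring). exact H. }
  exists l. intros eps Heps.
  destruct (Hl (eps / 2)%R) as (N1 & H1); [lra|].
  destruct (pow_lt_1_zero x ltac:(rewrite Rabs_pos_eq; lra) (eps / 2 * (1 - x) / (A + 1))%R)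
    as (N2 & H2).
  { apply Rdiv_lt_0_compat; [|lra]. apply Rmult_lt_0_compat; lra. }
  exists N2. intros d Hd. specialize (H2 d Hd).
  rewrite Rabs_pos_eq in H2 by (apply pow_le; lra).
  set (e := Nat.max N1 d).
  specialize (H1 e ltac:(unfold e; lia)).
  assert (Hde : (d <= s e)%nat).
  { pose proof (increasing_ge s e Hs). unfold e in *. lia. }
  pose proof (peval_tail a A x z d (s e) HA Hx (Rle_refl _) Hde) as H3.
  assert (H4 : (A * x ^ d * / (1 - x) <= eps / 2)%R).
  { apply (Rmult_lt_compat_r (A + 1)) in H2; [|lra].
    replace (eps / 2 * (1 - x) / (A + 1) * (A + 1))%R with (eps / 2 * (1 - x))%R in H2
      by (field; lra).
    apply Rmult_le_reg_r with (1 - x)%R; [lra|].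
    rewrite Rmult_assoc, Rinv_l by lra.
    assert (0 <= x ^ d)%R by (apply pow_le; lra). lra. }
  replace (peval d a z - l) with ((peval (s e) a z - l) - (peval (s e) a z - peval d a z))
    by ring.
  pose proof (Cmod_triangle_minus (peval (s e) a z - l) (peval (s e) a z - peval d a z)).
  lra.
Qed.

(* Test the multiplier inequality on the Szego kernel of z. *)
Lemma multiplier_bounded (h : nat -> C) (K A : R) (z l : C) :
  (0 <= K)%R -> (forall k, (Cmod (h k) <= A)%R) ->
  (forall (u : nat -> C) t,
     (rsum t (fun s => Cmod (conv h u s) ^ 2) <= K * rsum t (fun s => Cmod (u s) ^ 2))%R) ->
  (Cmod z < 1)%R -> pser h z l -> (Cmod l <= K + 1)%R.
Proof.
  intros HK HA Hmul Hz Hl. set (x := Cmod z).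
  assert (Hx : (0 <= x < 1)%R) by (split; [apply Cmod_ge_0|auto]).
  set (u k := Cconj z ^ k).
  assert (Hu : forall k, Cmod (u k) = (x ^ k)%R).
  { intros k. unfold u. now rewrite Cmod_pow, Cmod_conj. }
  assert (Hu1 : forall k, (Cmod (u k) <= 1)%R).
  { intros k. rewrite Hu, <- (pow1 k). apply pow_incr. lra. }
  set (S t := rsum t (fun s => Cmod (u s) ^ 2)%R).
  assert (HuS : forall t, peval t u z = RtoC (S t)).
  { intros t. unfold peval, S. rewrite RtoC_rsum. apply csum_ext. intros k _.
    rewrite Cmod2_conj. unfold u. rewrite Cpow_conj, Cconj_conj. reflexivity. }
  destruct (pser_ex u 1 z Hu1 Hz) as (sg & Hsg).
  assert (HS1 : forall t, (1 <= t)%nat -> (1 <= S t)%R).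
  { intros t Ht. unfold S.
    pose proof (rsum_ge_term t 0 (fun s => Cmod (u s) ^ 2)%R) as H.
    assert (Cmod (u 0%nat) ^ 2 <= rsum t (fun s => Cmod (u s) ^ 2))%R.
    { apply H; [intros; apply pow2_ge_0|lia]. }
    rewrite Hu, pow_O, pow1 in H0. exact H0. }
  assert (Hprod : forall t, (Cmod (peval t (conv h u) z) <= (K + 1) * S t)%R).
  { intros t. unfold peval. eapply Rle_trans; [apply Cmod_csum_le|].
    apply Rle_trans with (rsum t (fun s =>
      / 2 * (/ (K + 1) * Cmod (conv h u s) ^ 2 + / / (K + 1) * Cmod (u s) ^ 2))%R).
    - apply rsum_le. intros s _. rewrite Cmod_mult, Cmod_pow. fold x. rewrite <- Hu.
      apply amgm; try lra. apply Rinv_0_lt_compat. lra.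
    - rewrite rsum_scal_l, rsum_plus, !rsum_scal_l, Rinv_inv. fold (S t).
      specialize (Hmul u t). fold (S t) in Hmul.
      assert (HS : (0 <= S t)%R) by (apply rsum_ge_0; intros; apply pow2_ge_0).
      assert (Hk1 : (0 < / (K + 1) <= 1)%R).
      { split; [apply Rinv_0_lt_compat; lra|].
        rewrite <- Rinv_1. apply Rinv_le_contravar; lra. }
      set (Y := rsum t (fun s => Cmod (conv h u s) ^ 2)%R) in *.
      assert (HY : (0 <= Y)%R) by (apply rsum_ge_0; intros; apply pow2_ge_0).
      assert (/ (K + 1) * Y <= 1 * Y)%R by (apply Rmult_le_compat_r; lra).
      lra. }
  assert (Hlim : ccv (fun t => peval t (conv h u) z) (l * sg)).
  { now apply (pser_conv h u A 1). }
  (* The kernel at z is real and at least 1, so it can be cancelled at the end. *)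
  assert (Hsgr : sg = RtoC (Re sg)).
  { apply (ccv_unique (fun t => peval t u z)); auto.
    intros eps Heps. destruct (Hsg eps Heps) as (N & HN). exists N. intros t Ht.
    eapply Rle_lt_trans; [|exact (HN t Ht)]. rewrite HuS, <- RtoC_minus, Cmod_R.
    replace (S t - Re sg)%R with (Re (RtoC (S t) - sg)) by reflexivity.
    apply re_le_Cmod. }
  assert (Hsg1 : (1 <= Re sg)%R).
  { apply (ccv_Re_ge (fun t => peval t u z) _ _ 1); auto.
    intros t Ht. rewrite HuS, re_RtoC. auto. }
  assert (Hfin : (Cmod (l * sg) <= (K + 1) * Re sg)%R).
  { apply (ccv_Cmod_le (fun t => peval t (conv h u) z) _ _ 1); auto.
    intros t Ht. eapply Rle_trans; [apply Hprod|].
    apply Rmult_le_compat_l; [lra|].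
    apply (ccv_Re_ge (fun t => peval t u z) _ _ t); auto.
    intros t' Ht'. rewrite HuS, re_RtoC. apply rsum_mono_len; auto.
    intros; apply pow2_ge_0. }
  rewrite Cmod_mult, Hsgr, Cmod_R, Rabs_pos_eq, re_RtoC in Hfin by (rewrite ?re_RtoC; lra).
  apply Rmult_le_reg_r with (Re sg); lra.
Qed.

(** * Bounded analytic functions as multipliers of H^2 *)

Definition trunc (d : nat) (a : nat -> C) (k : nat) : C :=
  if Nat.ltb k d then a k else 0.

Lemma peval_mult (d t : nat) (a u : nat -> C) (z : C) :
  peval d a z * peval t u z = peval (d + t) (conv (trunc d a) (trunc t u)) z.
Proof.
  unfold peval at 3.
  rewrite (csum_ext (d + t) _ (fun s => csum (S s) (fun k =>
    (trunc d a k * z ^ k) * (trunc t u (s - k)%nat * z ^ (s - k))))).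
  2:{ intros s _. unfold conv. rewrite <- csum_scal_r. apply csum_ext. intros k Hk.
      replace (z ^ s) with (z ^ k * z ^ (s - k)) by (rewrite <- Cpow_add_r; f_equal; lia).
      ring. }
  rewrite (csum_triangle (d + t) (fun k l => (trunc d a k * z ^ k) * (trunc t u l * z ^ l))).
  rewrite (csum_trunc d (d + t)); [|lia|].
  2:{ intros k Hk. apply csum_0. intros l _. unfold trunc at 1.
      case Nat.ltb_spec; [lia|]. intros _. ring. }
  unfold peval. rewrite <- csum_prod. apply csum_ext. intros k Hk.
  rewrite (csum_trunc t (d + t - k)); [|lia|].
  - apply csum_ext. intros l Hl. unfold trunc.
    destruct (Nat.ltb_spec k d); [|lia]. destruct (Nat.ltb_spec l t); [reflexivity|lia].
  - intros l Hl. unfold trunc at 2. case Nat.ltb_spec; [lia|]. intros _. ring.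
Qed.

(** Parseval turns both sides into sums over the N-th roots of unity, where the bound M applies
    pointwise. N = d + t exceeds the degree of the product, and t <= d leaves its first t
    coefficients equal to those of [conv a u]. *)
Lemma poly_multiplier (d t : nat) (M : R) (a u : nat -> C) :
  (t <= d)%nat -> (forall z, (Cmod z <= 1)%R -> (Cmod (peval d a z) <= M)%R) ->
  (rsum t (fun s => Cmod (conv a u s) ^ 2) <= M ^ 2 * rsum t (fun s => Cmod (u s) ^ 2))%R.
Proof.
  intros Htd HM. destruct t as [|t']; [simpl; lra|]. set (t := S t') in *.
  set (N := (d + t)%nat).
  destruct (root_of_unity N ltac:(unfold N, t; lia)) as (w & Hw & HwN & Hprim).
  assert (H1 : Cmod 1 = 1%R) by apply Cmod_1.
  pose proof (parseval N w 1 (conv (trunc d a) (trunc t u)) Hw H1 HwN Hprim) as P1.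
  pose proof (parseval N w 1 (trunc t u) Hw H1 HwN Hprim) as P2.
  assert (Hu : rsum N (fun s => Cmod (trunc t u s) ^ 2)%R = rsum t (fun s => Cmod (u s) ^ 2)%R).
  { apply RtoC_inj. rewrite !RtoC_rsum, (csum_trunc t N); [|unfold N; lia|].
    - apply csum_ext. intros s Hs. unfold trunc. destruct (Nat.ltb_spec s t); [auto|lia].
    - intros s Hs. unfold trunc. destruct (Nat.ltb_spec s t); [lia|].
      rewrite Cmod_0. f_equal. ring. }
  assert (Hut : forall z, peval N (trunc t u) z = peval t u z).
  { intros z. unfold peval. rewrite (csum_trunc t N); [|unfold N; lia|].
    - apply csum_ext. intros s Hs. unfold trunc. destruct (Nat.ltb_spec s t); [auto|lia].
    - intros s Hs. unfold trunc. destruct (Nat.ltb_spec s t); [lia|ring]. }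
  assert (HN : (0 < INR N)%R) by (apply lt_0_INR; unfold N, t; lia).
  assert (Hle : (INR N * rsum N (fun s => Cmod (conv (trunc d a) (trunc t u) s) ^ 2) <=
                 M ^ 2 * (INR N * rsum t (fun s => Cmod (u s) ^ 2)))%R).
  { rewrite <- P1, <- Hu, <- P2, <- rsum_scal_l. apply rsum_le. intros k _.
    unfold N at 1. rewrite <- peval_mult, Hut, Cmod_mult, Rpow_mult_distr.
    apply Rmult_le_compat_r; [apply pow2_ge_0|]. apply pow_incr. split; [apply Cmod_ge_0|].
    apply HM. rewrite Cmod_mult, Cmod_pow, Hw, pow1, Cmod_1. lra. }
  apply Rle_trans with (rsum N (fun s => Cmod (conv (trunc d a) (trunc t u) s) ^ 2)%R).
  - rewrite (rsum_ext t _ (fun s => Cmod (conv (trunc d a) (trunc t u) s) ^ 2)%R).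
    + apply rsum_mono_len; [intros; apply pow2_ge_0|unfold N; lia].
    + intros s Hs. do 2 f_equal. apply csum_ext. intros k Hk. unfold trunc.
      destruct (Nat.ltb_spec k d); [|lia].
      destruct (Nat.ltb_spec (s - k) t); [reflexivity|lia].
  - apply Rmult_le_reg_l with (INR N); auto. lra.
Qed.

(** M + 1 allows for polynomials within distance 1 of the dilated F. The constant does not depend on
    the radius, which tends to 1 for fixed t. *)
Lemma bounded_multiplier (M A : R) (a : nat -> C) (F : C -> C) :
  (forall k, (Cmod (a k) <= A)%R) ->
  (forall z, (Cmod z < 1)%R -> pser a z (F z)) ->
  (forall z, (Cmod z < 1)%R -> (Cmod (F z) <= M)%R) ->
  forall (u : nat -> C) t,
    (rsum t (fun s => Cmod (conv a u s) ^ 2) <=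
     (M + 1) ^ 2 * rsum t (fun s => Cmod (u s) ^ 2))%R.
Proof.
  intros HA HF HM u t.
  rewrite <- (re_RtoC (rsum t (fun s => Cmod (conv a u s) ^ 2)%R)).
  apply (ccv_Re_le (fun j => RtoC (rsum 1 (fun _ =>
           rsum t (fun s => Cmod (conv (dilate (radius j) a) u s) ^ 2)))%R) _ _ O).
  - intros j _. rewrite re_RtoC. cbn [rsum]. rewrite Rplus_0_l.
    destruct (dilate_approx A (radius j) 1 t (radius_range j)) as (d & Htd & Hd); [lra|].
    apply (poly_multiplier d); auto. intros z Hz.
    destruct (Hd a F z HA HF Hz) as (Hz1 & Hap). specialize (HM _ Hz1).
    set (P := peval d (dilate (radius j) a) z) in *. set (v := F (radius j * z)) in *.
    replace P with (v - (v - P)) by ring.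
    pose proof (Cmod_triangle_minus v (v - P)). lra.
  - replace (rsum t (fun s => Cmod (conv a u s) ^ 2))%R with
      (rsum 1 (fun _ => rsum t (fun s => Cmod (conv a u s) ^ 2)))%R by apply Rplus_0_l.
    apply (ccv_sqr_sum 1 t (fun j _ s => conv (dilate (radius j) a) u s)).
    intros _ s _ _. unfold conv.
    apply (ccv_csum (S s) (fun j k => dilate (radius j) a k * u (s - k)%nat)).
    intros k _. apply ccv_mult; [apply ccv_dilate|apply ccv_const].
Qed.

(** * The algebra K and its characters *)

Definition l2 (a : nat -> C) (S : R) : Prop :=
  forall N, (rsum N (fun k => Cmod (a k) ^ 2) <= S)%R.

Lemma sum_n_csum (u : nat -> C) (n : nat) :
  @sum_n C_AbelianMonoid u n = csum (S n) u.
Proof.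
  induction n as [|n IH].
  - rewrite sum_O. simpl. ring.
  - rewrite sum_Sn, IH. reflexivity.
Qed.

Lemma sum_n_rsum (u : nat -> R) (n : nat) : sum_n u n = rsum (S n) u.
Proof.
  induction n as [|n IH].
  - rewrite sum_O. simpl. ring.
  - rewrite sum_Sn, IH. reflexivity.
Qed.

Lemma pow_n_Cpow (z : C) (n : nat) : @pow_n C_Ring z n = z ^ n.
Proof. induction n as [|n IH]; [reflexivity|]. simpl. now rewrite IH. Qed.

Lemma is_pseries_pser (a : nat -> C) (z l : C) :
  @is_pseries C_AbsRing C_NormedModule a z l <-> pser a z l.
Proof.
  (* [sum_n] includes its last index and [peval] excludes it. Below, the balls of C are squares, so
     the passage to [Cmod] costs a factor sqrt 2 < 2. *)
  assert (E : forall n, @sum_n C_AbelianMonoid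
      (fun k => @scal C_AbsRing C_NormedModule (@pow_n C_Ring z k) (a k)) n =
      peval (S n) a z).
  { intros n. rewrite sum_n_csum. apply csum_ext. intros k _.
    rewrite pow_n_Cpow. apply Cmult_comm. }
  split.
  - intros H eps Heps.
    assert (He : (0 < eps / 2)%R) by lra.
    destruct (proj1 (filterlim_locally _ _) H (mkposreal _ He)) as (N & HN).
    exists (S N). intros d Hd. destruct d as [|d]; [lia|].
    specialize (HN d ltac:(lia)). apply C_NormedModule_mixin_compat2 in HN.
    change (Cmod (@sum_n C_AbelianMonoid (fun k =>
      @scal C_AbsRing C_NormedModule (@pow_n C_Ring z k) (a k)) d - l) <
      sqrt 2 * (eps / 2))%R in HN.
    rewrite E in HN. eapply Rlt_trans; [exact HN|].
    assert (sqrt 2 < 2)%R.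
    { rewrite <- (sqrt_square 2) at 2 by lra. apply sqrt_lt_1; lra. }
    nra.
  - intros H. apply (proj2 (filterlim_locally _ _)). intros eps.
    destruct (H eps (cond_pos eps)) as (N & HN). exists N. intros d Hd.
    apply C_NormedModule_mixin_compat1.
    change (Cmod (@sum_n C_AbelianMonoid (fun k =>
      @scal C_AbsRing C_NormedModule (@pow_n C_Ring z k) (a k)) d - l) < eps)%R.
    rewrite E. apply HN. lia.
Qed.

Lemma l2_ex_series (a : nat -> C) :
  (exists S, l2 a S) <-> ex_series (fun n => (Cmod (a n) ^ 2)%R).
Proof.
  split.
  - intros (S0 & HS).
    destruct (ex_finite_lim_seq_incr (sum_n (fun n => (Cmod (a n) ^ 2)%R)) S0) as (l & Hl).
    + intros n. rewrite !sum_n_rsum. apply rsum_mono_len; [|lia].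
      intros; apply pow2_ge_0.
    + intros n. rewrite sum_n_rsum. apply HS.
    + exists l. exact Hl.
  - intros (l & Hl). exists l. intros N.
    apply Rle_trans with (sum_n (fun n => (Cmod (a n) ^ 2)%R) N).
    + rewrite sum_n_rsum. apply rsum_mono_len; [|lia]. intros; apply pow2_ge_0.
    + apply (is_lim_seq_incr_compare (sum_n (fun n => (Cmod (a n) ^ 2)%R)) l); [exact Hl|].
      intros n. rewrite !sum_n_rsum. apply rsum_mono_len; [|lia].
      intros; apply pow2_ge_0.
Qed.

Lemma inH2_iff (f : C -> C) :
  inH2 f <-> exists a S, l2 a S /\ forall z, inD z -> pser a z (f z).
Proof.
  split.
  - intros (a & Ha & Hf). apply l2_ex_series in Ha. destruct Ha as (S0 & HS).
    exists a, S0. split; auto. intros z Hz. now apply is_pseries_pser, Hf.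
  - intros (a & S0 & HS & Hf). exists a. split.
    + apply l2_ex_series. now exists S0.
    + intros z Hz. apply is_pseries_pser. auto.
Qed.

Lemma l2_bounded (a : nat -> C) (S0 : R) (k : nat) : l2 a S0 -> (Cmod (a k) <= S0 + 1)%R.
Proof.
  intros H. specialize (H (S k)).
  assert (Hk : (Cmod (a k) ^ 2 <= S0)%R).
  { eapply Rle_trans; [|exact H].
    apply (rsum_ge_term (S k) k (fun k => Cmod (a k) ^ 2)%R); [|lia].
    intros; apply pow2_ge_0. }
  pose proof (pow2_ge_0 (Cmod (a k))). pose proof (Cmod_ge_0 (a k)). nra.
Qed.

Lemma pser_unit0 (z : C) : pser unit0 z 1.
Proof.
  intros eps Heps. exists 1%nat. intros d Hd. destruct d as [|d]; [lia|].
  unfold peval. rewrite csum_first, csum_0.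
  - simpl. replace (1 * 1 + 0 - 1) with (RtoC 0) by ring. now rewrite Cmod_0.
  - intros k _. simpl. ring.
Qed.

Lemma inH2_lin (c : C) (f g : C -> C) :
  inH2 f -> inH2 g -> inH2 (fun z => f z + c * g z).
Proof.
  rewrite !inH2_iff. intros (a & S1 & Ha & Hf) (b & S2 & Hb & Hg).
  exists (fun k => a k + c * b k), (2 * S1 + 2 * Cmod c ^ 2 * S2)%R. split.
  - intros N.
    apply Rle_trans with (rsum N (fun k =>
      2 * Cmod (a k) ^ 2 + 2 * Cmod c ^ 2 * Cmod (b k) ^ 2)%R).
    + apply rsum_le. intros k _. eapply Rle_trans; [apply Cmod_sqr_plus_le|].
      rewrite Cmod_mult, Rpow_mult_distr. lra.
    + rewrite rsum_plus, !rsum_scal_l. specialize (Ha N). specialize (Hb N).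
      assert (0 <= 2 * Cmod c ^ 2)%R by (pose proof (pow2_ge_0 (Cmod c)); lra).
      apply Rplus_le_compat; apply Rmult_le_compat_l; lra.
  - intros z Hz.
    pose proof (ccv_plus _ _ _ _ (Hf z Hz) (ccv_mult _ _ _ _ (ccv_const c) (Hg z Hz))) as H.
    eapply ccv_ext; [|exact H]. intros d. unfold peval. simpl.
    rewrite <- csum_scal_l, <- csum_plus. apply csum_ext. intros k _. ring.
Qed.

Lemma inH2_0 : inH2 (fun _ => 0).
Proof.
  apply inH2_iff. exists (fun _ => 0), 0%R. split.
  - intros N. rewrite (rsum_ext N _ (fun _ => 0%R)) by (intros; rewrite Cmod_0; ring).
    rewrite rsum_const. lra.
  - intros z _. apply (ccv_ext (fun _ => 0)); [|apply ccv_const].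
    intros d. unfold peval. rewrite csum_0; auto. intros; ring.
Qed.

Lemma inK_lin (c : C) (f g : C -> C) : inK f -> inK g -> inK (fun z => f z + c * g z).
Proof.
  intros (Sf & (Hf & cf & gf & Hgf & Ef) & Mf & Bf) (Sg & (Hg & cg & gg & Hgg & Eg) & Mg & Bg).
  split; [|split].
  - intros z Hz. rewrite Sf, Sg by auto. ring.
  - split; [now apply inH2_lin|].
    exists (cf + c * cg), (fun z => gf z + c * gg z). split; [now apply inH2_lin|].
    intros z Hz. rewrite Ef, Eg by auto. ring.
  - exists (Mf + Cmod c * Mg)%R. intros z Hz.
    eapply Rle_trans; [apply Cmod_triangle|]. rewrite Cmod_mult.
    apply Rplus_le_compat; [auto|]. apply Rmult_le_compat_l; auto. apply Cmod_ge_0.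
Qed.

Lemma inK_0 : inK (fun _ => 0).
Proof.
  split; [|split].
  - now intros z.
  - split; [apply inH2_0|]. exists 0, (fun _ => 0). split; [apply inH2_0|].
    intros; ring.
  - exists 0%R. intros. rewrite Cmod_0. lra.
Qed.

Lemma inK_plus (f g : C -> C) : inK f -> inK g -> inK (fun z => f z + g z).
Proof.
  intros Hf Hg.
  replace (fun z => f z + g z) with (fun z => f z + 1 * g z); [now apply inK_lin|].
  apply functional_extensionality. intros z. ring.
Qed.

Lemma inK_scal (c : C) (g : C -> C) : inK g -> inK (fun z => c * g z).
Proof.
  intros Hg.
  replace (fun z => c * g z) with (fun z => 0 + c * g z).
  - apply (inK_lin c (fun _ => 0)); auto using inK_0.
  - apply functional_extensionality. intros z. ring.
Qed.

Lemma inK_csum (n : nat) (g : nat -> C -> C) :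
  (forall i, (i < n)%nat -> inK (g i)) -> inK (fun z => csum n (fun i => g i z)).
Proof.
  induction n as [|n IH]; intros H; simpl; [apply inK_0|]. apply inK_plus; auto.
Qed.

(* The unit of K: constants are cut off outside the disc. *)
Definition oneD (z : C) : C :=
  if excluded_middle_informative (inD z) then 1 else 0.

Lemma inK_oneD : inK oneD.
Proof.
  assert (H1 : forall z, inD z -> oneD z = 1).
  { intros z Hz. unfold oneD. now destruct (excluded_middle_informative (inD z)). }
  split; [|split].
  - intros z Hz. unfold oneD. now destruct (excluded_middle_informative (inD z)).
  - split.
    + apply inH2_iff. exists unit0, 1%R. split.
      * intros N. destruct N as [|N]; [simpl; lra|].
        induction N as [|N IH]; [simpl; rewrite Cmod_1; lra|].
        change (rsum (S N) (fun k => Cmod (unit0 k) ^ 2) + Cmod 0 ^ 2 <= 1)%R.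
        rewrite Cmod_0. lra.
      * intros z Hz. rewrite H1 by auto. apply pser_unit0.
    + exists 1, (fun _ => 0). split; [apply inH2_0|].
      intros z Hz. rewrite H1 by auto. ring.
  - exists 1%R. intros z Hz. rewrite H1, Cmod_1 by auto. lra.
Qed.

Lemma inH2_mult (f H : C -> C) (h : nat -> C) (K A : R) :
  (forall k, (Cmod (h k) <= A)%R) -> (0 <= K)%R ->
  (forall (u : nat -> C) t,
     (rsum t (fun s => Cmod (conv h u s) ^ 2) <= K * rsum t (fun s => Cmod (u s) ^ 2))%R) ->
  (forall z, inD z -> pser h z (H z)) ->
  inH2 f -> inH2 (fun z => f z * H z).
Proof.
  rewrite !inH2_iff. intros HA HK Hmul HH (a & S0 & Ha & Hf).
  exists (conv h a), (K * S0)%R. split.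
  - intros N. eapply Rle_trans; [apply Hmul|]. apply Rmult_le_compat_l; auto.
  - intros z Hz. rewrite Cmult_comm.
    apply (pser_conv h a A (S0 + 1)); auto.
    intros k. now apply l2_bounded.
Qed.

Lemma inH2_mult_bounded (f g : C -> C) :
  inH2 f -> inH2 g -> bounded_D g -> inH2 (fun z => f z * g z).
Proof.
  intros Hf Hg (M & HM). apply inH2_iff in Hg. destruct Hg as (a & S0 & Ha & Hag).
  assert (Hb : forall k, (Cmod (a k) <= S0 + 1)%R) by (intros k; now apply l2_bounded).
  apply (inH2_mult f g a ((M + 1) ^ 2) (S0 + 1)); auto; [apply pow2_ge_0|].
  now apply (bounded_multiplier M (S0 + 1) a g).
Qed.

Lemma inK_mult (f g : C -> C) : inK f -> inK g -> inK (fun z => f z * g z).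
Proof.
  intros (Sf & (Hf & cf & f1 & Hf1 & Ef) & Mf & Bf) (Sg & (Hg & cg & g1 & Hg1 & Eg) & Mg & Bg).
  assert (HBg : bounded_D g) by now exists Mg.
  split; [|split].
  - intros z Hz. rewrite Sf by auto. ring.
  - split; [now apply inH2_mult_bounded|].
    (* From f g = cf g + (z - 1) f1 g with g expanded in the first term; f1 g is in H^2 because g is
       bounded. *)
    exists (cf * cg), (fun z => f1 z * g z + cf * g1 z). split.
    + apply inH2_lin; auto. now apply inH2_mult_bounded.
    + intros z Hz. rewrite Ef, Eg by auto. ring.
  - exists (Mf * Mg)%R. intros z Hz. rewrite Cmod_mult.
    apply Rmult_le_compat; auto using Cmod_ge_0.
Qed.

(** * The boundary value at 1 *)

(** Cauchy-Schwarz in arithmetic-geometric form with a free parameter tau; it implies that (1 - r)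
    g(r) tends to 0. *)
Lemma H2_radial_growth (g : C -> C) :
  inH2 g -> exists S0, (0 <= S0)%R /\ forall (tau r : R), (0 < tau)%R -> (0 <= r < 1)%R ->
    ((1 - r) * Cmod (g (RtoC r)) <= / 2 * (tau * S0 * (1 - r) + / tau))%R.
Proof.
  rewrite inH2_iff. intros (a & S0 & Ha & Hg). exists S0.
  assert (HS0 : (0 <= S0)%R) by apply (Ha O).
  split; auto. intros tau r Htau Hr.
  assert (Hti : (0 < / tau)%R) by now apply Rinv_0_lt_compat.
  assert (Hz : inD (RtoC r)) by (unfold inD; rewrite Cmod_R, Rabs_pos_eq; lra).
  assert (Hb : (Cmod (g (RtoC r)) <= / 2 * (tau * S0 + / tau * / (1 - r)))%R).
  { apply (ccv_Cmod_le (fun d => peval d a (RtoC r)) _ _ O); [|apply Hg; auto].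
    intros d _. unfold peval. eapply Rle_trans; [apply Cmod_csum_le|].
    apply Rle_trans with (rsum d (fun k =>
      / 2 * (tau * Cmod (a k) ^ 2 + / tau * r ^ k))%R).
    - apply rsum_le. intros k _. rewrite Cmod_mult, Cmod_pow, Cmod_R, Rabs_pos_eq by lra.
      apply amgm; auto; [lra|].
      assert (0 <= r ^ k)%R by (apply pow_le; lra).
      assert (r ^ k <= 1)%R by (rewrite <- (pow1 k); apply pow_incr; lra). nra.
    - rewrite rsum_scal_l, rsum_plus, !rsum_scal_l.
      specialize (Ha d). pose proof (rsum_geom_le r d Hr).
      assert (tau * rsum d (fun k => Cmod (a k) ^ 2) <= tau * S0)%R
        by (apply Rmult_le_compat_l; lra).
      assert (/ tau * rsum d (fun k => r ^ k) <= / tau * / (1 - r))%R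
        by (apply Rmult_le_compat_l; lra).
      change (rsum d (pow r)) with (rsum d (fun k => r ^ k)%R). lra. }
  apply (Rmult_le_compat_l (1 - r)) in Hb; [|lra].
  eapply Rle_trans; [exact Hb|]. right. field. lra.
Qed.

Lemma val1_eq (f g : C -> C) (c : C) :
  inH2 g -> (forall z, inD z -> f z = c + (z - 1) * g z) -> val1 f = c.
Proof.
  intros Hg Hf.
  assert (Hlim : filterlim (fun r : R => f (RtoC r)) (at_left 1%R) (locally c)).
  { apply filterlim_locally. intros eps. pose proof (cond_pos eps) as Heps.
    destruct (H2_radial_growth g Hg) as (S0 & HS0 & Hgr).
    assert (Hd : (0 < Rmin 1 (eps ^ 2 / (S0 + 1)))%R).
    { apply Rmin_pos; [lra|]. apply Rdiv_lt_0_compat; [apply pow_lt; lra|lra]. }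
    exists (mkposreal _ Hd). intros r Hr Hr1.
    assert (Hr2 : (Rabs (r - 1) < Rmin 1 (eps ^ 2 / (S0 + 1)))%R) by exact Hr.
    rewrite Rabs_left in Hr2 by lra.
    assert (H1 := Rlt_le_trans _ _ _ Hr2 (Rmin_l _ _)).
    assert (H2 := Rlt_le_trans _ _ _ Hr2 (Rmin_r _ _)).
    apply C_NormedModule_mixin_compat1.
    change (Cmod (f (RtoC r) - c) < eps)%R.
    rewrite Hf by (unfold inD; rewrite Cmod_R, Rabs_pos_eq; lra).
    replace (c + (RtoC r - 1) * g (RtoC r) - c) with (RtoC (r - 1)%R * g (RtoC r))
      by (rewrite RtoC_minus; ring).
    rewrite Cmod_mult, Cmod_R, Rabs_left by lra.
    replace (- (r - 1))%R with (1 - r)%R by ring.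
    (* With tau = 1/eps the bound reads (S0 (1 - r) / eps + eps) / 2, which is below eps once S0 (1
       - r) < eps^2. *)
    eapply Rle_lt_trans; [apply (Hgr (/ eps)%R r); [now apply Rinv_0_lt_compat|lra]|].
    rewrite Rinv_inv.
    apply (Rmult_lt_compat_r (S0 + 1)) in H2; [|lra].
    replace (eps ^ 2 / (S0 + 1) * (S0 + 1))%R with (eps ^ 2)%R in H2 by (field; lra).
    assert (S0 * (1 - r) < eps ^ 2)%R by nra.
    assert (/ eps * (S0 * (1 - r)) < eps)%R.
    { apply Rmult_lt_reg_l with eps; auto.
      rewrite <- Rmult_assoc, Rinv_r by lra. lra. }
    lra. }
  unfold val1.
  apply (filterlim_locally_unique (V := C_NormedModule) (F := at_left 1%R)
    (fun r : R => f (RtoC r))); auto.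
  exact (epsilon_spec (inhabits (RtoC 0)) (fun c => filterlim (fun r : R => f (RtoC r))
    (at_left 1%R) (locally c)) (ex_intro _ c Hlim)).
Qed.

(** * Corona solutions over K and density of the evaluations *)

Lemma uniform_bound (n : nat) (P : nat -> R -> Prop) :
  (forall i (x y : R), (x <= y)%R -> P i x -> P i y) ->
  (forall i, (i < n)%nat -> exists x, P i x) ->
  exists x, (0 <= x)%R /\ forall i, (i < n)%nat -> P i x.
Proof.
  intros Hmono. induction n as [|n IH]; intros H.
  - exists 0%R. split; [lra|]. intros i Hi. lia.
  - destruct IH as (x & Hx & HP); auto. destruct (H n) as (y & Hy); auto.
    exists (Rmax x y). split; [eapply Rle_trans; [exact Hx|apply Rmax_l]|].
    intros i Hi. destruct (Nat.eq_dec i n) as [->|Hne].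
    + apply (Hmono n y); auto. apply Rmax_r.
    + apply (Hmono i x); [apply Rmax_l|]. apply HP. lia.
Qed.

(** The H_i are bounded multipliers of H^2, so u H_i is bounded and in H^2. It equals 0 + (z - 1) (g
    H_i) with g H_i in H^2, which is the decomposition required in K, with value 0 at 1. *)
Lemma corona_K (n : nat) (F : nat -> C -> C) (m : R) (u g : C -> C) :
  (0 < m)%R -> (forall i, (i < n)%nat -> inK (F i)) ->
  (forall z, inD z -> (m <= rsum n (fun i => Cmod (F i z) ^ 2))%R) ->
  inK u -> inH2 g -> (forall z, inD z -> u z = (z - 1) * g z) ->
  exists H : nat -> C -> C,
    (forall i, (i < n)%nat -> inK (fun z => u z * H i z)) /\
    forall z, inD z -> csum n (fun i => F i z * H i z) = 1.
Proof.
  intros Hm HF HFm Hu Hg Hug.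
  assert (Hco : forall i, exists a, (i < n)%nat ->
    (exists S0, l2 a S0) /\ forall z, inD z -> pser a z (F i z)).
  { intros i. destruct (Nat.lt_ge_cases i n) as [Hi|Hi].
    - destruct (HF i Hi) as (_ & (H2 & _) & _). apply inH2_iff in H2.
      destruct H2 as (a & S0 & HS & Ha). exists a. intros _. split; eauto.
    - exists (fun _ => 0). lia. }
  set (a i := proj1_sig (constructive_indefinite_description _ (Hco i))).
  assert (Ha : forall i, (i < n)%nat ->
    (exists S0, l2 (a i) S0) /\ forall z, inD z -> pser (a i) z (F i z)).
  { intros i. unfold a. now destruct (constructive_indefinite_description _ (Hco i)). }
  destruct (uniform_bound n (fun i A => forall k, (Cmod (a i k) <= A)%R)) as (A & HA0 & HA).
  { intros i x y Hxy H k. specialize (H k). lra. }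
  { intros i Hi. destruct (Ha i Hi) as ((S0 & HS) & _). exists (S0 + 1)%R.
    intros k. now apply l2_bounded. }
  destruct (uniform_bound n (fun i M => forall z, inD z -> (Cmod (F i z) <= M)%R))
    as (M & HM & HFM).
  { intros i x y Hxy H z Hz. specialize (H z Hz). lra. }
  { intros i Hi. apply (HF i Hi). }
  destruct (corona_coefficients n M m A a F HM Hm) as (h & K & HK & Hbez & Hmul).
  { intros i k Hi. now apply HA. }
  { intros i z Hi Hz. now apply Ha. }
  { intros i z Hi Hz. now apply HFM. }
  { exact HFm. }
  assert (Hhb : forall i k, (i < n)%nat -> (Cmod (h i k) <= K + 1)%R).
  { intros i k Hi. apply l2_bounded. intros N.
    pose proof (Hmul i unit0 N Hi) as H.
    rewrite (rsum_ext N _ (fun s => Cmod (h i s) ^ 2)%R) in H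
      by (intros; now rewrite conv_unit0).
    eapply Rle_trans; [exact H|]. rewrite <- (Rmult_1_r K) at 2.
    apply Rmult_le_compat_l; auto. clear. destruct N as [|N]; [simpl; lra|].
    induction N as [|N IH]; [simpl; rewrite Cmod_1; lra|].
    change (rsum (S N) (fun k => Cmod (unit0 k) ^ 2) + Cmod 0 ^ 2 <= 1)%R.
    rewrite Cmod_0. lra. }
  assert (HHex : forall i z, exists l, (i < n)%nat -> inD z -> pser (h i) z l).
  { intros i z. destruct (Nat.lt_ge_cases i n) as [Hi|Hi]; [|exists 0; lia].
    destruct (excluded_middle_informative (inD z)) as [Hz|Hz]; [|exists 0; tauto].
    destruct (pser_ex (h i) (K + 1) z) as (l & Hl); auto. now exists l. }
  set (H i z := proj1_sig (constructive_indefinite_description _ (HHex i z))).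
  assert (HH : forall i z, (i < n)%nat -> inD z -> pser (h i) z (H i z)).
  { intros i z. unfold H. now destruct (constructive_indefinite_description _ (HHex i z)). }
  exists H. split.
  - intros i Hi. destruct Hu as (Su & (Hu2 & _) & Mu & Bu). split; [|split].
    + intros z Hz. rewrite Su by auto. ring.
    + split.
      * apply (inH2_mult u (H i) (h i) K (K + 1)); auto.
      * exists 0, (fun z => g z * H i z). split.
        -- apply (inH2_mult g (H i) (h i) K (K + 1)); auto.
        -- intros z Hz. rewrite Hug by auto. ring.
    + exists (Mu * (K + 1))%R. intros z Hz. rewrite Cmod_mult.
      apply Rmult_le_compat; auto using Cmod_ge_0.
      apply (multiplier_bounded (h i) K (K + 1) z); auto.
  (* By [Hbez] the Cauchy products of h_i and a_i add up to [unit0], the coefficient sequence of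
     1. *)
  - intros z Hz. apply (ccv_unique (fun d => peval d unit0 z)); [|apply pser_unit0].
    apply (ccv_ext (fun d => csum n (fun i => peval d (conv (h i) (a i)) z))).
    + intros d. unfold peval. rewrite csum_swap. apply csum_ext. intros s _.
      rewrite csum_scal_r, <- Hbez, csum_swap. f_equal. apply csum_ext. intros i _.
      apply csum_ext. intros k _. ring.
    + apply (ccv_csum n (fun d i => peval d (conv (h i) (a i)) z)). intros i Hi.
      rewrite Cmult_comm. apply (pser_conv (h i) (a i) (K + 1) A); auto.
      now apply Ha.
Qed.

Lemma character_csum (phi : (C -> C) -> C) (n : nat) (g : nat -> C -> C) :
  is_character phi -> (forall i, (i < n)%nat -> inK (g i)) ->
  phi (fun z => csum n (fun i => g i z)) = csum n (fun i => phi (g i)).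
Proof.
  intros (Hadd & Hscal & _). induction n as [|n IH]; intros H; simpl.
  - pose proof (Hscal 0 _ inK_0) as H0. rewrite Cmult_0_l in H0.
    transitivity (phi (fun _ => 0 * 0)); [|exact H0].
    f_equal. apply functional_extensionality. intros z. ring.
  - rewrite (Hadd (fun z => csum n (fun i => g i z))), IH; auto.
    apply inK_csum. auto.
Qed.

Lemma character_oneD (phi : (C -> C) -> C) : is_character phi -> phi oneD = 1.
Proof.
  intros (_ & _ & Hmul & f & Hf & Hne).
  pose proof (Hmul oneD f inK_oneD Hf) as H.
  replace (fun z => oneD z * f z) with f in H.
  - replace (phi oneD) with (phi oneD * phi f / phi f) by (field; auto).
    rewrite <- H. field. auto.
  - apply functional_extensionality. intros z. unfold oneD.
    destruct (excluded_middle_informative (inD z)) as [Hz|Hz]; [ring|].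
    destruct Hf as (Sf & _). rewrite Sf by auto. ring.
Qed.

(* Weak-* density: every basic weak-* neighbourhood of a character phi
   (given by finitely many f_0..f_{n-1} in K and eps > 0) contains an
   evaluation functional at a point of D ∪ {1}. *)
Theorem theorem2p4 (phi : (C -> C) -> C) :
  is_character phi ->
  forall (n : nat) (fs : nat -> C -> C) (eps : R),
    (0 < eps)%R ->
    (forall i, (i < n)%nat -> inK (fs i)) ->
    exists z : C, (inD z \/ z = RtoC 1%R) /\
      forall i, (i < n)%nat -> (Cmod (ptval (fs i) z - phi (fs i)) < eps)%R.
Proof.
  intros Hphi n fs eps Heps Hfs.
  pose proof (character_oneD phi Hphi) as H1.
  pose proof Hphi as (Hadd & Hscal & Hmul & _).
  assert (Hsub : forall c f, inK f ->
    inK (fun z => f z + - c * oneD z) /\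
    phi (fun z => f z + - c * oneD z) = phi f - c).
  { intros c f Hf. split; [apply inK_lin; auto using inK_oneD|].
    rewrite (Hadd f (fun z => - c * oneD z)), Hscal, H1; auto using inK_oneD, inK_scal.
    ring. }
  assert (HoneD : forall z, inD z -> oneD z = 1).
  { intros z Hz. unfold oneD. now destruct (excluded_middle_informative (inD z)). }
  destruct (excluded_middle_informative
    (exists u g, inK u /\ inH2 g /\ (forall z, inD z -> u z = (z - 1) * g z) /\ phi u <> 0))
    as [(u & g & Hu & Hg & Hug & Hphiu)|Hno].
  - apply NNPP. intros Hcon. apply Hphiu.
    set (F i z := fs i z + - phi (fs i) * oneD z).
    assert (HF : forall i, (i < n)%nat -> inK (F i)) by (intros i Hi; now apply Hsub, Hfs).
    destruct (corona_K n F (eps ^ 2) u g) as (H & HuH & Hbez); auto.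
    { now apply pow_lt. }
    { intros z Hz. apply Rnot_lt_le. intros Hlt. apply Hcon. exists z. split; auto.
      intros i Hi. unfold ptval. destruct (excluded_middle_informative (z = RtoC 1)) as [->|_].
      { unfold inD in Hz. rewrite Cmod_1 in Hz. lra. }
      replace (fs i z - phi (fs i)) with (F i z)
        by (unfold F; rewrite HoneD by auto; ring).
      apply Rnot_le_lt. intros Hle.
      assert (eps ^ 2 <= Cmod (F i z) ^ 2)%R by (apply pow_incr; lra).
      pose proof (rsum_ge_term n i (fun i => Cmod (F i z) ^ 2)%R
        ltac:(intros; apply pow2_ge_0) Hi). simpl in *. lra. }
    replace u with (fun z => csum n (fun i => F i z * (u z * H i z))).
    + rewrite (character_csum phi n (fun i z => F i z * (u z * H i z))); auto.
      * apply csum_0. intros i Hi. rewrite (Hmul (F i)) by auto.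
        unfold F. rewrite (proj2 (Hsub _ _ (Hfs i Hi))). ring.
      * intros i Hi. apply inK_mult; auto.
    + apply functional_extensionality. intros z.
      destruct (excluded_middle_informative (inD z)) as [Hz|Hz].
      * rewrite (csum_ext n _ (fun i => u z * (F i z * H i z))) by (intros; ring).
        rewrite csum_scal_l, Hbez by auto. ring.
      * destruct Hu as (Su & _). rewrite Su by auto. apply csum_0. intros; ring.
  (* Here phi vanishes on the ideal. Subtracting c from f_i leaves (z - 1) g with the same g, so
     phi(f_i) = c, and c is the radial limit by [val1_eq]. *)
  - exists 1. split; [now right|]. intros i Hi.
    unfold ptval. destruct (excluded_middle_informative (RtoC 1 = RtoC 1)); [|tauto].
    destruct (Hfs i Hi) as (_ & (_ & c & g & Hg & Hfg) & _).
    rewrite (val1_eq (fs i) g c) by auto.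
    destruct (Hsub c (fs i) (Hfs i Hi)) as (HK & Hv).
    assert (Hz : phi (fs i) - c = 0).
    { rewrite <- Hv. apply NNPP. intros Hne. apply Hno.
      exists (fun z => fs i z + - c * oneD z), g. repeat split; auto; try apply HK.
      intros z Hz. rewrite Hfg, HoneD by auto. ring. }
    replace (c - phi (fs i)) with (- (phi (fs i) - c)) by ring.
    rewrite Hz, Cmod_opp, Cmod_0. exact Heps.
Qed.
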